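(* Let $(X,\omega)$ be a connected parasymplectic diffeological space such that the group of toric periods $P_{\mathrm{tor}}$ is discrete and the total group of periods satisfies $P_\omega\neq\mathbf{R}$. Let $\mathbf{T}_\omega$ be its prequantum groupoid, with $\mathrm{Obj}(\mathbf{T}_\omega)=X$, space of morphisms $\mathscr{Y}=\mathrm{Paths}(X)/\!\sim_\omega$, composition $[\gamma]_\omega\cdot[\gamma']_\omega=[\gamma\vee\gamma']_\omega$, and let $\mathrm{class}_\omega:\mathrm{Paths}(X)\to\mathscr{Y}$ be the quotient projection. Then: 1. $\mathbf{T}_\omega$ is a fibrating diffeological groupoid over $X$, meaning that the projection $\mathrm{ends}=(\mathrm{src},\mathrm{trg}):\mathscr{Y}\to X\times X$ is a subduction. 2. For every $x\in X$, the isotropy group $\mathbf{T}_{\omega,x}$ of $\mathbf{T}_\omega$ at $x$ is isomorphic to the torus of periods $T_\omega=\mathbf{R}/P_\omega$. 3. There exists a unique left-right invariant differential $1$-form $\boldsymbol{\lambda}$ on $\mathscr{Y}$ (the prequantum $1$-form) such that $\mathrm{class}_\omega^*(\boldsymbol{\lambda})=\mathbf{K}\omega$. 4. $d\boldsymbol{\lambda}=\mathrm{trg}^*(\omega)-\mathrm{src}^*(\omega)$.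
   Context: All spaces are diffeological spaces (subspaces, quotients and spaces of smooth maps carry the subset, quotient and functional diffeologies); differential forms are in the diffeological sense. A parasymplectic diffeological space $(X,\omega)$ is a diffeological space $X$ with a closed $2$-form $\omega$. Connectedness and connected components are with respect to smooth paths. **Paths.** $\mathrm{Paths}(X)=C^\infty(\mathbf{R},X)$, $\mathrm{ends}(\gamma)=(\gamma(0),\gamma(1))$. $\mathrm{Loops}(X)=\{\gamma:\gamma(0)=\gamma(1)\}$, and $\mathrm{Loops}(X,x_0)$ is the subspace of loops with $\gamma(0)=\gamma(1)=x_0$. $\hat x$ is the constant path at $x$; $\bar\gamma(t)=\gamma(1-t)$. For $\gamma(1)=\gamma'(0)$, $\gamma\vee\gamma'$ is the concatenation ($\gamma$ first), made smooth in the usual way: for a fixed smooth smashing function $s:\mathbf{R}\to[0,1]$ with $s=0$ on $]-\infty,\varepsilon]$ and $s=1$ on $[1-\varepsilon,\infty[$, one sets $(\gamma\vee\gamma')(t)=\gamma(s(2t))$ for $t\le 1/2$ and $\gamma'(s(2t-1))$ for $t\ge 1/2$. **The form $\mathbf{K}\omega$.** $\mathbf{K}:\Omega^k(X)\to\Omega^{k-1}(\mathrm{Paths}(X))$ is the chain-homotopy operator, satisfying $\mathbf{K}\circ d+d\circ\mathbf{K}=\hat 1^*-\hat 0^*$ with $\hat t(\gamma)=\gamma(t)$. For the $2$-form $\omega$ and a plot $P:U\to\mathrm{Paths}(X)$, $(\mathbf{K}\omega)(P)_r(v)=\int_0^1\omega\big((t,r)\mapsto P(r)(t)\big)_{(t,r)}\big((1,0),(0,v)\big)\,dt$.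 For a path $\sigma$ in $\mathrm{Paths}(X)$, $\int_\sigma\mathbf{K}\omega=\int_0^1\mathbf{K}\omega(\sigma)_s(1)\,ds$. The restriction of $\mathbf{K}\omega$ to $\mathrm{Loops}(X)$ is closed. **Toric periods.** $P_{\mathrm{tor}}\subset\mathbf{R}$ is the subgroup generated by all $\int_\sigma\mathbf{K}\omega$, where $\sigma$ runs over the loops in the connected components of $\mathrm{Loops}(X)$. It is assumed discrete (discrete subset diffeology; for a subgroup of $\mathbf{R}$ this is the same as being $\neq\mathbf{R}$). $T_{\mathrm{tor}}=\mathbf{R}/P_{\mathrm{tor}}$, $\pi_{\mathrm{tor}}:\mathbf{R}\to T_{\mathrm{tor}}$ the projection. **Surfacic cocycle.** Fix $x_0\in X$. Let $\mathscr{I}=\pi_0(\mathrm{Loops}(X,x_0))=\pi_1(X,x_0)$ with the group law $*$ induced by concatenation and identity $1$. Fix a basis of loops $\{\ell_i\}_{i\in\mathscr{I}}$: $\ell_i\in\mathrm{Loops}(X,x_0)$ belongs to the component $i$, and $\ell_1=\hat x_0$. For $\ell,\ell'$ in the same component of $\mathrm{Loops}(X,x_0)$, $\int_\ell^{\ell'}\mathbf{K}\omega$ is the integral along any path from $\ell$ to $\ell'$ in this component; it is well defined modulo $P_{\mathrm{tor}}$. Set $\tau(i,j)=\pi_{\mathrm{tor}}\big(\int_{\ell_{i*j}}^{\ell_i\vee\ell_j}\mathbf{K}\omega\big)\in T_{\mathrm{tor}}$. **Total group of periods.** $\tilde\Gamma=\mathscr{I}\times T_{\mathrm{tor}}$ with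 the law $(i,u)\cdot(j,v)=(i*j,\,u+v+\tau(i,j))$. Let $F(\mathscr{I})$ be the free group on the set $\mathscr{I}$, $\Psi:F(\mathscr{I})\to\tilde\Gamma$ the homomorphism with $\Psi(i)=(i,0)$ on generators, and $\mathscr{R}$ the set of relations, i.e. the kernel of the natural homomorphism $F(\mathscr{I})\to\mathscr{I}$. For $w\in\mathscr{R}$ define $\mathcal{T}(w)\in T_{\mathrm{tor}}$ by $\Psi(w)=(1,\mathcal{T}(w))$. Let $H_{\mathrm{surf}}\subset T_{\mathrm{tor}}$ be the subgroup generated by $\{\mathcal{T}(w):w\in\mathscr{R}\}$. Then $P_\omega=\pi_{\mathrm{tor}}^{-1}(H_{\mathrm{surf}})\subset\mathbf{R}$, assumed $\neq\mathbf{R}$; $T_\omega=\mathbf{R}/P_\omega$ and $\pi_\omega:\mathbf{R}\to T_\omega$ is the projection. **Groupoid.** For $\ell\in\mathrm{Loops}(X,x_0)$ in the component $i$, put $\psi(\ell)=\pi_\omega\big(\int_{\ell_i}^{\ell}\mathbf{K}\omega\big)\in T_\omega$. For $\gamma,\gamma'\in\mathrm{Paths}(X)$ with $\mathrm{ends}(\gamma)=\mathrm{ends}(\gamma')$, put $\Phi(\gamma,\gamma')=\psi\big(\delta\vee(\gamma\vee\bar\gamma')\vee\bar\delta\big)$, where $\delta$ is any path from $x_0$ to $\gamma(0)$ (the value does not depend on $\delta$). Define $\gamma\sim_\omega\gamma'$ iff $\mathrm{ends}(\gamma)=\mathrm{ends}(\gamma')$ and $\Phi(\gamma,\gamma')=0$.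 $\mathbf{T}_\omega$ has objects $X$, morphisms $\mathscr{Y}=\mathrm{Paths}(X)/\!\sim_\omega$, $\mathrm{src}([\gamma]_\omega)=\gamma(0)$, $\mathrm{trg}([\gamma]_\omega)=\gamma(1)$, and $[\gamma]_\omega\cdot[\gamma']_\omega=[\gamma\vee\gamma']_\omega$ when $\gamma(1)=\gamma'(0)$. The isotropy group at $x$ is $\mathbf{T}_{\omega,x}=\{y\in\mathscr{Y}:\mathrm{src}(y)=\mathrm{trg}(y)=x\}$. **Invariance.** A $1$-form $\boldsymbol{\lambda}$ on $\mathscr{Y}$ is left-right invariant if for every $y\in\mathscr{Y}$ the left multiplication $z\mapsto y\cdot z$, from $\mathrm{src}^{-1}(\mathrm{trg}(y))$ to $\mathrm{src}^{-1}(\mathrm{src}(y))$, and the right multiplication $z\mapsto z\cdot y$, from $\mathrm{trg}^{-1}(\mathrm{src}(y))$ to $\mathrm{trg}^{-1}(\mathrm{trg}(y))$, pull back the restriction of $\boldsymbol{\lambda}$ on the target to the restriction of $\boldsymbol{\lambda}$ on the source.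
   Formalization: Item 2 (isotropy isomorphic to the torus of periods) is stated for ω ≠ 0 only: for ω = 0, e.g. X a point, P_ω = {0} and T_ω = R, while every isotropy group is trivial, so the claim fails. Items 1, 3 and 4 are unrestricted. *)

(* Defs.v *)
From HB Require Import structures.
From mathcomp Require Import all_boot all_order all_algebra.
From mathcomp Require Import all_classical all_reals all_analysis.
From mathcomp Require Import ring lra.
Set Implicit Arguments.
Unset Strict Implicit.
Unset Printing Implicit Defensive.
Import Order.TTheory GRing.Theory Num.Theory.
Import numFieldNormedType.Exports.
Local Open Scope classical_set_scope.
Local Open Scope ring_scope.

Section Smooth.
Context {R : realType}.
Implicit Types V W : normedModType R.

Fixpoint Ck (k : nat) V W (U : set V) (f : V -> W) : Prop :=
  if k is k'.+1
  then (forall x, U x -> differentiable f x) /\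
       (forall v, Ck k' U (fun x => 'D_v f x))
  else forall x, U x -> {for x, continuous f}.

Definition smooth V W (U : set V) (f : V -> W) : Prop := forall k, Ck k U f.

Lemma near_eq_differentiable V W (f g : V -> W) (x : V) :
  (\forall y \near x, f y = g y) -> differentiable g x -> differentiable f x.
Proof.
move=> fg dg; have fgx : f x = g x := nbhs_singleton fg.
suff H : f \o shift x = cst (f x) + 'd g x +o_ 0 id.
  apply/diff_locallyP; have c : continuous ('d g x) by exact: diff_continuous.
  by rewrite (diff_unique c H).
apply/eqaddoP => _/posnumP[e]; near=> y.
rewrite (_ : (f \o shift x - _) y = (g \o shift x - (cst (g x) + 'd g x)) y).
  near: y; move/diff_locally/eqaddoP : dg; apply => //.
rewrite !fctE /= fgx; congr (_ - _); near: y.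
by move: fg; rewrite (near_shift 0) subr0.
Unshelve. all: by end_near. Qed.

Lemma Ck_local k V W (U : set V) (f : V -> W) :
  (forall x, U x -> exists B (g : V -> W),
     [/\ open B, B x, Ck k B g & forall y, B y -> f y = g y]) -> Ck k U f.
Proof.
have N (B : set V) (x : V) (f' g' : V -> W) : open B -> B x ->
    (forall y, B y -> f' y = g' y) -> \forall y \near x, f' y = g' y.
  by move=> oB Bx fg; apply: filterS (open_nbhs_nbhs (conj oB Bx)).
elim: k f => [|k IH] f /= H.
  move=> x Ux; have [B [g [oB Bx /= gB fg]]] := H _ Ux.
  rewrite /prop_for /continuous_at fg//.
  apply: cvg_trans (gB _ Bx); apply: near_eq_cvg.
  by apply: (N _ _ _ _ oB Bx) => y By; rewrite fg.
split=> [x Ux|v].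
  have [B [g [oB Bx [gB _] fg]]] := H _ Ux.
  exact: near_eq_differentiable (N _ _ _ _ oB Bx fg) (gB _ Bx).
apply: IH => x Ux.
have [B [g [oB Bx [_ gB] fg]]] := H _ Ux.
exists B, (fun y => 'D_v g y); split => // y By.
by apply: near_eq_derive; exact: N oB By fg.
Qed.

Lemma Ck_sub k V W (U U' : set V) (f : V -> W) :
  U' `<=` U -> Ck k U f -> Ck k U' f.
Proof.
elim: k f => [|k IH] f /= sU; first by move=> c x /sU/c.
by move=> [d D]; split=> [x /sU/d//|v]; apply: IH.
Qed.

Lemma Ck_ext k V W (U : set V) (f g : V -> W) :
  open U -> (forall x, U x -> f x = g x) -> Ck k U g -> Ck k U f.
Proof. by move=> oU fg cg; apply: Ck_local => x Ux; exists U, g. Qed.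

Lemma Ck_pred k V W (U : set V) (f : V -> W) : Ck k.+1 U f -> Ck k U f.
Proof.
elim: k f => [|k IH] f.
  by move=> [d _] x /d; exact: differentiable_continuous.
by move=> [d D]; split=> // v; exact: (IH _ (D v)).
Qed.

Lemma Ck_cst k V W (U : set V) (a : W) : Ck k U (fun _ : V => a).
Proof.
elim: k a => [|k IH] a /=; first by move=> x _; exact: cvg_cst.
split=> [x _|v]; first exact: differentiable_cst.
rewrite (_ : (fun x => _) = fun _ : V => 0 : W); first exact: (IH 0).
by apply/funext => x; exact: derive_cst.
Qed.

Lemma CkD k V W (U : set V) (f g : V -> W) : open U ->
  Ck k U f -> Ck k U g -> Ck k U (fun x => f x + g x).
Proof.
move=> oU; elim: k f g => [|k IH] f g /=.
  by move=> cf cg x Ux; apply: cvgD; [exact: cf|exact: cg].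
move=> [df Df] [dg Dg]; split=> [x Ux|v].
  by apply: differentiableD; [exact: df|exact: dg].
apply: (@Ck_ext _ _ _ _ _ (fun x => 'D_v f x + 'D_v g x)) => //; last exact: IH.
by move=> x Ux; rewrite -deriveD//; apply: diff_derivable; [exact: df|exact: dg].
Qed.

Lemma Ck_lin k V W W' (L : {linear W -> W'}) (U : set V) (f : V -> W) :
  open U -> continuous L -> Ck k U f -> Ck k U (L \o f).
Proof.
move=> oU cL; elim: k f => [|k IH] f /=.
  by move=> cf x Ux; apply: continuous_comp; [exact: cf|exact: cL].
have dL y : differentiable L y by exact: linear_differentiable.
move=> [df Df]; split=> [x Ux|v].
  by apply: differentiable_comp => //; exact: df.
apply: (@Ck_ext _ _ _ _ _ (L \o (fun x => 'D_v f x))) => //; last exact: IH.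
move=> x Ux; have dfx := df _ Ux.
rewrite deriveE; last exact: differentiable_comp.
by rewrite diff_comp//= diff_lin// [in RHS]deriveE.
Qed.

Section ScaleDiff.
Variable W : normedModType R.

Let scale_bilin (a : R^o) (w : W) : W := a *: w.

Let scale_is_bilinear : bilinear_for
  (GRing.Scale.Law.clone _ _ *:%R _) (GRing.Scale.Law.clone _ _ *:%R _)
  scale_bilin.
Proof.
split=> [u'|u] a x y; rewrite /scale_bilin /=.
- by rewrite scalerDl scalerA.
- by rewrite scalerDr !scalerA mulrC.
Qed.

HB.instance Definition _ :=
  bilinear_isBilinear.Build R R^o W W _ _ scale_bilin scale_is_bilinear.

Lemma is_diff_scale_pair V (a : V -> R^o) (f : V -> W) x :
  differentiable a x -> differentiable f x ->
  is_diff x (fun y => a y *: f y) (fun v => a x *: 'd f x v + 'd a x v *: f x).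
Proof.
move=> da df.
have c : continuous (fun p : R^o * W => scale_bilin p.1 p.2).
  exact: scale_continuous.
have dp : differentiable (fun y => (a y, f y)) x by exact: differentiable_pair.
have ds := @differentiable_bilin _ _ _ _ scale_bilin (a x, f x) c.
apply: DiffDef; first exact: (differentiable_comp dp ds).
have := diff_comp dp ds; rewrite /comp /= => ->.
by rewrite diff_bilin// diff_pair.
Qed.

End ScaleDiff.

Lemma CkZ k V W (U : set V) (a : V -> R) (f : V -> W) : open U ->
  Ck k U (a : V -> R^o) -> Ck k U f -> Ck k U (fun x => a x *: f x).
Proof.
move=> oU; elim: k a f => [|k IH] a f.
  by move=> ca cf x Ux; apply: cvgZ; [exact: ca|exact: cf].
move=> Ha Hf; have Ha' := Ck_pred Ha; have Hf' := Ck_pred Hf.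
move: Ha Hf => [da Da] [df Df].
have dZ x : U x -> is_diff x (fun x => a x *: f x)
   (fun v => a x *: 'd f x v + 'd (a : V -> R^o) x v *: f x).
  move=> Ux.
  by apply: is_diff_scale_pair; [exact: da|exact: df].
split=> [x Ux|v].
  by have [] := dZ x Ux.
apply: (@Ck_ext _ _ _ _ _
  (fun x => a x *: 'D_v f x + 'D_v (a : V -> R^o) x *: f x)) => //.
  move=> x Ux; have [d dv] := dZ _ Ux.
  rewrite deriveE// dv.
  by rewrite !deriveE; [|exact: da|exact: df].
apply: CkD => //; [exact: (IH _ _ Ha' (Df v))|exact: (IH _ _ (Da v) Hf')].
Qed.

Lemma Ck_sum k V W (U : set V) m (f : 'I_m -> V -> W) : open U ->
  (forall i, Ck k U (f i)) -> Ck k U (fun x => \sum_i f i x).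
Proof.
move=> oU cf; elim: (index_enum _) => [|i s IH].
  by under eq_fun do rewrite big_nil; exact: Ck_cst.
by under eq_fun do rewrite big_cons; apply: CkD.
Qed.

Lemma continuous_lin_rV m W (L : {linear 'rV[R]_m -> W}) : continuous L.
Proof.
move=> x.
have H : Ck 0 setT (fun y : 'rV[R]_m => \sum_j y 0 j *: L 'e_j).
  apply: Ck_sum => [|j]; first exact: openT.
  apply: CkZ; [exact: openT| |exact: Ck_cst].
  by move=> y _; exact: (@coord_continuous R 1 m 0 j y).
suff -> : (L : _ -> W) = fun y => \sum_j y 0 j *: L 'e_j by exact: H.
apply/funext => y; rewrite [in LHS](row_sum_delta y) linear_sum.
by apply: eq_bigr => j _; rewrite linearZ.
Qed.

Lemma Ck_comp k V m W (U : set V) (U' : set 'rV[R]_m) (F : V -> 'rV[R]_m)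
    (g : 'rV[R]_m -> W) : open U -> open U' -> (forall x, U x -> U' (F x)) ->
  Ck k U F -> Ck k U' g -> Ck k U (g \o F).
Proof.
move=> oU oU' FU; elim: k F g FU => [|k IH] F g FU.
  move=> cF cg x Ux; apply: continuous_comp; first exact: cF.
  by apply: cg; exact: FU.
move=> HF; have HF' := Ck_pred HF; move: HF => [dF DF] [dg Dg].
have dgF x : U x -> differentiable (g \o F) x.
  by move=> Ux; apply: differentiable_comp; [exact: dF|apply: dg; exact: FU].
split=> // v.
apply: (@Ck_ext _ _ _ _ _
  (fun x => \sum_j ('D_v F x) 0 j *: ('D_('e_j) g \o F) x)) => //.
  move=> x Ux; have dFx := dF _ Ux; have dgx := dg _ (FU _ Ux).
  rewrite deriveE; last exact: dgF.
  rewrite diff_comp//= [in RHS]deriveE// {1}(row_sum_delta ('d F x v)) linear_sum.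
  by apply: eq_bigr => j _; rewrite linearZ/= deriveE.
apply: Ck_sum => // j; apply: CkZ => //; last exact: (IH _ _ FU HF' (Dg 'e_j)).
have @L : {linear 'rV[R]_m -> R^o}.
  by exists (fun N : 'rV[R]_m => N 0 j); do 2![eexists]; do ?[constructor];
     rewrite ?mxE// => ? *; rewrite ?mxE//; move=> ?; rewrite !mxE.
exact: (@Ck_lin _ _ _ _ L _ _ oU (@continuous_lin_rV _ _ L) (DF v)).
Qed.

Lemma smooth_lin V W (U : set V) (L : {linear V -> W}) :
  continuous L -> smooth U L.
Proof.
move=> cL; case=> [|k] /=; first by move=> x _; exact: cL.
split=> [x _|v]; first exact: linear_differentiable.
rewrite (_ : (fun x => _) = fun _ : V => L v : W); first exact: Ck_cst.
apply/funext => x; rewrite deriveE; last exact: linear_differentiable.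
by rewrite diff_lin.
Qed.

Lemma smooth_lin_rV m W (U : set 'rV[R]_m) (L : {linear 'rV[R]_m -> W}) :
  smooth U L.
Proof. exact/smooth_lin/continuous_lin_rV. Qed.

Lemma smooth_comp V m W (U : set V) (U' : set 'rV[R]_m) (F : V -> 'rV[R]_m)
    (g : 'rV[R]_m -> W) : open U -> open U' -> (forall x, U x -> U' (F x)) ->
  smooth U F -> smooth U' g -> smooth U (g \o F).
Proof. by move=> oU oU' FU cF cg k; exact: (Ck_comp oU oU' FU (cF k) (cg k)). Qed.

Lemma smooth_row_mx V m m' (U : set V) (F : V -> 'rV[R]_m) (G : V -> 'rV[R]_m') :
  open U -> smooth U F -> smooth U G -> smooth U (fun x => row_mx (F x) (G x)).
Proof.
move=> oU sF sG k.
apply: (@Ck_ext _ _ _ _ _ (fun x => mulmxr (row_mx 1%:M 0) (F x) +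
                                    mulmxr (row_mx 0 1%:M) (G x))) => //.
  move=> x _ /=; rewrite !mul_mx_row !mulmx1 !mulmx0.
  by rewrite add_row_mx addr0 add0r.
apply: CkD => //; apply: Ck_lin => //; exact: continuous_lin_rV.
Qed.

Lemma open_preimage V W (U : set V) (A : set W) (f : V -> W) :
  open U -> open A -> smooth U f -> open (U `&` f @^-1` A).
Proof.
move=> oU oA /(_ 0%N) cf; rewrite openE => x [Ux Ax]; apply: filterI.
  exact: open_nbhs_nbhs.
by apply: (cf x Ux); exact: open_nbhs_nbhs.
Qed.

End Smooth.

(* Plots are total functions of which only the restriction to the open domain U
   matters; plot_local with V = U makes plot insensitive to values off U. *)
Record diffSpace (R : realType) := DiffSpace {
  carrier :> Type;
  plot : forall n, set 'rV[R]_n -> ('rV[R]_n -> carrier) -> Prop;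
  plot_open : forall n U P, @plot n U P -> open U;
  plot_cst : forall n (U : set 'rV[R]_n) x, open U -> plot U (fun=> x);
  plot_local : forall n (U : set 'rV[R]_n) P, open U ->
    (forall r, U r -> exists V Q,
       [/\ V r, V `<=` U, plot V Q & forall t, V t -> P t = Q t]) ->
    plot U P;
  plot_comp : forall n m (U : set 'rV[R]_n) P (V : set 'rV[R]_m) F,
    plot U P -> open V -> smooth V F -> (forall r, V r -> U (F r)) ->
    plot V (P \o F)
}.
Arguments plot {R d n}.

Section Constructions.
Context {R : realType}.
Implicit Types X Y : diffSpace R.

Definition dsmooth X Y (f : X -> Y) : Prop :=
  forall n (U : set 'rV[R]_n) P, plot U P -> plot U (f \o P).

Lemma plot_ext X n (U : set 'rV[R]_n) (P Q : 'rV[R]_n -> X) :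
  plot U P -> (forall t, U t -> Q t = P t) -> plot U Q.
Proof.
move=> pP QP; have oU := plot_open pP.
apply: plot_local => // r Ur; exists U, P; split=> //.
Qed.

Lemma plot_sub X n (U V : set 'rV[R]_n) (P : 'rV[R]_n -> X) :
  plot U P -> open V -> V `<=` U -> plot V P.
Proof.
move=> pP oV VU; apply: (plot_comp pP oV (F := id)) => //.
exact: (@smooth_lin_rV _ n 'rV[R]_n _ idfun).
Qed.

Section RealLine.

Let rplot n (U : set 'rV[R]_n) (P : 'rV[R]_n -> R) :=
  open U /\ smooth U (P : 'rV[R]_n -> R^o).

Let rplot_local n (U : set 'rV[R]_n) P : open U ->
  (forall r, U r -> exists V Q,
     [/\ V r, V `<=` U, rplot V Q & forall t, V t -> P t = Q t]) -> rplot U P.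
Proof.
move=> oU H; split=> // k; apply: Ck_local => x Ux.
by have [V [Q [Vx VU [oV sQ] PQ]]] := H x Ux; exists V, Q.
Qed.

Let rplot_cst n (U : set 'rV[R]_n) x : open U -> rplot U (fun=> x).
Proof. by move=> oU; split=> // k; exact: Ck_cst. Qed.

Let rplot_comp n m (U : set 'rV[R]_n) P (V : set 'rV[R]_m) F :
  rplot U P -> open V -> smooth V F -> (forall r, V r -> U (F r)) ->
  rplot V (P \o F).
Proof. by move=> [oU sP] oV sF VU; split=> //; exact: smooth_comp sF sP. Qed.

Definition real_line : diffSpace R :=
  @DiffSpace R R rplot (fun _ _ _ => @proj1 _ _) rplot_cst rplot_local rplot_comp.

End RealLine.

Section Subspace.
Variables (X : diffSpace R) (A : set X).

Let splot n (U : set 'rV[R]_n) (P : 'rV[R]_n -> {x | A x}) :=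
  plot U (fun r => sval (P r)).

Let splot_local n (U : set 'rV[R]_n) P : open U ->
  (forall r, U r -> exists V Q,
     [/\ V r, V `<=` U, splot V Q & forall t, V t -> P t = Q t]) -> splot U P.
Proof.
move=> oU H; apply: plot_local => // r Ur.
have [V [Q [Vx VU sQ PQ]]] := H r Ur; exists V, (fun r => sval (Q r)).
by split=> // t Vt; rewrite PQ.
Qed.

Definition sub_space : diffSpace R :=
  @DiffSpace R {x | A x} splot (fun _ _ _ => @plot_open _ _ _ _ _)
    (fun _ _ _ => @plot_cst _ _ _ _ _) splot_local
    (fun _ _ _ _ _ _ => @plot_comp _ _ _ _ _ _ _ _).

Definition sub_incl (p : sub_space) : X := sval p.

End Subspace.

Section Product.
Variables X Y : diffSpace R.

Let pplot n (U : set 'rV[R]_n) (P : 'rV[R]_n -> X * Y) :=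
  plot U (fun r => (P r).1) /\ plot U (fun r => (P r).2).

Let pplot_open n (U : set 'rV[R]_n) P : pplot U P -> open U.
Proof. by move=> [/plot_open]. Qed.

Let pplot_cst n (U : set 'rV[R]_n) x : open U -> pplot U (fun=> x).
Proof. by split; exact: plot_cst. Qed.

Let pplot_local n (U : set 'rV[R]_n) P : open U ->
  (forall r, U r -> exists V Q,
     [/\ V r, V `<=` U, pplot V Q & forall t, V t -> P t = Q t]) -> pplot U P.
Proof.
move=> oU H; split; apply: plot_local => // r Ur;
  have [V [Q [Vx VU [Q1 Q2] PQ]]] := H r Ur.
- by exists V, (fun r => (Q r).1); split=> // t Vt; rewrite PQ.
- by exists V, (fun r => (Q r).2); split=> // t Vt; rewrite PQ.
Qed.

Let pplot_comp n m (U : set 'rV[R]_n) P (V : set 'rV[R]_m) F :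
  pplot U P -> open V -> smooth V F -> (forall r, V r -> U (F r)) ->
  pplot V (P \o F).
Proof.
move=> [P1 P2] oV sF VU.
by split; [exact: (plot_comp P1)|exact: (plot_comp P2)].
Qed.

Definition prod_space : diffSpace R :=
  DiffSpace pplot_open pplot_cst pplot_local pplot_comp.

End Product.

(* T with the quotient diffeology along the surjection f : X -> T. *)
Section PushForward.
Variables (X : diffSpace R) (T : Type) (f : X -> T).
Hypothesis f_surj : forall y, exists x, f x = y.

Let qplot n (U : set 'rV[R]_n) (P : 'rV[R]_n -> T) :=
  open U /\ forall r, U r -> exists V Q,
    [/\ V r, V `<=` U, plot V Q & forall t, V t -> P t = f (Q t)].

Let qplot_cst n (U : set 'rV[R]_n) y : open U -> qplot U (fun=> y).
Proof.
move=> oU; split=> // r Ur; have [x fx] := f_surj y.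
by exists U, (fun=> x); split=> //; exact: plot_cst.
Qed.

Let qplot_local n (U : set 'rV[R]_n) P : open U ->
  (forall r, U r -> exists V Q,
     [/\ V r, V `<=` U, qplot V Q & forall t, V t -> P t = Q t]) -> qplot U P.
Proof.
move=> oU H; split=> // r Ur; have [V [Q [Vr VU [_ lQ] PQ]]] := H r Ur.
have [V' [Q' [V'r V'V pQ' QQ']]] := lQ r Vr.
exists V', Q'; split=> // [t /V'V/VU //|t V't].
by rewrite PQ ?QQ'//; exact: V'V.
Qed.

Let qplot_comp n m (U : set 'rV[R]_n) P (V : set 'rV[R]_m) F :
  qplot U P -> open V -> smooth V F -> (forall r, V r -> U (F r)) ->
  qplot V (P \o F).
Proof.
move=> [_ lP] oV sF VU; split=> // r Vr.
have [V' [Q [V'r V'U pQ PQ]]] := lP _ (VU _ Vr).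
have oV' := plot_open pQ.
have oW : open (V `&` F @^-1` V') by exact: open_preimage.
exists (V `&` F @^-1` V'), (Q \o F); split=> //.
- apply: (plot_comp pQ oW) => [k|t []//].
  by apply: Ck_sub (sF k) => t [].
- by move=> t [_ /PQ].
Qed.

Definition push_space : diffSpace R :=
  @DiffSpace R T qplot (fun _ _ _ => @proj1 _ _) qplot_cst qplot_local qplot_comp.

End PushForward.

(* The smooth maps from X to Y, with the functional diffeology: P is a plot iff
   (r, x) |-> P r x is smooth on U x X. *)
Section MapSpace.
Variables X Y : diffSpace R.

Let mplot n (U : set 'rV[R]_n) (P : 'rV[R]_n -> {f : X -> Y | dsmooth f}) :=
  open U /\ forall m (V : set 'rV[R]_m) (Q : 'rV[R]_m -> X), plot V Q ->
    plot [set z : 'rV[R]_(n + m) | U (lsubmx z) /\ V (rsubmx z)]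
         (fun z => sval (P (lsubmx z)) (Q (rsubmx z))).

Let open_prod n m (U : set 'rV[R]_n) (V : set 'rV[R]_m) : open U -> open V ->
  open [set z : 'rV[R]_(n + m) | U (lsubmx z) /\ V (rsubmx z)].
Proof.
move=> oU oV; rewrite (_ : [set _ | _] = lsubmx @^-1` U `&` rsubmx @^-1` V)//.
apply: openI; apply: open_comp => // x _.
- exact: continuous_lsubmx.
- exact: continuous_rsubmx.
Qed.

Let mplot_cst n (U : set 'rV[R]_n) f : open U -> mplot U (fun=> f).
Proof.
move=> oU; split=> // m V Q pQ; have oV := plot_open pQ.
apply: (plot_comp (svalP f _ _ _ pQ)) => [|k|z []//]; first exact: open_prod.
exact: smooth_lin_rV.
Qed.

Let mplot_local n (U : set 'rV[R]_n) P : open U ->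
  (forall r, U r -> exists V Q,
     [/\ V r, V `<=` U, mplot V Q & forall t, V t -> P t = Q t]) -> mplot U P.
Proof.
move=> oU H; split=> // m V Q pQ; have oV := plot_open pQ.
apply: plot_local => [|z [Ur Vr]]; first exact: open_prod.
have [W [P' [Wr WU [oW pP'] PP']]] := H _ Ur.
eexists; eexists; split; [|  |exact: (pP' _ _ _ pQ)|].
- by split.
- by move=> t [/WU].
- by move=> t [Wt Vt]; rewrite PP'.
Qed.

Let mplot_comp n m (U : set 'rV[R]_n) P (V : set 'rV[R]_m) F :
  mplot U P -> open V -> smooth V F -> (forall r, V r -> U (F r)) ->
  mplot V (P \o F).
Proof.
move=> [oU pP] oV sF VU; split=> // m' V' Q pQ; have oV' := plot_open pQ.
have oW := open_prod oV oV'.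
pose G (z : 'rV[R]_(m + m')) := row_mx (F (lsubmx z)) (rsubmx z).
rewrite (_ : (fun z => _) =
  (fun z => sval (P (lsubmx z)) (Q (rsubmx z))) \o G); last first.
  by apply/funext => z; rewrite /G /= row_mxKl row_mxKr.
apply: (plot_comp (pP _ _ _ pQ)) => //.
- apply: smooth_row_mx => //; last exact: smooth_lin_rV.
  apply: (smooth_comp oW oV _ _ sF) => [z []//|]; exact: smooth_lin_rV.
- by move=> z [Vz V'z]; rewrite /G /= row_mxKl row_mxKr; split=> //; apply: VU.
Qed.

Definition map_space : diffSpace R :=
  @DiffSpace R {f : X -> Y | dsmooth f} mplot (fun _ _ _ => @proj1 _ _)
    mplot_cst mplot_local mplot_comp.

End MapSpace.

End Constructions.

Arguments real_line R : clear implicits.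
Arguments sub_incl {R X A}.

Section Subduction.
Context {R : realType}.
Implicit Types X Y : diffSpace R.

Definition diffeomorphism X Y (f : X -> Y) : Prop :=
  dsmooth f /\ exists g : Y -> X, [/\ dsmooth g, cancel f g & cancel g f].

Definition subduction X Y (f : X -> Y) : Prop :=
  [/\ dsmooth f, forall y, exists x, f x = y &
    forall n (U : set 'rV[R]_n) (P : 'rV[R]_n -> Y), plot U P ->
      forall r, U r -> exists V (Q : 'rV[R]_n -> X),
        [/\ V r, V `<=` U, plot V Q & forall t, V t -> P t = f (Q t)]].

(* Every plot is locally constant. *)
Definition discrete_space X : Prop :=
  forall n (U : set 'rV[R]_n) (P : 'rV[R]_n -> X), plot U P ->
    forall r, U r -> exists V : set 'rV[R]_n,
      [/\ open V, V r, V `<=` U & forall t, V t -> P t = P r].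

Section Quotient.
Variables (X : diffSpace R) (e : X -> X -> Prop).

(* The classes are the sets [set y | e x y]. *)
Definition dquotient : Type := {A : set X | exists x, A = e x}.

Definition to_quotient (x : X) : dquotient :=
  exist (fun A : set X => exists x, A = e x) (e x) (ex_intro _ x erefl).

Definition quotient_rep (c : dquotient) : X := projT1 (cid (svalP c)).

Lemma quotient_repK (c : dquotient) : to_quotient (quotient_rep c) = c.
Proof.
case: c => A h; apply: eq_exist; rewrite /quotient_rep.
by case: cid => x /= ->.
Qed.

Lemma to_quotient_surj (c : dquotient) : exists x, to_quotient x = c.
Proof. by exists (quotient_rep c); exact: quotient_repK. Qed.

Definition dquotient_space : diffSpace R := push_space to_quotient_surj.

End Quotient.

End Subduction.

Section Paths.
Context {R : realType}.
Implicit Types X : diffSpace R.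

Definition Paths X : diffSpace R := map_space (real_line R) X.

Definition ev X (t : R) (p : Paths X) : X := sval p t.

Lemma affine_dsmooth (a b : R) :
  dsmooth (X := real_line R) (Y := real_line R) (fun t => a * t + b).
Proof.
move=> n U P [oU sP]; split=> // k.
apply: (@CkD _ _ _ R^o) => //; last exact: Ck_cst.
apply: (@CkZ _ _ _ R^o _ (fun=> a)) => //; exact: Ck_cst.
Qed.

Lemma cst_dsmooth X (x : X) : dsmooth (X := real_line R) (fun=> x).
Proof. by move=> n U P [oU _]; exact: plot_cst. Qed.

Definition cst_path X (x : X) : Paths X := exist _ (fun=> x) (@cst_dsmooth X x).

Lemma rev_dsmooth X (p : Paths X) :
  dsmooth (X := real_line R) (fun t => ev (1 - t) p).
Proof.
move=> n U P pP; rewrite [X in plot U X](_ : _ =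
  (sval p \o ((fun t : R => -1 * t + 1) \o P))); last first.
  by apply/funext => r /=; rewrite /ev mulN1r addrC.
exact/(svalP p)/affine_dsmooth.
Qed.

Definition rev_path X (p : Paths X) : Paths X := exist _ _ (@rev_dsmooth X p).

End Paths.

Record smashing (R : realType) := Smashing {
  smash_fun :> R -> R;
  smash_eps : R;
  smash_eps_gt0 : 0 < smash_eps;
  smash_smooth : dsmooth (X := real_line R) (Y := real_line R) smash_fun;
  smash_range : forall t, 0 <= smash_fun t <= 1;
  smash_left : forall t, t <= smash_eps -> smash_fun t = 0;
  smash_right : forall t, 1 - smash_eps <= t -> smash_fun t = 1
}.

Section Concatenation.
Context {R : realType} (s : smashing R).
Implicit Types X : diffSpace R.

Definition concat_fun X (p q : Paths X) (t : R) : X :=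
  if t <= 2^-1 then ev (s (2 * t)) p else ev (s (2 * t - 1)) q.

Lemma concat_dsmooth X (p q : Paths X) : ev 1 p = ev 0 q ->
  dsmooth (X := real_line R) (concat_fun p q).
Proof.
move=> pq n U P pP; have [oU sP] := pP; have e0 := smash_eps_gt0 s.
have oA (A : set R) : open A -> open (U `&` P @^-1` A).
  by move=> oA; exact: (open_preimage oU oA sP).
have pA (A : set R) : open A ->
    plot (U `&` P @^-1` A) (P : _ -> real_line R).
  by move=> opA; apply: (plot_sub pP (oA _ opA)) => t [].
apply: plot_local => // r Ur; case: (ltgtP (P r) 2^-1) => Pr.
- exists (U `&` P @^-1` [set t | t < 2^-1]),
    (sval p \o (s \o ((fun t : R => 2 * t + 0) \o P))).
  split=> //.
    apply: (svalP p); apply: (smash_smooth s); apply: affine_dsmooth.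
    by apply: pA; exact: open_lt.
  by move=> t [_ Pt]; rewrite /= /concat_fun addr0 ltW.
- exists (U `&` P @^-1` [set t | t > 2^-1]),
    (sval q \o (s \o ((fun t : R => 2 * t + -1) \o P))).
  split=> //.
    apply: (svalP q); apply: (smash_smooth s); apply: affine_dsmooth.
    by apply: pA; exact: open_gt.
  by move=> t [_ Pt]; rewrite /= /concat_fun leNgt Pt.
- pose d := smash_eps s / 2.
  pose A := [set t | 2^-1 - d < t] `&` [set t : R | t < 2^-1 + d].
  have opA : open A by apply: openI; [exact: open_gt|exact: open_lt].
  have d0 : 0 < d by rewrite /d divr_gt0.
  exists (U `&` P @^-1` A), (fun=> ev 1 p); split=> //.
  + by split=> //; rewrite /A /= Pr; split; rewrite ?ltrDl ?ltrBlDr ?ltrDl.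
  + by apply: plot_cst; exact: oA.
  move=> t [_ [/= At1 At2]]; rewrite /concat_fun; case: ifP => _.
    rewrite smash_right//; move: At1; rewrite /d; lra.
  by rewrite smash_left ?pq//; move: At2; rewrite /d; lra.
Qed.

(* Only meaningful when ev 1 p = ev 0 q; p is a dummy value otherwise. *)
Definition concat X (p q : Paths X) : Paths X :=
  if pselect (ev 1 p = ev 0 q) is left pq
  then exist _ (concat_fun p q) (concat_dsmooth pq) else p.

Lemma ev0_concat X (p q : Paths X) :
  ev 1 p = ev 0 q -> ev 0 (concat p q) = ev 0 p.
Proof.
rewrite /concat; case: pselect => // pq _; rewrite /ev /= /concat_fun /ev.
by rewrite invr_ge0 ler0n mulr0 smash_left// ltW// smash_eps_gt0.
Qed.

Lemma ev1_concat X (p q : Paths X) :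
  ev 1 p = ev 0 q -> ev 1 (concat p q) = ev 1 q.
Proof.
rewrite /concat; case: pselect => // pq _; rewrite /ev /= /concat_fun /ev.
rewrite ifF; last by apply/negbTE; rewrite -ltNge invf_lt1 ?ltr1n.
rewrite smash_right//; have := smash_eps_gt0 s; lra.
Qed.

End Concatenation.

Section Forms.
Context {R : realType}.
Implicit Types X Y : diffSpace R.

(* Assigns to each plot P : U -> X, point r of U and vectors v_0, .., v_{k-1}
   a real number; the value is irrelevant when P is not a plot or r is not
   in U, whence dform_eq. *)
Definition pre_dform (k : nat) X : Type :=
  forall n, set 'rV[R]_n -> ('rV[R]_n -> X) -> 'rV[R]_n ->
    ('I_k -> 'rV[R]_n) -> R.

Definition dform_eq k X (a b : pre_dform k X) : Prop :=
  forall n (U : set 'rV[R]_n) P, plot U P -> forall r, U r -> forall v,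
    a n U P r v = b n U P r v.

Record is_dform k X (a : pre_dform k X) : Prop := IsDForm {
  dform_linear : forall n (U : set 'rV[R]_n) P, plot U P -> forall r, U r ->
    forall v i c u w,
      a n U P r [eta v with i |-> c *: u + w] =
      c * a n U P r [eta v with i |-> u] + a n U P r [eta v with i |-> w];
  dform_alternating : forall n (U : set 'rV[R]_n) P, plot U P ->
    forall r, U r -> forall v i j, i != j -> v i = v j -> a n U P r v = 0;
  dform_smooth : forall n (U : set 'rV[R]_n) P, plot U P -> forall v,
    smooth U ((fun r => a n U P r v) : 'rV[R]_n -> R^o);
  (* a (P \o F) = F^* (a P); P \o F is only required on V, so that a P depends
     only on the restriction of P to U *)
  dform_compat : forall n m (U : set 'rV[R]_n) P (V : set 'rV[R]_m) F Q,
    plot U P -> open V -> smooth V F -> (forall r, V r -> U (F r)) ->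
    (forall r, V r -> Q r = P (F r)) -> forall r, V r -> forall v,
      a m V Q r v = a n U P (F r) (fun i => 'D_(v i) F r)
}.

Record dform (k : nat) X := DForm {
  dform_val :> pre_dform k X;
  dformP : is_dform dform_val
}.

Definition zero_dform k X : pre_dform k X := fun _ _ _ _ _ => 0.

Definition sub_dform k X (a b : pre_dform k X) : pre_dform k X :=
  fun n U P r v => a n U P r v - b n U P r v.

Definition pullback k X Y (f : X -> Y) (a : pre_dform k Y) : pre_dform k X :=
  fun n U P r v => a n U (f \o P) r v.

(* No bracket terms: the v i are constant vector fields. *)
Definition ext_d k X (a : pre_dform k X) : pre_dform k.+1 X :=
  fun n U P r v => \sum_(i < k.+1)
    (-1) ^+ i * 'D_(v i) ((fun t => a n U P t (fun j => v (lift i j)))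
                            : 'rV[R]_n -> R^o) r.

Definition closed_dform k X (a : pre_dform k X) : Prop :=
  dform_eq (ext_d a) (@zero_dform _ _).

(* The chain-homotopy operator; (t, r) |-> P r t is a plot on R x U, and the
   vectors are (1, 0), (0, v_0), .., (0, v_{k-1}). *)
Definition Kop k X (a : pre_dform k.+1 X) : pre_dform k (Paths X) :=
  fun n U P r v => \int[lebesgue_measure]_(t in `[0%R, 1%R])
    a (1 + n)%N [set z | U (rsubmx z)]
      (fun z => ev (lsubmx z 0 0) (P (rsubmx z)))
      (row_mx (const_mx t) r)
      (fun j => if unlift ord0 j is Some i then row_mx 0 (v i)
                else row_mx (const_mx 1) 0).

Definition path_integral X (a : pre_dform 1 X) (p : Paths X) : R :=
  \int[lebesgue_measure]_(t in `[0%R, 1%R])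
    a 1%N setT (fun x => ev (x 0 0) p) (const_mx t) (fun=> const_mx 1).

End Forms.

Section Topology.
Context {R : realType} (X : diffSpace R).

Definition joined (x y : X) : Prop :=
  exists p : Paths X, ev 0 p = x /\ ev 1 p = y.

Definition dconnected : Prop := forall x y, joined x y.

Definition pi0 : Type := dquotient joined.

Definition Loops : diffSpace R := sub_space [set p : Paths X | ev 0 p = ev 1 p].

End Topology.

Section BasedLoops.
Context {R : realType} (s : smashing R) (X : diffSpace R) (x0 : X).

Definition based_loops : diffSpace R :=
  sub_space [set p : Paths X | ev 0 p = x0 /\ ev 1 p = x0].

Definition cst_loop : based_loops := exist _ (cst_path x0) (conj erefl erefl).

(* Only meaningful when p is a loop at x0. *)
Definition to_loop (p : Paths X) : based_loops :=
  if pselect (ev 0 p = x0 /\ ev 1 p = x0) is left h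
  then exist (fun p : Paths X => ev 0 p = x0 /\ ev 1 p = x0) p h else cst_loop.

Definition pi1 : Type := pi0 based_loops.

Definition component (l : based_loops) : pi1 := to_quotient (@joined R _) l.

Definition pi1_one : pi1 := component cst_loop.

Definition pi1_mul (i j : pi1) : pi1 :=
  component (to_loop (concat s (sub_incl (quotient_rep i))
                               (sub_incl (quotient_rep j)))).

Definition pi1_inv (i : pi1) : pi1 :=
  component (to_loop (rev_path (sub_incl (quotient_rep i)))).

Record loop_basis := LoopBasis {
  basis_loop :> pi1 -> based_loops;
  basis_loopP : forall i, component (basis_loop i) = i;
  basis_loop1 : basis_loop pi1_one = cst_loop
}.

End BasedLoops.

Definition generated (V : zmodType) (S : set V) : {pred V} :=
  fun x => `[< forall H : {pred V}, zmod_closed H ->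
                 (forall y, S y -> y \in H) -> x \in H >].

Lemma generated_zmod_closed (V : zmodType) (S : set V) :
  zmod_closed (generated S).
Proof.
split=> [|x y /asboolP Hx /asboolP Hy]; apply/asboolP => H cH SH.
  by case: cH.
by case: (cH) => _; apply; [exact: Hx|exact: Hy].
Qed.

HB.instance Definition _ (V : zmodType) (S : set V) :=
  GRing.isZmodClosed.Build V (generated S) (generated_zmod_closed S).

(* F(I), as the set of reduced words in the letters (i, false), standing for i,
   and (i, true), standing for the inverse of i. *)
Definition reduced (I : Type) (w : seq (I * bool)) : Prop :=
  forall u v i b, w <> u ++ (i, b) :: (i, ~~ b) :: v.

Definition free_group (I : Type) : Type := {w : seq (I * bool) | reduced w}.

(* The homomorphism from F(I) to the group (G, mul, inv, one) extending f. *)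
Definition free_lift (I G : Type) (mul : G -> G -> G) (inv : G -> G) (one : G)
    (f : I -> G) (w : free_group I) : G :=
  foldr (fun a => mul (if a.2 then inv (f a.1) else f a.1)) one (sval w).

Section Periods.
Context {R : realType} (s : smashing R) (X : diffSpace R).
Variables (w : dform 2 X) (x0 : X) (l : loop_basis x0).

Let Kw : pre_dform 1 (Paths X) := Kop w.

Definition P_tor : {pred R} := generated [set c | exists p : Paths (Loops X),
  ev 0 p = ev 1 p /\ c = path_integral (pullback sub_incl Kw) p].

HB.instance Definition _ := GRing.ZmodClosed.on P_tor.

Definition T_tor : zmodType := Quotient.quot P_tor.

Definition pi_tor (c : R) : T_tor := (\pi_(Quotient.quot P_tor) c)%qT.

(* The integral of Kw along some path from p to q in based_loops x0. *)
Definition integral_between (p q : based_loops x0) : R :=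
  xget 0 [set c | exists a : Paths (based_loops x0),
    [/\ ev 0 a = p, ev 1 a = q & c = path_integral (pullback sub_incl Kw) a]].

(* The class in T_tor of integral_between does not depend on the path. *)
Definition tau (i j : pi1 x0) : T_tor :=
  pi_tor (integral_between (l (pi1_mul s i j))
                           (to_loop x0 (concat s (sub_incl (l i)) (sub_incl (l j))))).

Definition Gamma : Type := (pi1 x0 * T_tor)%type.

Definition Gamma_one : Gamma := (pi1_one x0, 0).

Definition Gamma_mul (a b : Gamma) : Gamma :=
  (pi1_mul s a.1 b.1, a.2 + b.2 + tau a.1 b.1).

(* The inverse of (i, u) for Gamma_mul. *)
Definition Gamma_inv (a : Gamma) : Gamma :=
  (pi1_inv a.1, - a.2 - tau a.1 (pi1_inv a.1)).

Definition Psi : free_group (pi1 x0) -> Gamma :=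
  free_lift Gamma_mul Gamma_inv Gamma_one (fun i => (i, 0)).

Definition relations : set (free_group (pi1 x0)) :=
  [set r | free_lift (@pi1_mul _ s _ x0) (@pi1_inv _ _ x0) (pi1_one x0) id r
           = pi1_one x0].

Definition H_surf : {pred T_tor} :=
  generated [set (Psi r).2 | r in relations].

HB.instance Definition _ := GRing.ZmodClosed.on H_surf.

Definition P_omega : {pred R} := fun c => pi_tor c \in H_surf.

Lemma P_omega_zmod_closed : zmod_closed P_omega.
Proof.
split=> [|x y]; rewrite /in_mem /= /P_omega /pi_tor; first by rewrite raddf0 rpred0.
by move=> Hx Hy; rewrite raddfB rpredB.
Qed.

HB.instance Definition _ := GRing.isZmodClosed.Build R P_omega P_omega_zmod_closed.

Definition T_omega : zmodType := Quotient.quot P_omega.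

Definition pi_omega (c : R) : T_omega := (\pi_(Quotient.quot P_omega) c)%qT.

Lemma pi_omega_surj (u : T_omega) : exists c, pi_omega c = u.
Proof. by exists (repr u); exact: reprK. Qed.

(* T_omega with the quotient diffeology of R. *)
Definition T_omega_space : diffSpace R :=
  push_space (X := real_line R) pi_omega_surj.

Definition psi (p : based_loops x0) : T_omega :=
  pi_omega (integral_between (l (component p)) p).

Definition Phi (d p q : Paths X) : T_omega :=
  psi (to_loop x0 (concat s (concat s d (concat s p (rev_path q)))
                            (rev_path d))).

(* Phi does not depend on the path d from x0 to ev 0 p. *)
Definition omega_equiv (p q : Paths X) : Prop :=
  [/\ ev 0 p = ev 0 q, ev 1 p = ev 1 q &
      forall d : Paths X, ev 0 d = x0 -> ev 1 d = ev 0 p -> Phi d p q = 0].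

Definition Mor : diffSpace R := dquotient_space omega_equiv.

Definition class_omega (p : Paths X) : Mor := to_quotient omega_equiv p.

(* The operations are computed on chosen representatives. *)
Definition mor_src (y : Mor) : X := ev 0 (quotient_rep y).

Definition mor_trg (y : Mor) : X := ev 1 (quotient_rep y).

(* Only meaningful when mor_trg y = mor_src z. *)
Definition mor_comp (y z : Mor) : Mor :=
  class_omega (concat s (quotient_rep y) (quotient_rep z)).

Definition isotropy (x : X) : diffSpace R :=
  sub_space [set y : Mor | mor_src y = x /\ mor_trg y = x].

End Periods.

Arguments mor_src {R} s {X} w {x0} l y.
Arguments mor_trg {R} s {X} w {x0} l y.
Arguments mor_comp {R} s {X} w {x0} l y z.

Section Groupoids.
Context {R : realType} (X Y : diffSpace R).
Variables (src trg : Y -> X) (comp : Y -> Y -> Y).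

Definition composable : diffSpace R :=
  sub_space [set p : prod_space Y Y | trg p.1 = src p.2].

Record is_groupoid (one : X -> Y) (inv : Y -> Y) : Prop := IsGroupoid {
  src_comp : forall y z, trg y = src z -> src (comp y z) = src y;
  trg_comp : forall y z, trg y = src z -> trg (comp y z) = trg z;
  comp_assoc : forall y z t, trg y = src z -> trg z = src t ->
    comp (comp y z) t = comp y (comp z t);
  src_one : forall x, src (one x) = x;
  trg_one : forall x, trg (one x) = x;
  comp_one_l : forall y, comp (one (src y)) y = y;
  comp_one_r : forall y, comp y (one (trg y)) = y;
  src_inv : forall y, src (inv y) = trg y;
  trg_inv : forall y, trg (inv y) = src y;
  comp_inv_l : forall y, comp (inv y) y = one (trg y);
  comp_inv_r : forall y, comp y (inv y) = one (src y)
}.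

Definition diffeological_groupoid : Prop :=
  exists one inv, is_groupoid one inv /\
    [/\ dsmooth src, dsmooth trg, dsmooth one, dsmooth inv &
        dsmooth (X := composable) (fun p => comp (sub_incl p).1 (sub_incl p).2)].

Definition fibrating_groupoid : Prop :=
  diffeological_groupoid /\
  subduction (Y := prod_space X X) (fun y => (src y, trg y)).

(* The restriction of a to the target, pulled back by z |-> comp y z, is the
   pullback of a by the composite of this map with the inclusion into Y. *)
Definition left_right_invariant k (a : pre_dform k Y) : Prop :=
  (forall y : Y,
    dform_eq (X := sub_space [set z : Y | src z = trg y])
      (pullback (fun z => comp y (sub_incl z)) a) (pullback sub_incl a)) /\
  (forall y : Y,
    dform_eq (X := sub_space [set z : Y | trg z = src y])
      (pullback (fun z => comp (sub_incl z) y) a) (pullback sub_incl a)).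

End Groupoids.

(* Main.v *)
From HB Require Import structures.
Require Import Defs.
From mathcomp Require Import all_boot all_order all_algebra.
From mathcomp Require Import all_classical all_reals all_analysis.
From mathcomp Require Import ring lra.
Import Order.TTheory GRing.Theory Num.Theory.
Import numFieldNormedType.Exports.
Local Open Scope classical_set_scope.
Local Open Scope ring_scope.
Set Implicit Arguments.
Unset Strict Implicit.
Unset Printing Implicit Defensive.

(* The map psi is a homomorphism from the based loops to T_omega: the defect
   psi (p v q) - psi p - psi q is locally constant in p and q because Kw is
   additive under concatenation, and at the basis loops it is the class of tau,
   which lies in H_surf by the relators d^-1 * d and d^-1 * (i * j), d = i * j.
   Formal words of paths whose Kw cancels can be contracted to a point without
   changing psi, so choosing a path from x0 to every point gives an additive
   holonomy on all paths, and (src, trg, holonomy) embeds the morphisms in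
   X * X * T_omega; the groupoid laws follow. The form lambda is Kw of any local
   lift: the difference of Kw on two lifts has its primitives in P_omega, hence
   vanishes since P_omega is a proper subgroup of R. Finally, if w <> 0, a plane
   plot on which w > 0 carries a one-parameter family of loops whose holonomy
   has nonzero derivative, and the inverse function theorem turns it into a
   smooth local section of the holonomy. *)

(** * Integration over the unit interval *)

Section Integral.
Context {R : realType}.
Implicit Types f g F : R -> R.

(** Contracting words stands in for homotopy theory and for Stokes' theorem. No homotopy between two
    words is ever built: it is enough that the [Kw] terms of a word cancel formally, since then
    every smooth deformation of its letters leaves [psi] unchanged, whatever surface it sweeps. The
    obstacle that shapes the rest is that the paths chosen from [x0] do not vary smoothly with their
    end, so the holonomy cannot be differentiated along families with moving ends. Smoothness has to
    come from elsewhere: from local lifts to paths, from prolonging one chosen path along the moving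
    source, or from families of loops with fixed ends. Families over a line are plots on the whole
    line, so a curve that must stay in a small ball is bounded globally, by a multiple of x / (1 +
    x^2), and not restricted to a small interval. For the isotropy groups, a nonzero value of [w] at
    one point is enough: loops near that point realize all small holonomies, conjugation carries
    them to any other point, and their products exhaust the torus. *)

Definition int01 f : R := \int[lebesgue_measure]_(t in `[0%R, 1%R]) f t.

Lemma integrable01 f : continuous f ->
  lebesgue_measure.-integrable `[0%R, 1%R] (EFin \o f).
Proof.
move=> cf; apply: continuous_compact_integrable; first exact: segment_compact.
exact: continuous_subspaceT.
Qed.

Lemma eq_int01 f g : (forall t, 0 <= t <= 1 -> f t = g t) -> int01 f = int01 g.
Proof. by move=> fg; apply: eq_Rintegral => t; rewrite inE/= in_itv/= => /fg. Qed.

Lemma int01D f g : continuous f -> continuous g ->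
  int01 (fun t => f t + g t) = int01 f + int01 g.
Proof. by move=> cf cg; apply: RintegralD => //; exact: integrable01. Qed.

Lemma int01Z c f : continuous f -> int01 (fun t => c * f t) = c * int01 f.
Proof. by move=> cf; apply: RintegralZl => //; exact: integrable01. Qed.

Lemma int01_cst c : int01 (fun=> c) = c.
Proof.
rewrite /int01 Rintegral_cst//= lebesgue_measure_itv/= lte_fin ltr01.
by rewrite sube0 mulr1.
Qed.

Lemma int01_le f e : continuous f -> (forall t, 0 <= t <= 1 -> `|f t| <= e) ->
  `|int01 f| <= e.
Proof.
move=> cf fe; apply: (le_trans (le_normr_Rintegral _ (integrable01 cf))) => //.
rewrite -[leRHS]int01_cst; apply: le_Rintegral => //.
- by apply: integrable01 => x; apply: cvg_norm; exact: cf.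
- by apply: integrable01 => x; exact: cvg_cst.
Qed.

(** The margin around [0, 1] provides two-sided derivatives at both ends, from which the one-sided
    conditions of [continuous_FTC2] follow. *)
Lemma int01_ftc F f : continuous f ->
  (forall x : R, -1 < x < 2 -> is_derive x 1 F (f x)) -> int01 f = F 1 - F 0.
Proof.
move=> cf dF.
have cF x : -1 < x < 2 -> {for x, continuous F}.
  by move=> /dF[d _]; apply: differentiable_continuous; apply/derivable1_diffP.
have := @continuous_FTC2 R f F 0 1 ltr01.
rewrite /int01 /Rintegral => ->//.
- exact: continuous_subspaceT.
- split => [x||].
  + by rewrite in_itv/= => /andP[x0 x1]; have [|+ _] := dF x; first lra.
  + apply: cvg_at_right_filter; apply: cF; lra.
  + apply: cvg_at_left_filter; apply: cF; lra.
- move=> x; rewrite in_itv/= => /andP[x0 x1]; rewrite derive1E.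
  by have [|_ ->] := dF x; first lra.
Qed.

(** The primitive is based at -1, to the left of 0, so that it has a two-sided derivative at 0; the
    bound -1 recurs wherever such a primitive is used. *)
Lemma antiderivative f : continuous f ->
  exists F : R -> R, forall x : R, -1 < x -> is_derive x 1 F (f x).
Proof.
move=> cf.
pose F x := \int[lebesgue_measure]_(t in [set` Interval (BLeft (-1)) (BRight x)]) f t.
exists F => x x0.
have xx1 : x < x + 1 by rewrite ltrDl.
have fi : lebesgue_measure.-integrable [set` Interval (BLeft (-1)) (BRight (x + 1))] (EFin \o f).
  apply: continuous_compact_integrable; first exact: segment_compact.
  exact: continuous_subspaceT.
have [dF Fx] := continuous_FTC1 xx1 fi x0 (cf x).
by apply: DeriveDef; [exact: dF|rewrite -derive1E; exact: Fx].
Qed.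

End Integral.

(** * Smooth dependence of integrals on parameters *)

Section Calculus.
Context {R : realType}.

Lemma is_derive_line (V W : normedModType R) (h : V -> W) (x w : V) (u : R) :
  differentiable h (x + u *: w) ->
  is_derive u 1 (fun u' : R => h (x + u' *: w)) ('D_w h (x + u *: w)).
Proof.
move=> dh.
have E : (fun e : R => e^-1 *: (h (x + (e *: 1 + u) *: w) - h (x + u *: w))) =
         (fun e : R => e^-1 *: (h (e *: w + (x + u *: w)) - h (x + u *: w))).
  apply/funext => e; congr (_ *: (h _ - _)).
  by rewrite [e *: 1]mulr1 scalerDl addrCA.
apply: DeriveDef; last by rewrite /derive /= /shift /= E.
by rewrite /derivable /= /shift /= E; exact: diff_derivable.
Qed.

Lemma diff_eps (V W : normedModType R) (f : V -> W) (L : {linear V -> W}) x :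
  continuous L ->
  (forall e : R, 0 < e ->
    \forall v \near (0 : V), `|f (v + x) - f x - L v| <= e * `|v|) ->
  differentiable f x /\ forall v, 'D_v f x = L v.
Proof.
move=> cL fL.
have H : f \o shift x = cst (f x) + L +o_ 0 id.
  apply/eqaddoP => e e0; have := fL e e0; apply: filterS => v.
  by rewrite !fctE /= opprD addrA.
have dE := diff_unique cL H.
have df : differentiable f x by apply/diff_locallyP; rewrite dE; split.
by split => // v; rewrite deriveE// dE.
Qed.

Definition lincomb n (W : lmodType R) (c : 'I_n -> W) (v : 'rV[R]_n) : W :=
  \sum_j v 0 j *: c j.

Lemma lincomb_is_linear n (W : lmodType R) (c : 'I_n -> W) : linear (lincomb c).
Proof.
move=> a u v; rewrite /lincomb scaler_sumr -big_split; apply: eq_bigr => j _.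
by rewrite /= !mxE scalerDl scalerA.
Qed.

HB.instance Definition _ n (W : lmodType R) (c : 'I_n -> W) :=
  GRing.isLinear.Build R 'rV[R]_n W *:%R (@lincomb n W c) (lincomb_is_linear c).

End Calculus.

Section Parametric.
Context {R : realType} (n : nat).
Implicit Types (U : set 'rV[R]_n) (h : 'rV[R]_(1 + n) -> R).

Definition tpoint (t : R) (r : 'rV[R]_n) : 'rV[R]_(1 + n) := row_mx (const_mx t) r.

Lemma tpointE t r : tpoint t r = t *: tpoint 1 0 + row_mx 0 r.
Proof.
rewrite /tpoint scale_row_mx scaler0 add_row_mx addr0 add0r; congr row_mx.
by apply/rowP => i; rewrite !mxE mulr1.
Qed.

Lemma tpointD t r v u : tpoint t (r + u *: v) = tpoint t r + u *: row_mx 0 v.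
Proof. by rewrite /tpoint scale_row_mx add_row_mx scaler0 addr0. Qed.

Lemma rsub_tpoint t r : rsubmx (tpoint t r) = r.
Proof. exact: row_mxKr. Qed.

Lemma tpoint_cont : continuous (fun p : R * 'rV[R]_n => tpoint p.1 p.2).
Proof.
rewrite (_ : (fun _ => _) =
  fun p : R * 'rV[R]_n => p.1 *: tpoint 1 0 + mulmxr (row_mx 0 1%:M) p.2); last first.
  by apply/funext => p; rewrite tpointE /= mul_mx_row mulmx0 mulmx1.
move=> p; apply: cvgD.
  by apply: cvgZ; [exact: cvg_fst|exact: cvg_cst].
apply: (@continuous_comp _ _ _ (@snd R 'rV[R]_n) (mulmxr (row_mx 0 1%:M))); first exact: cvg_snd.
exact: continuous_lin_rV.
Qed.

Lemma tpoint_cont_l r : continuous (tpoint ^~ r).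
Proof.
rewrite (_ : tpoint ^~ r = fun t => t *: tpoint 1 0 + row_mx 0 r); last first.
  by apply/funext => t; rewrite tpointE.
move=> t; apply: cvgD; last exact: cvg_cst.
by apply: cvgZ; [exact: cvg_id|exact: cvg_cst].
Qed.

Definition cyl U : set 'rV[R]_(1 + n) := [set z | U (rsubmx z)].

Lemma open_cyl U : open U -> open (cyl U).
Proof. by move=> oU; apply: open_comp => // x _; exact: continuous_rsubmx. Qed.

Lemma cont_tslice U h r : Ck 0 (cyl U) (h : _ -> R^o) -> U r ->
  continuous (fun t => h (tpoint t r)).
Proof.
move=> ch Ur t; apply: (@continuous_comp _ _ _ (tpoint ^~ r) h).
  exact: tpoint_cont_l.
by apply: ch; rewrite /cyl /= rsub_tpoint.
Qed.

Lemma tube U h r e : Ck 0 (cyl U) (h : _ -> R^o) -> U r -> 0 < e ->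
  \forall r' \near r, forall t, 0 <= t <= 1 ->
    `|h (tpoint t r') - h (tpoint t r)| < e.
Proof.
move=> ch Ur e0.
have := @segment_compact R 0 1 => /compact_near_coveringP.
move=> /(_ _ (nbhs r) (fun r' t => `|h (tpoint t r') - h (tpoint t r)| < e)).
move=> H; have {H} : \forall r' \near r,
    `[0, 1]%classic `<=` (fun t => `|h (tpoint t r') - h (tpoint t r)| < e).
  apply: H => t _.
  have c : {for (t, r), continuous (fun p : R * 'rV[R]_n =>
      h (tpoint p.1 p.2) - h (tpoint p.1 r) : R^o)}.
    have ct : {for tpoint t r, continuous (h : _ -> R^o)}.
      by apply: ch; rewrite /cyl /= rsub_tpoint.
    apply: cvgB.
      apply: (@continuous_comp _ _ _ (fun p : R * 'rV[R]_n => tpoint p.1 p.2) h) => //.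
      exact: tpoint_cont.
    apply: (@continuous_comp _ _ _ (fun p : R * 'rV[R]_n => tpoint p.1 r) h) => //.
    apply: (@continuous_comp _ _ _ fst (tpoint ^~ r)); first exact: cvg_fst.
    exact: tpoint_cont_l.
  move: c => /cvgr_dist_lt /(_ _ e0) [[A B] /= [At Br] AB].
  exists (A, B) => // -[t' r'] /= ABt.
  by have := AB (t', r') ABt; rewrite /= subrr add0r normrN.
by apply: filterS => r' H t t01; apply: H; rewrite /= in_itv.
Qed.

(** Differentiation under the integral sign, for total differentials because [Ck] asks for
    [differentiable]. For each t the mean value theorem turns the error into a difference of
    derivatives at two points, which [tube] bounds uniformly in t. *)
Lemma int01_diff U h r : open U -> Ck 1 (cyl U) (h : _ -> R^o) -> U r ->
  differentiable (fun r => int01 (fun t => h (tpoint t r)) : R^o) r /\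
  forall v, 'D_v (fun r => int01 (fun t => h (tpoint t r)) : R^o) r =
    int01 (fun t => 'D_(row_mx 0 v) (h : _ -> R^o) (tpoint t r)).
Proof.
move=> oU C1 Ur; have C0 := Ck_pred C1; move: C1 => [dh Dh].
have cylt r' t : U r' -> cyl U (tpoint t r') by rewrite /cyl /= rsub_tpoint.
set f := fun r => _.
pose g j := ('D_(row_mx 0 'e_j) (h : _ -> R^o)).
pose c j : R^o := int01 (fun t => g j (tpoint t r)).
pose L := lincomb c.
have gE v t r' : U r' -> 'D_(row_mx 0 v) (h : _ -> R^o) (tpoint t r') =
    \sum_j v 0 j * g j (tpoint t r').
  move=> Ur'; have d := dh _ (cylt _ t Ur').
  rewrite /g deriveE// [in row_mx 0 v](row_sum_delta v).
  rewrite (_ : row_mx _ _ = \sum_j v 0 j *: row_mx 0 'e_j); last first.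
    rewrite [RHS](_ : _ = \sum_j mulmxr (row_mx 0 1%:M) (v 0 j *: 'e_j)).
      by rewrite -linear_sum/= mul_mx_row mulmx0 mulmx1.
    by apply: eq_bigr => j _; rewrite linearZ/= mul_mx_row mulmx0 mulmx1.
  by rewrite linear_sum; apply: eq_bigr => j _; rewrite linearZ/= deriveE.
have cg j : continuous (fun t => g j (tpoint t r)).
  exact: (cont_tslice (Dh _) Ur).
have int_sum (s : seq 'I_n) (v : 'rV[R]_n) : continuous (fun t => \sum_(j <- s) v 0 j * g j (tpoint t r)) /\
   int01 (fun t => \sum_(j <- s) v 0 j * g j (tpoint t r)) = \sum_(j <- s) v 0 j * c j.
  elim: s => [|j s [IH1 IH2]].
    under eq_fun do rewrite big_nil; rewrite big_nil int01_cst; split => // x; exact: cvg_cst.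
  have cj : continuous (fun t => v 0 j * g j (tpoint t r)).
    by move=> t; apply: cvgM; [exact: cvg_cst|exact: cg].
  under eq_fun do rewrite big_cons; rewrite big_cons; split.
    by move=> t; apply: cvgD; [exact: cj|exact: IH1].
  by rewrite int01D// int01Z// IH2.
have LE v : lincomb c v = int01 (fun t => 'D_(row_mx 0 v) (h : _ -> R^o) (tpoint t r)).
  rewrite (_ : (fun _ => _) = fun t => \sum_j v 0 j * g j (tpoint t r)).
    by have [_ ->] := int_sum (index_enum _) v.
  by apply/funext => t; rewrite gE.
have [] := @diff_eps _ _ _ (f : _ -> R^o) L r; last first.
- by move=> df Df; split => // v; rewrite -LE; exact: Df.
- move=> e e0.
  (* The error is a sum of n terms, each at most [|v| * e']; dividing by n + 1 also covers n = 0. *)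
  pose e' := e / n.+1%:R.
  have e'0 : 0 < e' by rewrite divr_gt0.
  have T : \forall r' \near r, U r' /\ forall j t, 0 <= t <= 1 ->
      `|g j (tpoint t r') - g j (tpoint t r)| < e'.
    apply: filterI; first exact: open_nbhs_nbhs.
    have Tj j := @tube U (g j) r e' (Dh _) Ur e'0.
    exact: (@filter_forall _ _ _ (nbhs r) (nbhs_filter r) Tj).
  move: T => /nbhs_normP[d /= d0 T]; apply/nbhs_normP; exists d => //= v.
  rewrite /ball_/= sub0r normrN => vd.
  have Bv (u : R) : 0 <= u <= 1 -> U (r + u *: v) /\ forall j t, 0 <= t <= 1 ->
      `|g j (tpoint t (r + u *: v)) - g j (tpoint t r)| < e'.
    move=> /andP[u0 u1]; apply: T; rewrite /ball_/= opprD addNKr normrN normrZ.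
    apply: le_lt_trans vd; rewrite ger0_norm//.
    by rewrite -[leRHS]mul1r ler_wpM2r.
  have U1 : U (v + r).
    have [|+ _] := Bv 1; first by rewrite ler01 lexx.
    by rewrite scale1r addrC.
  have cD : continuous (fun t => 'D_(row_mx 0 v) (h : _ -> R^o) (tpoint t r)).
    exact: (cont_tslice (Dh _) Ur).
  rewrite LE /f.
  have cN (k : R -> R) : continuous k -> continuous (fun t => -1 * k t).
    by move=> ck t; apply: cvgM; [exact: cvg_cst|exact: ck].
  have cD2 (k k' : R -> R) : continuous k -> continuous k' -> continuous (fun t => k t + k' t).
    by move=> ck ck' t; apply: cvgD; [exact: ck|exact: ck'].
  have c1 := cont_tslice C0 U1; have c2 := cont_tslice C0 Ur.
  rewrite (_ : _ - _ = int01 (fun t => h (tpoint t (v + r)) + (-1 * h (tpoint t r) +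
     -1 * 'D_(row_mx 0 v) (h : _ -> R^o) (tpoint t r)))); last first.
    rewrite int01D//; last by apply: (cD2); exact: (cN).
    rewrite int01D//; [|exact: (cN)|exact: (cN)].
    by rewrite !int01Z// !mulN1r addrA.
  apply: int01_le => [|t t01].
    by apply: (cD2) => //; apply: (cD2); exact: (cN).
  have [u] : exists2 u, u \in `[0, 1]%R &
    h (tpoint t (r + 1 *: v)) - h (tpoint t (r + 0 *: v)) =
    'D_(row_mx 0 v) (h : _ -> R^o) (tpoint t r + u *: row_mx 0 v) * (1 - 0).
    have dl (u : R) : 0 <= u <= 1 -> is_derive u 1 (fun u : R => h (tpoint t (r + u *: v)) : R^o)
       ('D_(row_mx 0 v) (h : _ -> R^o) (tpoint t r + u *: row_mx 0 v)).
      move=> u01; rewrite (_ : (fun _ => _) = fun u => h (tpoint t r + u *: row_mx 0 v)).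
        apply: is_derive_line; apply: dh; rewrite -tpointD; apply: cylt.
        by have [] := Bv _ u01.
      by apply/funext => u'; rewrite tpointD.
    apply: (MVT_segment (f := fun u => h (tpoint t (r + u *: v)))) => // [u u01|].
      by apply: dl; move: u01; rewrite in_itv/= => /andP[/ltW -> /ltW ->].
    apply: derivable_within_continuous => u; rewrite in_itv/= => /dl [].
    by [].
  rewrite in_itv/= => u01; rewrite scale1r scale0r addr0 subr0 mulr1 [r + v]addrC => E.
  rewrite !mulN1r addrA E -tpointD.
  have [Uu gu] := Bv _ u01.
  rewrite !gE// -sumrB; apply: (le_trans (ler_norm_sum _ _ _)).
  apply: (@le_trans _ _ (\sum_(j < n) `|v| * e')).
    apply: ler_sum => j _; rewrite -mulrBr normrM ler_pM//; last exact/ltW/gu.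
    rewrite [leRHS]/Num.Def.normr /= mx_normrE; apply/bigmax_geP; right => /=.
    by exists (0, j).
  rewrite sumr_const card_ord -[leLHS]mulr_natr /e' [leRHS]mulrC -mulrA ler_wpM2l//.
  rewrite -mulrA ler_piMr ?(ltW e0)// ler_pdivrMl// mulr1 ler_nat//.
- exact: continuous_lin_rV.
Qed.

(** A directional derivative of the integral is again such an integral, with the integrand
    differentiated along (0, v), so the induction on the order closes. *)
Lemma smooth_int01 U h : open U -> smooth (cyl U) (h : _ -> R^o) ->
  smooth U (fun r => int01 (fun t => h (tpoint t r)) : R^o).
Proof.
move=> oU + k; elim: k h => [|k IH] h sh /=.
  move=> r Ur; apply: differentiable_continuous.
  by have [] := int01_diff oU (sh 1%N) Ur.
split => [r Ur|v]; first by have [] := int01_diff oU (sh 1%N) Ur.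
apply: (@Ck_ext _ _ _ _ _ _
  (fun r => int01 (fun t => 'D_(row_mx 0 v) (h : _ -> R^o) (tpoint t r)))) => //.
  by move=> r Ur; have [_ ->] := int01_diff oU (sh 1%N) Ur.
by apply: (IH ('D_(row_mx 0 v) (h : _ -> R^o))) => k'; have [_] := sh k'.+1; apply.
Qed.

End Parametric.

(** * Plots of paths and the operator K *)

Section SmoothTools.
Context {R : realType}.
Implicit Types V W : normedModType R.

Lemma derive_line0 V W (F : V -> W) z w :
  'D_w F z = 'D_1 (fun u : R => F (z + u *: w)) 0.
Proof.
have E : (fun e : R => e^-1 *: (F (z + (e *: 1 + 0) *: w) - F (z + 0 *: w))) =
         (fun e : R => e^-1 *: (F (e *: w + z) - F z)).
  by apply/funext => e; rewrite [e *: 1]mulr1 addr0 scale0r addr0 [z + _]addrC.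
by rewrite /derive /= /shift /= E.
Qed.

Lemma derive_lineE V W (F : V -> W) z w c :
  is_derive (0 : R) 1 (fun u : R => F (z + u *: w)) c -> 'D_w F z = c.
Proof. by move=> H; rewrite derive_line0; exact: derive_val. Qed.

Lemma is_derive_affine W (a : R -> R) (u a' : R) (b c : W) :
  is_derive u 1 a a' -> is_derive u 1 (fun u : R => b + a u *: c) (a' *: c).
Proof.
move=> [da <-].
have E : (fun e : R => e^-1 *: ((b + a (e *: 1 + u) *: c) - (b + a u *: c))) =
         (fun e : R => (e^-1 *: (a (e *: 1 + u) - a u)) *: c).
  by apply/funext => e; rewrite opprD addrACA subrr add0r -scalerBl scalerA.
have C : (fun e : R => (e^-1 *: (a (e *: 1 + u) - a u)) *: c) @ 0^' --> 'D_1 a u *: c.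
  by apply: cvgZ; [exact: da|exact: cvg_cst].
by apply: DeriveDef; rewrite ?/derivable /derive /= /shift /= E;
  [apply/cvg_ex; eexists; exact: C|exact: cvg_lim C].
Qed.

Lemma is_derive_lin V W W' (L : {linear W -> W'}) (f : V -> W) (f' : W) b x v :
  continuous L -> is_derive x v f f' -> is_derive x v (fun y => b + L (f y)) (L f').
Proof.
move=> cL [df <-].
have E : (fun e : R => e^-1 *: ((b + L (f (e *: v + x))) - (b + L (f x)))) =
         (fun e : R => L (e^-1 *: (f (e *: v + x) - f x))).
  by apply/funext => e; rewrite opprD addrACA subrr add0r -linearB -linearZ.
have C : (fun e : R => L (e^-1 *: (f (e *: v + x) - f x))) @ 0^' --> L ('D_v f x).
  exact: (continuous_cvg _ (cL _) df).
by apply: DeriveDef; rewrite ?/derivable /derive /= /shift /= E;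
  [apply/cvg_ex; eexists; exact: C|exact: cvg_lim C].
Qed.

Lemma derive_affine V W (F : V -> W) z w c :
  (forall u : R, F (z + u *: w) = F z + u *: c) -> 'D_w F z = c.
Proof.
move=> FE; apply: derive_lineE.
rewrite (_ : (fun u => _) = (fun u : R => F z + u *: c)); last exact/funext.
by rewrite -[c in is_derive _ _ _ c]scale1r; apply: (is_derive_affine (a := id)).
Qed.

Lemma smoothD V W (U : set V) (f g : V -> W) : open U ->
  smooth U f -> smooth U g -> smooth U (fun x => f x + g x).
Proof. by move=> oU sf sg k; apply: CkD. Qed.

Lemma smoothZ V W (U : set V) (a : V -> R) (f : V -> W) : open U ->
  smooth U (a : V -> R^o) -> smooth U f -> smooth U (fun x => a x *: f x).
Proof. by move=> oU sa sf k; apply: CkZ. Qed.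

Lemma smoothM V (U : set V) (f g : V -> R) : open U ->
  smooth U (f : V -> R^o) -> smooth U (g : V -> R^o) ->
  smooth U ((fun x => f x * g x) : V -> R^o).
Proof. by move=> oU sf sg k; apply: (@CkZ R k V R^o). Qed.

Lemma smooth_cst V W (U : set V) (c : W) : smooth U (fun _ : V => c).
Proof. by move=> k; exact: Ck_cst. Qed.

Lemma smooth_ext V W (U : set V) (f g : V -> W) : open U ->
  (forall x, U x -> f x = g x) -> smooth U g -> smooth U f.
Proof. by move=> oU fg sg k; exact: Ck_ext (sg k). Qed.

Lemma smooth_sub V W (U U' : set V) (f : V -> W) :
  U' `<=` U -> smooth U f -> smooth U' f.
Proof. by move=> sU sf k; exact: Ck_sub (sf k). Qed.

Lemma smooth_id n (U : set 'rV[R]_n) : smooth U (fun x => x).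
Proof. exact: (@smooth_lin_rV _ n 'rV[R]_n U idfun). Qed.

Lemma smooth_coord n (U : set 'rV[R]_n) i : smooth U ((fun x => x 0 i) : _ -> R^o).
Proof.
rewrite (_ : (fun x => _) = lincomb (W := R^o) (fun j => (j == i)%:R)).
  exact: smooth_lin_rV.
apply/funext => x; rewrite /lincomb (bigD1 i)//= eqxx big1 => [|j /negbTE->].
  by rewrite addr0 [RHS]mulr1.
by rewrite scaler0.
Qed.

Lemma smooth_tpoint V n (U : set V) (a : V -> R) (b : V -> 'rV[R]_n) : open U ->
  smooth U (a : V -> R^o) -> smooth U b -> smooth U (fun x => tpoint (a x) (b x)).
Proof.
move=> oU sa sb; apply: smooth_row_mx => //.
apply: (@smooth_ext _ _ _ _ (fun x => a x *: const_mx 1)) => // [x _|].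
  by apply/rowP => i; rewrite !mxE mulr1.
by apply: smoothZ => //; exact: smooth_cst.
Qed.

Lemma smooth_rsubmx n m (U : set 'rV[R]_(n + m)) : smooth U (fun z => rsubmx z).
Proof. exact: smooth_lin_rV. Qed.

Lemma smooth_lsubmx n m (U : set 'rV[R]_(n + m)) : smooth U (fun z => lsubmx z).
Proof. exact: smooth_lin_rV. Qed.

Lemma smooth_time n (U : set 'rV[R]_(1 + n)) :
  smooth U ((fun z => lsubmx z 0 0) : _ -> R^o).
Proof.
rewrite (_ : (fun z : 'rV[R]_(1 + n) => _) = fun z => z 0 (lshift n 0)); first exact: smooth_coord.
by apply/funext => z; rewrite mxE.
Qed.

Lemma tpoint_time t n (r : 'rV[R]_n) : lsubmx (tpoint t r) 0 0 = t.
Proof. by rewrite row_mxKl mxE. Qed.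

Lemma tpointDl t u n (r : 'rV[R]_n) : tpoint (t + u) r = tpoint t r + u *: tpoint 1 0.
Proof. by rewrite tpointE scalerDl addrAC -tpointE. Qed.

Lemma tpoint_eta n (z : 'rV[R]_(1 + n)) : tpoint (lsubmx z 0 0) (rsubmx z) = z.
Proof.
rewrite -[RHS]hsubmxK /tpoint; congr row_mx; apply/rowP => i.
by rewrite !mxE ord1.
Qed.

End SmoothTools.

Section Plots.
Context {R : realType} (X : diffSpace R).

Lemma plot_real n (U : set 'rV[R]_n) (a : 'rV[R]_n -> R) : open U ->
  smooth U (a : _ -> R^o) -> plot (d := real_line R) U a.
Proof. by []. Qed.

(** The real variable is passed through ['rV_1], because [smooth_comp] composes with maps defined on
    row vectors. *)
Lemma dsmooth_smooth (h : R -> R) (V : normedModType R) (U : set V) (a : V -> R) :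
  dsmooth (X := real_line R) (Y := real_line R) h -> open U ->
  smooth U (a : V -> R^o) -> smooth U ((fun x => h (a x)) : V -> R^o).
Proof.
move=> sh oU sa.
have [_ sh1] := sh 1%N setT (fun x => x 0 0) (conj openT (@smooth_coord R 1 setT 0)).
rewrite (_ : (fun x => _) = ((h \o (fun x : 'rV[R]_1 => x 0 0)) : _ -> R^o) \o
   (fun x => a x *: const_mx 1)); last by apply/funext => x /=; rewrite !mxE mulr1.
apply: (smooth_comp oU openT) => //.
by apply: smoothZ => //; exact: smooth_cst.
Qed.

Definition Kplot n (P : 'rV[R]_n -> Paths X) (z : 'rV[R]_(1 + n)) : X :=
  ev (lsubmx z 0 0) (P (rsubmx z)).

Lemma plot_ev n m (U : set 'rV[R]_n) (P : 'rV[R]_n -> Paths X)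
    (W : set 'rV[R]_m) (a : 'rV[R]_m -> R) (b : 'rV[R]_m -> 'rV[R]_n) :
  plot U P -> open W -> smooth W (a : _ -> R^o) -> smooth W b ->
  (forall z, W z -> U (b z)) -> plot W (fun z => ev (a z) (P (b z))).
Proof.
move=> [oU pP] oW sa sb bU.
have pa : plot (d := real_line R) setT (fun x : 'rV[R]_1 => x 0 0).
  by apply: plot_real; [exact: openT|exact: smooth_coord].
have := plot_comp (pP _ _ _ pa) oW (F := fun z => row_mx (b z) (a z *: const_mx 1)).
move=> H; apply: (plot_ext (H _ _)) => [|z Wz|z Wz].
- apply: smooth_row_mx => //; apply: smoothZ => //; exact: smooth_cst.
- by rewrite /= row_mxKl; split => //; exact: bU.
- by rewrite /= row_mxKl row_mxKr !mxE mulr1.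
Qed.

Lemma plot_Kplot n (U : set 'rV[R]_n) P : plot U P -> plot (cyl U) (@Kplot n P).
Proof.
move=> pP; apply: (plot_ev pP) => //.
- by apply: open_cyl; exact: plot_open pP.
- exact: smooth_time.
- exact: smooth_rsubmx.
Qed.

(** The functional diffeology tests against every plot [Q] of the line, but the identity is
    universal: the test against [Q] is [Kplot P] with [Q] substituted for the time. The substitution
    also swaps the two blocks, since [Kplot] puts the time first. *)
Lemma plot_Paths n (U : set 'rV[R]_n) (P : 'rV[R]_n -> Paths X) : open U ->
  plot (cyl U) (Kplot P) -> plot U P.
Proof.
move=> oU pP; split => // m V Q [oV sQ].
have oW : open [set z : 'rV[R]_(n + m) | U (lsubmx z) /\ V (rsubmx z)].
  rewrite (_ : [set _ | _] = lsubmx @^-1` U `&` rsubmx @^-1` V)//.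
  apply: openI; apply: open_comp => // x _.
  - exact: continuous_lsubmx.
  - exact: continuous_rsubmx.
have := plot_comp pP oW (F := fun z => tpoint (Q (rsubmx z)) (lsubmx z)).
move=> H; apply: (plot_ext (H _ _)) => [|z [Uz Vz]|z _].
- apply: smooth_tpoint => //; last exact: smooth_lsubmx.
  by apply: (smooth_comp (F := rsubmx) oW oV _ _ sQ) => [z []//|]; exact: smooth_rsubmx.
- by rewrite /cyl /= rsub_tpoint.
- by rewrite /Kplot /= rsub_tpoint tpoint_time.
Qed.

Definition line_plot (p : Paths X) (x : 'rV[R]_1) : X := ev (x 0 0) p.

Lemma plot_line (p : Paths X) : plot setT (line_plot p).
Proof.
apply: (svalP p); apply: plot_real; [exact: openT|exact: smooth_coord].
Qed.

Lemma mk_path (P : 'rV[R]_1 -> X) : plot setT P ->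
  exists p : Paths X, forall t, ev t p = P (const_mx t).
Proof.
move=> pP.
have sP : dsmooth (X := real_line R) (fun t => P (const_mx t)).
  move=> n U a [oU sa].
  apply: (plot_ext (plot_comp pP oU (F := fun z => a z *: const_mx 1) _ _)) => //.
    by apply: smoothZ => //; exact: smooth_cst.
  by move=> z _ /=; congr P; apply/rowP => i; rewrite !mxE mulr1.
by exists (exist _ _ sP).
Qed.

End Plots.

Section Forms.
Context {R : realType}.
Implicit Types X : diffSpace R.

(** Compatibility with the identity map on the overlap of [U] and [V] computes both sides from one
    plot. The vectors are first written as derivatives of the identity, so that [dform_compat]
    applies from right to left. *)
Lemma dform_local k X (a : pre_dform k X) n (U V : set 'rV[R]_n)
    (P Q : 'rV[R]_n -> X) : is_dform a -> plot U P -> plot V Q ->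
  (forall t, U t -> V t -> P t = Q t) ->
  forall r, U r -> V r -> forall v, a n U P r v = a n V Q r v.
Proof.
move=> da pP pQ PQ r Ur Vr v.
have oU := plot_open pP; have oV := plot_open pQ.
have oW : open (U `&` V) by exact: openI.
have Did : (fun i => 'D_(v i) (fun x : 'rV[R]_n => x) r) = v.
  by apply/funext => i; apply: derive_affine.
rewrite -[in LHS]Did -[in RHS]Did.
rewrite -(dform_compat da (V := U `&` V) (Q := P) pP)//; last first.
- by move=> ? [].
- exact: smooth_id.
rewrite -(dform_compat da (V := U `&` V) (Q := P) pQ)//; last first.
- by move=> x [/PQ]; apply.
- by move=> ? [].
- exact: smooth_id.
Qed.

Definition Kvec k n (v : 'I_k -> 'rV[R]_n) (j : 'I_k.+1) : 'rV[R]_(1 + n) :=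
  if unlift ord0 j is Some i then row_mx 0 (v i) else row_mx (const_mx 1) 0.

Lemma Kvec_lift k n (v : 'I_k -> 'rV[R]_n) i : Kvec v (lift ord0 i) = row_mx 0 (v i).
Proof. by rewrite /Kvec liftK. Qed.

Lemma Kvec0 k n (v : 'I_k -> 'rV[R]_n) : Kvec v ord0 = tpoint 1 0.
Proof. by rewrite /Kvec unlift_none. Qed.

Lemma KopE k X (a : pre_dform k.+1 X) n (U : set 'rV[R]_n) P r v :
  Kop a U P r v = int01 (fun t => a (1 + n)%N (cyl U) (Kplot P) (tpoint t r) (Kvec v)).
Proof. by []. Qed.

Lemma cont_dens k X (a : pre_dform k.+1 X) : is_dform a ->
  forall n (U : set 'rV[R]_n) P, plot U P -> forall r, U r -> forall v,
  continuous (fun t => a (1 + n)%N (cyl U) (Kplot P) (tpoint t r) v).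
Proof.
move=> da n U P pP r Ur v.
exact: (cont_tslice (dform_smooth da (plot_Kplot pP) v 0%N) Ur).
Qed.

Lemma Kop_is_dform k X (a : pre_dform k.+1 X) : is_dform a -> is_dform (Kop a).
Proof.
move=> da; split.
- move=> n U P pP r Ur v i c u w; rewrite !KopE.
  have cc := cont_dens da pP Ur.
  have Kupd x : Kvec [eta v with i |-> x] =
      [eta Kvec v with lift ord0 i |-> row_mx 0 x].
    apply/funext => j; rewrite /Kvec /=; case: unliftP => [j' ->|->].
      by rewrite (inj_eq lift_inj); case: ifP.
    by rewrite (negbTE (neq_lift _ _)).
  rewrite -int01Z// -int01D//; last by move=> t; apply: cvgM; [exact: cvg_cst|exact: cc].
  apply: eq_int01 => t _; rewrite !Kupd -(dform_linear da)//; last first.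
  + by rewrite /cyl /= rsub_tpoint.
  + exact: plot_Kplot.
  congr (a _ _ _ _ _); apply/funext => j /=; case: ifP => // _.
  by rewrite scale_row_mx add_row_mx scaler0 addr0.
- move=> n U P pP r Ur v i j ij vij; rewrite KopE -[RHS](int01_cst 0).
  apply: eq_int01 => t _.
  apply: (dform_alternating da (plot_Kplot pP) _ (i := lift ord0 i) (j := lift ord0 j)).
  + by rewrite /cyl /= rsub_tpoint.
  + by rewrite (inj_eq lift_inj).
  + by rewrite !Kvec_lift vij.
- move=> n U P pP v.
  apply: (smooth_int01 (h := fun z => a _ (cyl U) (Kplot P) z (Kvec v))).
    exact: plot_open pP.
  exact: (dform_smooth da (plot_Kplot pP)).
- move=> n m U P V F Q pP oV sF FU QP r Vr v; rewrite !KopE.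
  apply: eq_int01 => t _.
  (* [G] is [F] with the time carried along. Its differential fixes (1, 0) and sends (0, v) to (0,
     D_v F), hence [Kvec] to [Kvec]. *)
  pose G (z : 'rV[R]_(1 + m)) : 'rV[R]_(1 + n) := tpoint (lsubmx z 0 0) (F (rsubmx z)).
  have oc := open_cyl oV.
  have sG : smooth (cyl V) G.
    apply: smooth_tpoint => //; first exact: smooth_time.
    by apply: (smooth_comp (F := rsubmx) oc oV _ _ sF) => //; exact: smooth_rsubmx.
  have ct : cyl V (tpoint t r) by rewrite /cyl /= rsub_tpoint.
  rewrite (dform_compat da (plot_Kplot pP) oc sG)//; last 2 first.
  + by move=> z Vz; rewrite /cyl /= /G rsub_tpoint; exact: FU.
  + by move=> z Vz; rewrite /Kplot /G rsub_tpoint tpoint_time QP.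
  rewrite {1}/G rsub_tpoint tpoint_time; congr (a _ _ _ _ _); apply/funext => j.
  rewrite /Kvec; case: unliftP => [i _|_].
    have dF : differentiable F r by have [+ _] := sF 1%N; apply.
    apply: derive_lineE.
    rewrite (_ : (fun u => _) =
        fun u : R => tpoint t 0 + mulmxr (row_mx 0 1%:M) (F (r + u *: v i))).
      have -> : row_mx 0 ('D_(v i) F r) = mulmxr (row_mx (0 : 'M[R]_(n, 1)) 1%:M) ('D_(v i) F r).
        by rewrite /= mul_mx_row mulmx0 mulmx1.
      apply: is_derive_lin; first exact: continuous_lin_rV.
      rewrite -[r in is_derive _ _ _ ('D_(v i) F r)]addr0 -(scale0r (v i)).
      by apply: is_derive_line; rewrite scale0r addr0.
    apply/funext => u; rewrite /G -tpointD rsub_tpoint tpoint_time /=.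
    by rewrite mul_mx_row mulmx0 mulmx1 add_row_mx addr0 add0r.
  by apply: derive_affine => u; rewrite /G -tpointDl !rsub_tpoint !tpoint_time tpointDl.
Qed.

End Forms.

(** * Concatenation *)

Section RealFunctions.
Context {R : realType}.

Lemma is_derive_comp (f g : R -> R) (x f' g' : R) :
  is_derive x 1 f f' -> is_derive (f x) 1 g g' ->
  is_derive x 1 (fun y => g (f y)) (g' * f').
Proof.
move=> [df f'E] [dg g'E]; apply: DeriveDef.
  apply/derivable1_diffP; apply: differentiable_comp; exact/derivable1_diffP.
by rewrite -derive1E (derive1_comp df dg) !derive1E f'E g'E.
Qed.

Lemma is_derive_affine1 (a b x : R) : is_derive x 1 (fun y : R => a * y + b) a.
Proof.
have := @is_derive_affine R R^o id x 1 b a (is_derive_id _ _).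
rewrite scale1r; congr (is_derive _ _ _ _).
by apply/funext => y; rewrite addrC; congr (_ + _); exact: mulrC.
Qed.

Lemma dsmooth_derive (h : R -> R) :
  dsmooth (X := real_line R) (Y := real_line R) h ->
  exists2 h' : R -> R, continuous h' & forall t : R, is_derive t 1 h (h' t).
Proof.
move=> sh.
have [_ sh1] := sh 1%N setT (fun x => x 0 0) (conj openT (@smooth_coord R 1 setT 0)).
set S := _ \o _ in sh1.
exists (fun t => 'D_(const_mx 1) (S : _ -> R^o) (0 + t *: const_mx 1)).
  move=> t; apply: (@continuous_comp _ _ _ (fun t : R => 0 + t *: (const_mx 1 : 'rV[R]_1))
      ('D_(const_mx 1) (S : _ -> R^o))).
    apply: cvgD; first exact: cvg_cst.
    by apply: cvgZ; [exact: cvg_id|exact: cvg_cst].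
  by have [_ c] := sh1 1%N; exact: (c _ _ I).
move=> t; have := @is_derive_line R _ _ (S : _ -> R^o) 0 (const_mx 1) t.
rewrite (_ : (fun u' : R => _) = h).
  by apply; have [+ _] := sh1 1%N; apply.
by apply/funext => u; rewrite /S /= !mxE add0r mulr1.
Qed.

Variable s : smashing R.

(** Flatness at both ends is what makes the inactive half of a concatenation disappear from
    derivatives. *)
Lemma smash_derive : exists2 s' : R -> R, continuous s' &
  [/\ forall t : R, is_derive t 1 s (s' t),
      forall t, t < smash_eps s -> s' t = 0 &
      forall t, 1 - smash_eps s < t -> s' t = 0].
Proof.
have [s' cs' ds'] := dsmooth_derive (smash_smooth s).
exists s' => //; split => // t te.
- have [_ <-] := ds' t; rewrite (@near_eq_derive _ _ _ _ (cst 0)) ?derive_cst//.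
  by near=> u; rewrite smash_left//; apply: ltW; near: u; by apply: open_nbhs_nbhs; split => //; exact: open_lt.
- have [_ <-] := ds' t; rewrite (@near_eq_derive _ _ _ _ (cst (1 : R^o))) ?derive_cst//.
  by near=> u; rewrite smash_right//; apply: ltW; near: u; by apply: open_nbhs_nbhs; split => //; exact: open_gt.
Unshelve. all: by end_near. Qed.

End RealFunctions.

Section ConcatPlots.
Context {R : realType} (s : smashing R).
Implicit Types X : diffSpace R.

(** The formula of the first half remains valid a little beyond 1/2, because both halves are
    stationary there. With [ev_concat_right] this yields two overlapping open intervals, on each of
    which a concatenation is a plain reparametrization. *)
Lemma ev_concat_left X (p q : Paths X) t : ev 1 p = ev 0 q ->
  t < 2^-1 + smash_eps s / 2 -> ev t (concat s p q) = ev (s (2 * t)) p.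
Proof.
move=> pq te; rewrite /concat; case: pselect => // pq'.
rewrite /ev /= /concat_fun; case: leP => // t2.
rewrite smash_left; last by lra.
by rewrite smash_right ?pq//; have := smash_eps_gt0 s; lra.
Qed.

Lemma ev_concat_right X (p q : Paths X) t : ev 1 p = ev 0 q ->
  2^-1 - smash_eps s / 2 < t -> ev t (concat s p q) = ev (s (2 * t - 1)) q.
Proof.
move=> pq te; rewrite /concat; case: pselect => // pq'.
rewrite /ev /= /concat_fun; case: leP => // t2.
rewrite smash_right; last by lra.
by rewrite smash_left -?pq//; have := smash_eps_gt0 s; lra.
Qed.

Lemma smooth_affine n (U : set 'rV[R]_n) (f : 'rV[R]_n -> R) a b : open U ->
  smooth U (f : _ -> R^o) -> smooth U ((fun x => a * f x + b) : _ -> R^o).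
Proof.
move=> oU sf; apply: smoothD => //; last exact: smooth_cst.
by apply: smoothM => //; exact: smooth_cst.
Qed.

Lemma plot_concat X n (U : set 'rV[R]_n) (P Q : 'rV[R]_n -> Paths X) :
  plot U P -> plot U Q -> (forall r, U r -> ev 1 (P r) = ev 0 (Q r)) ->
  plot U (fun r => concat s (P r) (Q r)).
Proof.
move=> pP pQ PQ; have oU := plot_open pP; apply: plot_Paths => //.
have oc := open_cyl oU; have e0 := smash_eps_gt0 s.
have oA (A : set R) : open A -> open (cyl U `&` (fun z => lsubmx z 0 0) @^-1` A).
  by move=> oA; exact: (open_preimage oc oA (@smooth_time R n _)).
apply: plot_local => // z Uz.
have [zt|zt] := ltP (lsubmx z 0 0) (2^-1 + smash_eps s / 2).
  exists (cyl U `&` (fun z => lsubmx z 0 0) @^-1` [set t | t < 2^-1 + smash_eps s / 2]).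
  exists (fun z => ev (s (2 * lsubmx z 0 0 + 0)) (P (rsubmx z))); split => //.
    have oW := oA _ (@open_lt _ (2^-1 + smash_eps s / 2)).
    apply: (plot_ev pP) => //.
    - apply: dsmooth_smooth => //; first exact: smash_smooth.
      by apply: smooth_affine => //; exact: smooth_time.
    - exact: smooth_rsubmx.
    - by move=> x [].
  move=> x [Ux xt]; rewrite /Kplot ev_concat_left ?addr0//; exact: PQ.
exists (cyl U `&` (fun z => lsubmx z 0 0) @^-1` [set t | 2^-1 - smash_eps s / 2 < t]).
exists (fun z => ev (s (2 * lsubmx z 0 0 + -1)) (Q (rsubmx z))); split => //.
- split => //=; lra.
- have oW := oA _ (@open_gt _ (2^-1 - smash_eps s / 2)).
  apply: (plot_ev pQ) => //.
  - apply: dsmooth_smooth => //; first exact: smash_smooth.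
    by apply: smooth_affine => //; exact: smooth_time.
  - exact: smooth_rsubmx.
  - by move=> x [].
- move=> x [Ux xt]; rewrite /Kplot ev_concat_right//; exact: PQ.
Qed.

Lemma plot_rev X n (U : set 'rV[R]_n) (P : 'rV[R]_n -> Paths X) :
  plot U P -> plot U (fun r => Defs.rev_path (P r)).
Proof.
move=> pP; have oU := plot_open pP; apply: plot_Paths => //.
have oc := open_cyl oU.
apply: (plot_ext (P := fun z => ev (-1 * lsubmx z 0 0 + 1) (P (rsubmx z)))).
  apply: (plot_ev pP) => //; last exact: smooth_rsubmx.
  by apply: smooth_affine => //; exact: smooth_time.
by move=> z _; rewrite /Kplot /rev_path /ev /= mulN1r addrC.
Qed.

Lemma plot_ev_at X n (U : set 'rV[R]_n) (P : 'rV[R]_n -> Paths X) t :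
  plot U P -> plot U (fun r => ev t (P r)).
Proof.
move=> pP; have oU := plot_open pP.
by apply: (plot_ev pP oU) => //; [exact: smooth_cst|exact: smooth_id].
Qed.

Lemma ev0_rev X (p : Paths X) : ev 0 (Defs.rev_path p) = ev 1 p.
Proof. by rewrite /ev /= subr0. Qed.

Lemma ev1_rev X (p : Paths X) : ev 1 (Defs.rev_path p) = ev 0 p.
Proof. by rewrite /ev /= subrr. Qed.

Lemma path_eq X (p q : Paths X) : (forall t, ev t p = ev t q) -> p = q.
Proof. by case: p q => [p hp] [q hq] pq; apply: eq_exist; apply/funext. Qed.

Lemma concat_cst X (x : X) : concat s (cst_path x) (cst_path x) = cst_path x.
Proof.
apply: path_eq => t; rewrite /concat; case: pselect => // h.
by rewrite /ev /= /concat_fun; case: ifP.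
Qed.

Lemma rev_cst X (x : X) : Defs.rev_path (cst_path x) = cst_path x.
Proof. exact: path_eq. Qed.

End ConcatPlots.

Section Density.
Context {R : realType} (X : diffSpace R).

Lemma dform_scale k (a : pre_dform k X) n (U : set 'rV[R]_n) P : is_dform a ->
  plot U P -> forall r, U r -> forall v i c u,
  a n U P r [eta v with i |-> c *: u] = c * a n U P r [eta v with i |-> u].
Proof.
move=> da pP r Ur v i c u.
have H := dform_linear da pP Ur v i.
have H0 : a n U P r [eta v with i |-> 0] = 0.
  by have := H 1 0 0; rewrite scaler0 addr0 mul1r => /eqP; rewrite -subr_eq0 opprD addrA subrr add0r oppr_eq0 => /eqP.
by have := H c u 0; rewrite addr0 H0 addr0.
Qed.

Definition dens k (a : pre_dform k.+1 X) n (U : set 'rV[R]_n) P r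
    (v : 'I_k -> 'rV[R]_n) (t : R) : R :=
  a (1 + n)%N (cyl U) (Kplot P) (tpoint t r) (Kvec v).

(** The map (t, r) -> (h t, r) pulls one plot back to the other; its differential multiplies (1, 0)
    by [h'] and fixes each (0, v), so [h'] comes out by linearity. The relation is local in time, on
    [N], because a concatenation is a reparametrization of one factor only on part of the line. *)
Lemma dens_reparam k (a : pre_dform k.+1 X) n (U : set 'rV[R]_n)
    (P Q : 'rV[R]_n -> Paths X) (N : set R) (h : R -> R) (t h' : R) :
  is_dform a -> plot U P -> plot U Q ->
  dsmooth (X := real_line R) (Y := real_line R) h ->
  open N -> N t -> is_derive t 1 h h' ->
  (forall t r, N t -> U r -> ev t (Q r) = ev (h t) (P r)) ->
  forall r, U r -> forall v, dens a U Q r v t = h' * dens a U P r v (h t).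
Proof.
move=> da pP pQ sh oN Nt dh QP r Ur v.
have oU := plot_open pP; have oc := open_cyl oU.
pose W := cyl U `&` (fun z : 'rV[R]_(1 + n) => lsubmx z 0 0) @^-1` N.
have oW : open W by exact: (open_preimage oc oN (@smooth_time R n _)).
pose F (z : 'rV[R]_(1 + n)) := tpoint (h (lsubmx z 0 0)) (rsubmx z).
have sF : smooth W F.
  apply: smooth_tpoint => //; last exact: smooth_rsubmx.
  by apply: dsmooth_smooth => //; exact: smooth_time.
have FW z : W z -> cyl U (F z) by move=> [Uz _]; rewrite /cyl /= rsub_tpoint.
have QF z : W z -> Kplot Q z = Kplot P (F z).
  by move=> [Uz Nz]; rewrite /Kplot QP// /F rsub_tpoint tpoint_time.
have Wtr : W (tpoint t r) by split; rewrite /cyl /= ?rsub_tpoint ?tpoint_time.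
have pW : plot W (Kplot Q).
  by apply: (plot_sub (plot_Kplot pQ)) => // z [].
rewrite /dens (dform_local da (plot_Kplot pQ) pW _ _ Wtr)//; last by case: Wtr.
rewrite (dform_compat da (plot_Kplot pP) oW sF FW QF Wtr).
rewrite {1}/F rsub_tpoint tpoint_time.
rewrite (_ : (fun i => _) = [eta Kvec v with ord0 |-> h' *: tpoint 1 0]).
  rewrite (dform_scale da (plot_Kplot pP)); last by rewrite /cyl /= rsub_tpoint.
  congr (_ * a _ _ _ _ _); apply/funext => j /=.
  by case: eqP => // ->; rewrite Kvec0.
apply/funext => j /=; rewrite /Kvec; case: unliftP => [i ->|->]; last first.
  rewrite eqxx; apply: derive_lineE.
  rewrite (_ : (fun u => _) = fun u : R => tpoint 0 r + h (1 * u + t) *: tpoint 1 0).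
    apply: is_derive_affine; rewrite -[h']mulr1.
    apply: (is_derive_comp (f := fun u : R => 1 * u + t)); first exact: is_derive_affine1.
    by rewrite mul1r add0r.
  apply/funext => u; rewrite /F -[row_mx (const_mx 1) 0]/(tpoint 1 0) -!tpointDl.
  by rewrite tpoint_time rsub_tpoint add0r mul1r addrC.
have /negbTE-> : lift ord0 i != ord0 by rewrite eq_sym neq_lift.
by apply: derive_affine => u; rewrite /F -tpointD !rsub_tpoint !tpoint_time tpointD.
Qed.

End Density.

Section Kop.
Context {R : realType} (s : smashing R) (X : diffSpace R).

Lemma dens_cont k (a : pre_dform k.+1 X) n (U : set 'rV[R]_n)
    (P : 'rV[R]_n -> Paths X) r v : is_dform a -> plot U P -> U r ->
  continuous (dens a U P r v).
Proof. by move=> da pP Ur; exact: cont_dens. Qed.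

(** The change of variable goes through a primitive [G] of the density: by [dens_reparam], G(1 - x)
    is a primitive of the reversed density. *)
Lemma Kop_rev k (a : pre_dform k.+1 X) n (U : set 'rV[R]_n)
    (P : 'rV[R]_n -> Paths X) r v : is_dform a -> plot U P -> U r ->
  Kop a U (fun r => Defs.rev_path (P r)) r v = - Kop a U P r v.
Proof.
move=> da pP Ur; have pQ := plot_rev pP.
have cP := dens_cont (v := v) da pP Ur; have cQ := dens_cont (v := v) da pQ Ur.
have [G dG] := antiderivative cP.
have h (t : R) : is_derive t 1 (fun u : R => -1 * u + 1) (-1) by exact: is_derive_affine1.
rewrite !KopE -/(dens a U P r v) -/(dens a U _ r v).
have -> : int01 (dens a U P r v) = G 1 - G 0.
  by apply: int01_ftc => // x /andP[x0 _]; exact: dG.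
suff -> : int01 (dens a U (fun r => Defs.rev_path (P r)) r v) =
    G (-1 * 1 + 1) - G (-1 * 0 + 1).
  by rewrite mulr1 mulr0 addNr add0r opprB.
apply: (int01_ftc (F := fun x => G (-1 * x + 1))) => // x /andP[x1 x2].
rewrite (dens_reparam (P := P) (N := setT) (h := fun u => -1 * u + 1) (h' := -1))//.
- rewrite mulrC; apply: (is_derive_comp (f := fun u => -1 * u + 1)) => //.
  apply: dG; lra.
- exact: affine_dsmooth.
- exact: openT.
- by move=> t r' _ _; rewrite /rev_path /ev /= mulN1r addrC.
Qed.

(** A single primitive serves on the whole interval, G(s(2x)) + H(s(2x - 1)): at every x the
    derivative of one term vanishes because [s] is flat, and the other term differentiates to the
    density of the concatenation. *)
Lemma Kop_concat k (a : pre_dform k.+1 X) n (U : set 'rV[R]_n)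
    (P Q : 'rV[R]_n -> Paths X) r v : is_dform a -> plot U P -> plot U Q ->
  (forall r, U r -> ev 1 (P r) = ev 0 (Q r)) -> U r ->
  Kop a U (fun r => concat s (P r) (Q r)) r v = Kop a U P r v + Kop a U Q r v.
Proof.
move=> da pP pQ PQ Ur; have pC := plot_concat s pP pQ PQ.
have e0 := smash_eps_gt0 s.
have cP := dens_cont (v := v) da pP Ur; have cQ := dens_cont (v := v) da pQ Ur.
have cC := dens_cont (v := v) da pC Ur.
have [G dG] := antiderivative cP; have [H dH] := antiderivative cQ.
have [s' cs' [ds' sl sr]] := smash_derive s.
have ds2 b (t : R) : is_derive t 1 (fun u : R => s (2 * u + b)) (s' (2 * t + b) * 2).
  by apply: (is_derive_comp (f := fun u : R => 2 * u + b)); first exact: is_derive_affine1.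
(* [G] and [H] have a known derivative only beyond -1. *)
have s01 t : -1 < s t by have /andP[+ _] := smash_range s t; lra.
rewrite !KopE -/(dens a U P r v) -/(dens a U Q r v) -/(dens a U _ r v).
have -> : int01 (dens a U P r v) = G 1 - G 0.
  by apply: int01_ftc => // x /andP[x0 _]; exact: dG.
have -> : int01 (dens a U Q r v) = H 1 - H 0.
  by apply: int01_ftc => // x /andP[x0 _]; exact: dH.
suff -> : int01 (dens a U (fun r => concat s (P r) (Q r)) r v) =
    G (s (2 * 1 + 0)) + H (s (2 * 1 + -1)) - (G (s (2 * 0 + 0)) + H (s (2 * 0 + -1))).
  rewrite (smash_right (t := 2 * 1 + 0)); last by lra.
  rewrite (smash_right (t := 2 * 1 + -1)); last by lra.
  rewrite (smash_left (t := 2 * 0 + 0)); last by lra.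
  rewrite (smash_left (t := 2 * 0 + -1)); last by lra.
  lra.
apply: (int01_ftc (F := fun x => G (s (2 * x + 0)) + H (s (2 * x + -1)))) => // x _.
have dsm b : dsmooth (X := real_line R) (Y := real_line R) (fun t => s (2 * t + b)).
  by move=> m V f pf; apply: (smash_smooth s (affine_dsmooth 2 b pf)).
have dP := is_derive_comp (ds2 0 x) (dG _ (s01 _)).
have dQ := is_derive_comp (ds2 (-1) x) (dH _ (s01 _)).
have dPQ := is_deriveD dP dQ.
apply: (is_derive_eq dPQ).
have [xt|xt] := ltP x (2^-1 + smash_eps s / 2).
  rewrite (dens_reparam (P := P) (Q := fun r => concat s (P r) (Q r))
    (N := [set t | t < 2^-1 + smash_eps s / 2]) da pP pC (dsm 0) _ _ (ds2 0 x))//; last first.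
    by move=> t r' Nt Ur'; rewrite addr0 ev_concat_left//; exact: PQ.
  rewrite (sl (2 * x + -1)); last by lra.
  by rewrite mul0r mulr0 addr0 mulrC.
rewrite (dens_reparam (P := Q) (Q := fun r => concat s (P r) (Q r))
  (N := [set t | 2^-1 - smash_eps s / 2 < t]) da pQ pC (dsm (-1)) _ _ (ds2 (-1) x))//; last 2 first.
- rewrite /=; lra.
- by move=> t r' Nt Ur'; rewrite ev_concat_right//; exact: PQ.
rewrite (sr (2 * x + 0)); last by lra.
by rewrite mul0r mulr0 add0r mulrC.
Qed.

Lemma dform2_line (a : pre_dform 2 X) (U : set 'rV[R]_1) P x v : is_dform a ->
  plot U P -> U x -> a 1%N U P x v = 0.
Proof.
move=> da pP Ux; pose e : 'rV[R]_1 := const_mx 1.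
have E (u : 'rV[R]_1) : u = u 0 0 *: e.
  by apply/rowP => i; rewrite !mxE ord1 mulr1.
have H u : a 1%N U P x [eta u with ord0 |-> e] = u (lift ord0 ord0) 0 0 * a 1%N U P x (fun=> e).
  rewrite [in LHS](_ : [eta u with _ |-> _] = [eta [eta u with ord0 |-> e] with
      lift ord0 ord0 |-> u (lift ord0 ord0) 0 0 *: e] :> (_ -> _)).
    rewrite (dform_scale da pP)//; congr (_ * a _ _ _ _ _).
    apply/funext => j /=; case: eqP => // /eqP jl.
    by case: (unliftP ord0 j) jl => [i ->|-> _]; rewrite ?eqxx// ord1 eqxx.
  apply/funext => j /=; case: (unliftP ord0 j) => [i ->|->]; last by rewrite eqxx.
  by rewrite ord1 eqxx -E.
have -> : v = [eta v with ord0 |-> v ord0 0 0 *: e] :> (_ -> _).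
  by apply/funext => j /=; case: eqP => [->|//]; rewrite -E.
rewrite (dform_scale da pP)// H.
rewrite (dform_alternating da pP Ux (i := ord0) (j := lift ord0 ord0))//.
by rewrite !mulr0.
Qed.

(** The surface swept by the family factors through the line on which [p] is defined, and a 2-form
    vanishes on a line. This handles both thin homotopies and constant families of paths. *)
Lemma Kop_thin (a : pre_dform 2 X) n (U : set 'rV[R]_n)
    (P : 'rV[R]_n -> Paths X) (p : Paths X) (h : 'rV[R]_(1 + n) -> R) r v :
  is_dform a -> plot U P -> smooth (cyl U) (h : _ -> R^o) ->
  (forall t r, U r -> ev t (P r) = ev (h (tpoint t r)) p) -> U r ->
  Kop a U P r v = 0.
Proof.
move=> da pP sh Ph Ur; have oc := open_cyl (plot_open pP).
rewrite KopE -[RHS](int01_cst 0); apply: eq_int01 => t _.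
rewrite (dform_compat da (plot_line p) oc (F := fun z => h z *: const_mx 1))//.
- exact: (dform2_line _ da (plot_line p)).
- by apply: smoothZ => //; exact: smooth_cst.
- by move=> z Uz; rewrite /Kplot Ph// tpoint_eta /line_plot !mxE mulr1.
- by rewrite /cyl /= rsub_tpoint.
Qed.

End Kop.

(** * Integrals of 1-forms along paths *)

Section PathIntegral.
Context {R : realType} (s : smashing R) (X : diffSpace R).
Variables (a : pre_dform 1 X) (da : is_dform a).

(** Integrating a 1-form is [Kop] landing in degree 0, evaluated on a constant plot; the rules for
    concatenation and reversal are then those of [Kop]. *)
Lemma path_integralE (p : Paths X) :
  path_integral a p = Kop a setT (fun _ : 'rV[R]_1 => p) 0 (fun=> 0).
Proof.
apply: eq_int01 => t _.
have oc : open (cyl (setT : set 'rV[R]_1)) by apply: open_cyl; exact: openT.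
rewrite (dform_compat da (plot_line p) oc (F := lsubmx))//; last exact: smooth_lsubmx.
congr (@a _ _ _ _ _).
- by rewrite row_mxKl.
apply/funext => j; rewrite ord1; apply/esym; case: unliftP => [[]//|_].
by apply: derive_affine => u; rewrite linearD linearZ/= row_mxKl.
Qed.

Lemma path_integral_concat (p q : Paths X) : ev 1 p = ev 0 q ->
  path_integral a (concat s p q) = path_integral a p + path_integral a q.
Proof.
move=> pq; rewrite !path_integralE.
rewrite (Kop_concat s (P := fun=> p) (Q := fun=> q))//; apply: plot_cst; exact: openT.
Qed.

Lemma path_integral_rev (p : Paths X) :
  path_integral a (Defs.rev_path p) = - path_integral a p.
Proof.
rewrite !path_integralE (@Kop_rev _ _ _ _ _ _ (fun=> p))//; apply: plot_cst; exact: openT.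
Qed.

End PathIntegral.

Section PullBack.
Context {R : realType}.
Implicit Types X Y : diffSpace R.

Lemma pullback_is_dform k X Y (f : X -> Y) (a : pre_dform k Y) :
  dsmooth f -> is_dform a -> is_dform (pullback f a).
Proof.
move=> sf da; split.
- by move=> n U P pP r Ur v i c u w; exact: (dform_linear da (sf _ _ _ pP)).
- by move=> n U P pP r Ur v i j; apply: (dform_alternating da) => //; exact: sf.
- by move=> n U P pP v; apply: (dform_smooth da); exact: sf.
- move=> n m U P V F Q pP oV sF FU QP r Vr v.
  by apply: (dform_compat da) => // [|x Vx /=]; [exact: sf|rewrite QP].
Qed.

Lemma dsmooth_incl X (A : set X) : dsmooth (sub_incl : sub_space A -> X).
Proof. by []. Qed.

Lemma generatedP (V : zmodType) (S : set V) x : S x -> x \in generated S.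
Proof. by move=> Sx; apply/asboolP => H _; apply. Qed.

End PullBack.

Section Joined.
Context {R : realType} (s : smashing R) (X : diffSpace R).

Lemma joined_refl (x : X) : joined x x.
Proof. by exists (cst_path x). Qed.

Lemma joined_sym (x y : X) : joined x y -> joined y x.
Proof. by move=> [p [p0 p1]]; exists (Defs.rev_path p); rewrite ev0_rev ev1_rev. Qed.

Lemma joined_trans (x y z : X) : joined x y -> joined y z -> joined x z.
Proof.
move=> [p [p0 p1]] [q [q0 q1]]; exists (concat s p q).
by rewrite ev0_concat ?p1 ?q0// ev1_concat ?p1 ?q0.
Qed.

End Joined.

(** * Components of the space of based loops *)

Section BasedLoops.
Context {R : realType} (s : smashing R) (X : diffSpace R) (x0 : X).
Implicit Types p q : based_loops x0.

Lemma component_eq p q : component p = component q <-> joined p q.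
Proof.
split=> [|pq].
  move=> /(congr1 (fun c : pi1 x0 => sval c q)) /= ->; exact: joined_refl.
apply: eq_exist; apply/funext => r; apply/propext; split => H.
  by apply: joined_trans H => //; apply: joined_sym.
exact: joined_trans pq H.
Qed.

Lemma componentK (i : pi1 x0) : component (quotient_rep i) = i.
Proof. exact: quotient_repK. Qed.

Lemma to_loop_val (p : Paths X) : ev 0 p = x0 -> ev 1 p = x0 ->
  sub_incl (to_loop x0 p) = p.
Proof. by move=> p0 p1; rewrite /to_loop; case: pselect => // -[]. Qed.

Lemma loop0 p : ev 0 (sub_incl p) = x0. Proof. by have [] := svalP p. Qed.
Lemma loop1 p : ev 1 (sub_incl p) = x0. Proof. by have [] := svalP p. Qed.

Lemma loop_eq p q : sub_incl p = sub_incl q -> p = q.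
Proof. by case: p q => [p hp] [q hq] /= pq; apply: eq_exist. Qed.

Lemma to_loopK p : to_loop x0 (sub_incl p) = p.
Proof. by apply: loop_eq; rewrite to_loop_val// ?loop0 ?loop1. Qed.

Lemma loop_concat p q : ev 1 (sub_incl p) = ev 0 (sub_incl q).
Proof. by rewrite loop0 loop1. Qed.

Definition lconcat p q : based_loops x0 :=
  to_loop x0 (concat s (sub_incl p) (sub_incl q)).

Lemma lconcat_val p q : sub_incl (lconcat p q) = concat s (sub_incl p) (sub_incl q).
Proof.
rewrite to_loop_val ?ev0_concat ?ev1_concat// ?loop0 ?loop1 //; exact: loop_concat.
Qed.

Definition lrev p : based_loops x0 := to_loop x0 (Defs.rev_path (sub_incl p)).

Lemma lrev_val p : sub_incl (lrev p) = Defs.rev_path (sub_incl p).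
Proof. by rewrite to_loop_val ?ev0_rev ?ev1_rev// ?loop0 ?loop1. Qed.

Lemma based_path (Q : 'rV[R]_1 -> Paths X) : plot setT Q ->
  (forall x, ev 0 (Q x) = x0 /\ ev 1 (Q x) = x0) ->
  exists a : Paths (based_loops x0), forall t, sub_incl (ev t a) = Q (const_mx t).
Proof.
move=> pQ Q0.
have [|a aE] := @mk_path R (based_loops x0) (fun x => to_loop x0 (Q x)).
  apply: (plot_ext (X := Paths X) pQ) => x _.
  by have [Q0x Q1x] := Q0 x; exact: to_loop_val.
by exists a => t; have [Q0x Q1x] := Q0 (const_mx t); rewrite aE to_loop_val.
Qed.

Lemma plot_based (a : Paths (based_loops x0)) :
  plot setT (fun x : 'rV[R]_1 => sub_incl (ev (x 0 0) a)).
Proof. exact: (plot_line a). Qed.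

Lemma joined_concat p p' q q' : joined p p' -> joined q q' ->
  exists a b c : Paths (based_loops x0),
  [/\ ev 0 a = p /\ ev 1 a = p', ev 0 b = q /\ ev 1 b = q',
      ev 0 c = lconcat p q, ev 1 c = lconcat p' q' &
      forall t, sub_incl (ev t c) = concat s (sub_incl (ev t a)) (sub_incl (ev t b))].
Proof.
move=> [a [a0 a1]] [b [b0 b1]].
have [||c cE] := @based_path (fun x => concat s (sub_incl (ev (x 0 0) a)) (sub_incl (ev (x 0 0) b))).
- apply: plot_concat => [||x _]; [exact: plot_based|exact: plot_based|exact: loop_concat].
- by move=> x; rewrite ev0_concat ?ev1_concat ?loop0 ?loop1//; exact: loop_concat.
have cE' t : sub_incl (ev t c) = concat s (sub_incl (ev t a)) (sub_incl (ev t b)).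
  by rewrite cE mxE.
exists a, b, c; split => //.
- by apply: loop_eq; rewrite cE' lconcat_val a0 b0.
- by apply: loop_eq; rewrite cE' lconcat_val a1 b1.
Qed.

Lemma pi1_mulE p q : pi1_mul s (component p) (component q) = component (lconcat p q).
Proof.
have jr (r : based_loops x0) : joined (quotient_rep (component r)) r.
  by apply/component_eq; rewrite componentK.
have [_ [_ [c [_ _ c0 c1 _]]]] := joined_concat (jr p) (jr q).
by apply/component_eq; exists c.
Qed.

Lemma comp_dsmooth (m : Paths X) (h : R -> R) :
  dsmooth (X := real_line R) (Y := real_line R) h ->
  dsmooth (X := real_line R) (fun t => ev (h t) m).
Proof. by move=> sh n U a pa; apply: (svalP m); exact: sh. Qed.

Definition path_comp (m : Paths X) (h : R -> R)
    (sh : dsmooth (X := real_line R) (Y := real_line R) h) : Paths X :=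
  exist _ _ (comp_dsmooth m sh).

(** The homotopy interpolates the parameters, f + x (g - f), inside the single path [m]; since f and
    g agree at 0 and 1, its ends stay at [x0]. The interpolation [h] is exported in the form that
    [Kop_thin] expects. *)
Lemma joined_reparam (p q : based_loops x0) (m : Paths X) (f g : R -> R) :
  dsmooth (X := real_line R) (Y := real_line R) f ->
  dsmooth (X := real_line R) (Y := real_line R) g ->
  f 0 = g 0 -> f 1 = g 1 ->
  (forall t, ev t (sub_incl p) = ev (f t) m) ->
  (forall t, ev t (sub_incl q) = ev (g t) m) ->
  exists a : Paths (based_loops x0), [/\ ev 0 a = p, ev 1 a = q &
    exists2 h : 'rV[R]_(1 + 1) -> R, smooth setT (h : _ -> R^o) &
      forall t (x : 'rV[R]_1), ev t (sub_incl (ev (x 0 0) a)) = ev (h (tpoint t x)) m].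
Proof.
move=> sf sg fg0 fg1 pf qg.
pose h (z : 'rV[R]_(1 + 1)) := f (lsubmx z 0 0) +
  rsubmx z 0 0 * (g (lsubmx z 0 0) + -1 * f (lsubmx z 0 0)).
have sh : smooth setT (h : _ -> R^o).
  have oT : open (setT : set 'rV[R]_(1 + 1)) by exact: openT.
  have st := @smooth_time R 1 setT.
  have sr : smooth setT ((fun z : 'rV[R]_(1 + 1) => rsubmx z 0 0) : _ -> R^o).
    rewrite (_ : (fun z : 'rV[R]_(1 + 1) => _) = fun z => z 0 (rshift 1 0)).
      exact: smooth_coord.
    by apply/funext => z; rewrite mxE.
  apply: smoothD => //; first exact: dsmooth_smooth.
  apply: smoothM => //; apply: smoothD => //; first exact: dsmooth_smooth.
  by apply: smoothM => //; [exact: smooth_cst|exact: dsmooth_smooth].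
have cs (r : R) : dsmooth (X := real_line R) (Y := real_line R) (fun t => h (tpoint t (const_mx r))).
  move=> n U a [oU sa]; split => //.
  apply: (smooth_comp (g := h : _ -> R^o) oU openT) => //.
  by apply: smooth_tpoint => //; exact: smooth_cst.
pose Q (x : 'rV[R]_1) : Paths X := path_comp m (cs (x 0 0)).
have QE t x : ev t (Q x) = ev (h (tpoint t x)) m.
  rewrite /ev /=; congr (sval m (h (tpoint t _))).
  by apply/rowP => i; rewrite mxE ord1.
have h0 x : h (tpoint 0 x) = f 0.
  by rewrite /h tpoint_time fg0 mulN1r subrr mulr0 addr0.
have h1 x : h (tpoint 1 x) = f 1.
  by rewrite /h tpoint_time fg1 mulN1r subrr mulr0 addr0.
have pQ : plot setT Q.
  apply: plot_Paths; first exact: openT.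
  apply: (plot_ext (P := fun z => ev (h z) m)); last by move=> z _; rewrite /Kplot QE tpoint_eta.
  apply: (plot_ev (U := setT) (P := fun _ : 'rV[R]_1 => m) (b := rsubmx)) => //.
  - exact: plot_cst openT.
  - exact: open_cyl openT.
  - exact: smooth_rsubmx.
have [|a aE] := based_path pQ.
  by move=> x; rewrite !QE h0 h1 -!pf loop0 loop1.
exists a; split.
- apply: loop_eq; apply: path_eq => t; rewrite aE QE /h tpoint_time rsub_tpoint.
  by rewrite mxE mul0r addr0 pf.
- apply: loop_eq; apply: path_eq => t; rewrite aE QE /h tpoint_time rsub_tpoint.
  by rewrite mxE mul1r mulN1r addrCA subrr addr0 qg.
- exists h => // t x; rewrite aE QE; congr (ev (h (tpoint t _)) m).
  by apply/rowP => i; rewrite mxE ord1.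
Qed.

End BasedLoops.

(** * The homomorphism psi *)

Section Psi.
Context {R : realType} (s : smashing R) (X : diffSpace R).
Variables (w : dform 2 X) (x0 : X) (l : loop_basis x0).
Implicit Types (p q : based_loops x0) (a b : Paths (based_loops x0)).

Let Kw : pre_dform 1 (Paths X) := Kop w.

Lemma Kw_dform : is_dform Kw.
Proof. exact: Kop_is_dform (dformP w). Qed.

Definition Kint a : R := path_integral (pullback sub_incl Kw) a.

Lemma Kint_dform (A : set (Paths X)) :
  is_dform (pullback (sub_incl : sub_space A -> _) Kw).
Proof. exact: pullback_is_dform (dsmooth_incl (A := A)) Kw_dform. Qed.

Lemma Kint_concat a b : ev 1 a = ev 0 b -> Kint (concat s a b) = Kint a + Kint b.
Proof. by move=> ab; apply: path_integral_concat => //; exact: Kint_dform. Qed.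

Lemma Kint_rev a : Kint (Defs.rev_path a) = - Kint a.
Proof. by apply: path_integral_rev; exact: Kint_dform. Qed.

Definition Kdens a (t : R) : R :=
  Kw setT (fun x : 'rV[R]_1 => sub_incl (ev (x 0 0) a)) (const_mx t) (fun=> const_mx 1).

Lemma KintE a : Kint a = int01 (Kdens a).
Proof. by []. Qed.

Lemma Kdens_cont a : continuous (Kdens a).
Proof.
have sK := dform_smooth Kw_dform (plot_based a) (fun=> const_mx 1) 0%N.
move=> t; apply: (@continuous_comp _ _ _ (fun t : R => (const_mx t : 'rV[R]_1))
   (fun r => Kw setT (fun x : 'rV[R]_1 => sub_incl (ev (x 0 0) a)) r (fun=> const_mx 1))).
  rewrite (_ : (fun t : R => _) = fun t : R => t *: const_mx 1); last first.
    by apply/funext => u; apply/rowP => i; rewrite !mxE mulr1.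
  by apply: cvgZ; [exact: cvg_id|exact: cvg_cst].
exact: (sK _ I).
Qed.

(** Going along [a] and back along [b] is a closed path in [Loops X], whose integral is one of the
    generators. *)
Lemma P_torP a b : ev 0 a = ev 0 b -> ev 1 a = ev 1 b -> Kint a - Kint b \in P_tor w.
Proof.
move=> ab0 ab1.
pose c := concat s a (Defs.rev_path b).
have abr : ev 1 a = ev 0 (Defs.rev_path b) by rewrite ev0_rev.
have [|c' c'E] := @mk_path R (Loops X) (fun x => exist
   (fun p : Paths X => ev 0 p = ev 1 p) (sub_incl (ev (x 0 0) c))
   (etrans (loop0 _) (esym (loop1 _)))).
  exact: plot_based c.
apply: generatedP; exists c'; split.
  rewrite !c'E; apply: eq_exist; rewrite /= !mxE ev0_concat// ev1_concat//.
  by rewrite ev1_rev ab0.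
rewrite -Kint_rev -Kint_concat// -/c KintE; apply: eq_int01 => t _.
rewrite /pullback /Kdens; congr (Kw _ _ _); apply/funext => x /=.
by rewrite c'E /= mxE.
Qed.

Lemma integral_betweenP p q a : ev 0 a = p -> ev 1 a = q ->
  integral_between w p q - Kint a \in P_tor w.
Proof.
move=> ap aq.
rewrite /integral_between; set A := [set c | _].
(* The path [a] shows that the set is inhabited, so the default 0 of [xget] is not taken and the
   value is the integral along some path [b]. *)
have /(xgetPex 0) [b [b0 b1 ->]] : exists c, A c by exists (Kint a), a.
by apply: P_torP; rewrite ?ap ?aq.
Qed.

Lemma pi_tor_eq0 c : (pi_tor w c == 0) = (c \in P_tor w).
Proof.
rewrite -[c in RHS]subr0 Quotient.idealrBE.
by rewrite -[X in _ = (_ == X)]/(pi_tor w 0) /pi_tor raddf0.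
Qed.

Lemma pi_omega_eq0 c : (pi_omega s w l c == 0) = (c \in P_omega s w l).
Proof.
rewrite -[c in RHS]subr0 Quotient.idealrBE.
by rewrite -[X in _ = (_ == X)]/(pi_omega s w l 0) /pi_omega raddf0.
Qed.

Lemma pi_omegaB c d : pi_omega s w l (c - d) = pi_omega s w l c - pi_omega s w l d.
Proof. exact: raddfB. Qed.

Lemma pi_omegaD c d : pi_omega s w l (c + d) = pi_omega s w l c + pi_omega s w l d.
Proof. exact: raddfD. Qed.

Lemma pi_omega0 : pi_omega s w l 0 = 0.
Proof. exact: raddf0. Qed.

Lemma P_tor_omega c : c \in P_tor w -> c \in P_omega s w l.
Proof. by rewrite -pi_tor_eq0 /in_mem /= /P_omega => /eqP ->; exact: rpred0. Qed.

Lemma pi_omega_tor c d : c - d \in P_tor w -> pi_omega s w l c = pi_omega s w l d.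
Proof.
by move=> /P_tor_omega; rewrite -pi_omega_eq0 pi_omegaB subr_eq0 => /eqP.
Qed.

Lemma basis_joined p : joined (l (component p)) p.
Proof. by apply/(component_eq s); exact: basis_loopP. Qed.

Lemma psi_basis p a : ev 0 a = l (component p) -> ev 1 a = p ->
  psi s w l p = pi_omega s w l (Kint a).
Proof. by move=> a0 a1; apply: pi_omega_tor; exact: integral_betweenP. Qed.

(** The ends of [a] lie in one component and share their basis loop: a path from this loop to the
    start of [a], prolonged by [a], computes [psi] at the end. *)
Lemma psi_path a : psi s w l (ev 1 a) = psi s w l (ev 0 a) + pi_omega s w l (Kint a).
Proof.
have [b [b0 b1]] := basis_joined (ev 0 a).
rewrite (psi_basis b0 b1) -pi_omegaD -Kint_concat//; apply: psi_basis.
  rewrite ev0_concat// b0; congr (l _); apply/(component_eq s).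
  by exists a.
by rewrite ev1_concat.
Qed.

Lemma psi_cst : psi s w l (cst_loop x0) = 0.
Proof.
rewrite (psi_basis (a := cst_path (cst_loop x0))) //; last by rewrite basis_loop1.
suff -> : Kint (cst_path (cst_loop x0)) = 0 by exact: pi_omega0.
(* The constant path is its own reverse, so its integral is its own opposite. *)
by have := Kint_rev (cst_path (cst_loop x0)); rewrite rev_cst; lra.
Qed.

Lemma dsmooth_idR : dsmooth (X := real_line R) (Y := real_line R) id.
Proof. by []. Qed.

Lemma dsmooth_cstR c : dsmooth (X := real_line R) (Y := real_line R) (fun=> c).
Proof. by move=> n U a [oU _]; split => //; exact: smooth_cst. Qed.

Definition id_path : Paths (real_line R) := exist _ id dsmooth_idR.

Lemma concatE (Y : diffSpace R) (p q : Paths Y) t : ev 1 p = ev 0 q ->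
  ev t (concat s p q) = concat_fun s p q t.
Proof. by move=> pq; rewrite /concat; case: pselect. Qed.

(** The reparametrization is itself a concatenation of paths in the real line, the identity followed
    by the constant 1, so its smoothness and end values come with it. The next lemma uses the path
    from 1 to 0 and back in the same way. *)
Lemma concat_right_reparam p : exists2 f : R -> R,
  dsmooth (X := real_line R) (Y := real_line R) f &
  [/\ f 0 = 0, f 1 = 1 & forall t,
    ev t (sub_incl (lconcat s p (cst_loop x0))) = ev (f t) (sub_incl p)].
Proof.
pose c := concat s id_path (cst_path (1 : real_line R)).
have i1 : ev 1 id_path = ev 0 (cst_path (1 : real_line R)) by [].
exists (sval c); first exact: (svalP c).
split => [||t]; first by rewrite -[sval c 0]/(ev 0 c) ev0_concat.
  by rewrite -[sval c 1]/(ev 1 c) ev1_concat.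
rewrite lconcat_val -[sval c t]/(ev t c) !concatE//; last exact: loop_concat.
by rewrite /concat_fun; case: ifP; rewrite // /ev /= -[sval _ 1]/(ev 1 (sub_incl p)) loop1.
Qed.

Lemma concat_rev_reparam p : exists2 f : R -> R,
  dsmooth (X := real_line R) (Y := real_line R) f &
  [/\ f 0 = 1, f 1 = 1 & forall t,
    ev t (sub_incl (lconcat s (lrev p) p)) = ev (f t) (sub_incl p)].
Proof.
pose c := concat s (Defs.rev_path id_path) id_path.
have i1 : ev 1 (Defs.rev_path id_path) = ev 0 id_path by rewrite ev1_rev.
exists (sval c); first exact: (svalP c).
split => [||t]; first by rewrite -[sval c 0]/(ev 0 c) ev0_concat// ev0_rev.
  by rewrite -[sval c 1]/(ev 1 c) ev1_concat.
rewrite lconcat_val -[sval c t]/(ev t c) !concatE//; last exact: loop_concat.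
by rewrite /concat_fun lrev_val; case: ifP.
Qed.

Lemma Kint_thin a (m : Paths X) (h : 'rV[R]_(1 + 1) -> R) :
  smooth setT (h : _ -> R^o) ->
  (forall t (x : 'rV[R]_1), ev t (sub_incl (ev (x 0 0) a)) = ev (h (tpoint t x)) m) ->
  Kint a = 0.
Proof.
move=> sh ah; rewrite KintE -[RHS](int01_cst 0); apply: eq_int01 => t _.
apply: (Kop_thin (p := m) (h := h)) => //; [exact: dformP|exact: plot_based].
Qed.

Lemma lconcat1_joined p : exists a,
  [/\ ev 0 a = p, ev 1 a = lconcat s p (cst_loop x0) & Kint a = 0].
Proof.
have [f sf [f0 f1 pf]] := concat_right_reparam p.
have [||//|a [a0 a1 [h sh ah]]] := joined_reparam (p := p) dsmooth_idR sf _ _ _ pf.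
- by rewrite f0.
- by rewrite f1.
by exists a; split => //; exact: Kint_thin sh ah.
Qed.

Lemma pi1_mul1 (i : pi1 x0) : pi1_mul s i (pi1_one x0) = i.
Proof.
rewrite -(componentK i) pi1_mulE; apply/(component_eq s)/joined_sym.
by have [a [a0 a1 _]] := lconcat1_joined (quotient_rep i); exists a.
Qed.

Lemma pi1_invE p : pi1_inv (component p) = component (lrev p).
Proof.
apply/(component_eq s).
have [a [a0 a1]] : joined (quotient_rep (component p)) p.
  by apply/(component_eq s); rewrite componentK.
have [||b bE] := @based_path R X x0 (fun x => Defs.rev_path (sub_incl (ev (x 0 0) a))).
- exact: plot_rev (plot_based a).
- by move=> x; rewrite ev0_rev ev1_rev loop0 loop1.
exists b; split; apply: loop_eq; rewrite bE mxE ?a0 ?a1.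
- by rewrite to_loop_val// ?ev0_rev ?ev1_rev ?loop0 ?loop1.
- by rewrite lrev_val.
Qed.

Lemma pi1_mulV (i : pi1 x0) : pi1_mul s (pi1_inv i) i = pi1_one x0.
Proof.
rewrite -(componentK i) pi1_invE pi1_mulE; apply/(component_eq s).
have [f sf [f0 f1 pf]] := concat_rev_reparam (quotient_rep i).
have [//|//||a [a0 a1 _]] := joined_reparam (q := cst_loop x0) sf (dsmooth_cstR 1) _ _ pf.
  by move=> t; rewrite loop1.
by exists a.
Qed.

Lemma tau1 (i : pi1 x0) : tau s w l i (pi1_one x0) = 0.
Proof.
apply/eqP; rewrite pi_tor_eq0 pi1_mul1 basis_loop1.
have [a [a0 a1 aK]] := lconcat1_joined (l i).
by rewrite -[X in X \in _]subr0 -[X in _ - X]aK; exact: integral_betweenP.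
Qed.

(** Without inverse letters there is nothing to cancel. Such words suffice for [tau_H], which spells
    the inverse of a class [d] by the generator [pi1_inv d] and not by the formal inverse of the
    letter [d]. *)
Lemma reduced_pos (v : seq (pi1 x0)) : reduced [seq (i, false) | i <- v].
Proof.
move=> u v' i b E.
have : all (fun c => ~~ c.2) [seq (i, false) | i <- v] by elim: (v).
by rewrite E all_cat /= => /and4P[_ /negbTE -> ].
Qed.

Definition pos_word (v : seq (pi1 x0)) : free_group (pi1 x0) :=
  exist _ _ (@reduced_pos v).

(** Once simplified by [pi1_mul1] and [tau1], the second component is tau(i, j) on the word i, j and
    tau(i, j * k) + tau(j, k) on the word i, j, k; these are the only two lengths required. *)
Lemma relation_H v : foldr (@pi1_mul _ s _ x0) (pi1_one x0) v = pi1_one x0 ->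
  (foldr (fun i => @Gamma_mul _ s _ w _ l (i, 0)) (Gamma_one w x0) v).2 \in H_surf s l.
Proof.
move=> v1; apply: generatedP; exists (pos_word v).
  by rewrite /relations /= /free_lift /= foldr_map /=.
by rewrite /Psi /free_lift /= foldr_map /=.
Qed.

(* The relators [d^-1, d] and [d^-1, i, j] with d = i * j. *)
Lemma tau_H (i j : pi1 x0) : tau s w l i j \in H_surf s l.
Proof.
pose d := pi1_mul s i j; pose d' := pi1_inv d.
have H1 : tau s w l d' d \in H_surf s l.
  have := @relation_H [:: d'; d]; rewrite /= pi1_mul1 pi1_mulV => /(_ erefl).
  by rewrite tau1 !addr0 add0r.
have := @relation_H [:: d'; i; j]; rewrite /= pi1_mul1 pi1_mulV => /(_ erefl).
by rewrite tau1 !addr0 !add0r -/d rpredDr.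
Qed.

Lemma psi_basis_concat (i j : pi1 x0) : psi s w l (lconcat s (l i) (l j)) = 0.
Proof.
apply/eqP; rewrite /psi pi_omega_eq0 -pi1_mulE !basis_loopP.
exact: tau_H.
Qed.

Lemma psi_concat p q : psi s w l (lconcat s p q) = psi s w l p + psi s w l q.
Proof.
have [a [b [c [[a0 a1] [b0 b1] c0 c1 cE]]]] :=
  joined_concat s (basis_joined p) (basis_joined q).
rewrite -c1 psi_path c0 psi_basis_concat add0r (psi_basis a0 a1) (psi_basis b0 b1).
rewrite -pi_omegaD; congr (pi_omega _ _ _ _).
rewrite !KintE -int01D; [|exact: Kdens_cont|exact: Kdens_cont].
apply: eq_int01 => t _; rewrite /Kdens.
rewrite -(Kop_concat s _ (dformP w))//; [|exact: plot_based|exact: plot_based|].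
  by congr (Kw _ _ _); apply/funext => x; exact: cE.
by move=> x _; exact: loop_concat.
Qed.

End Psi.

(** * Holonomy *)

(** Endpoint bookkeeping for nested concatenations: each rewriting raises a composability condition
    of the same kind, which the recursion settles. *)
Ltac ends := first [ by [] | congruence
  | (rewrite ev0_rev; ends) | (rewrite ev1_rev; ends)
  | (rewrite ev0_concat; ends) | (rewrite ev1_concat; ends) ].

Section Holonomy.
Context {R : realType} (s : smashing R) (X : diffSpace R).
Variables (w : dform 2 X) (x0 : X) (l : loop_basis x0).

Let Kw : pre_dform 1 (Paths X) := Kop w.
Let psiP (m : Paths X) := psi s w l (to_loop x0 m).

Lemma psi_var (Q : 'rV[R]_1 -> Paths X) : plot setT Q ->
  (forall x, ev 0 (Q x) = x0 /\ ev 1 (Q x) = x0) ->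
  psiP (Q (const_mx 1)) = psiP (Q (const_mx 0)) +
    pi_omega s w l (int01 (fun t => Kw setT Q (const_mx t) (fun=> const_mx 1))).
Proof.
move=> pQ Q0; have [a aE] := based_path pQ Q0.
have aQ t : ev t a = to_loop x0 (Q (const_mx t)) by rewrite -aE to_loopK.
rewrite /psiP -!aQ psi_path; congr (_ + pi_omega _ _ _ _).
rewrite KintE; apply: eq_int01 => t _; congr (Kop w _ _ _); apply/funext => x.
by rewrite aE; congr Q; apply/rowP => i; rewrite mxE ord1.
Qed.

(** The working form of homotopy invariance: in a based word whose [Kw] contributions cancel, the
    letters may be deformed freely. *)
Lemma psi_const (Q : 'rV[R]_1 -> Paths X) : plot setT Q ->
  (forall x, ev 0 (Q x) = x0 /\ ev 1 (Q x) = x0) ->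
  (forall x v, Kw setT Q x v = 0) -> psiP (Q (const_mx 1)) = psiP (Q (const_mx 0)).
Proof.
move=> pQ Q0 K0; rewrite psi_var//; under eq_int01 do rewrite K0.
by rewrite int01_cst pi_omega0 addr0.
Qed.

Lemma psiP_cst : psiP (cst_path x0) = 0.
Proof. by rewrite -(psi_cst s w l) /psiP; congr psi; exact: (to_loopK (cst_loop x0)). Qed.

Lemma psiP_concat (p q : Paths X) : ev 0 p = x0 -> ev 1 p = x0 ->
  ev 0 q = x0 -> ev 1 q = x0 -> psiP (concat s p q) = psiP p + psiP q.
Proof.
move=> p0 p1 q0 q1; rewrite /psiP -psi_concat; congr psi.
by apply: loop_eq; rewrite lconcat_val !to_loop_val//; ends.
Qed.

(** The reverse of [p] followed by [p] only retraces [p], so a thin homotopy joins it to the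
    constant loop and additivity gives the sign. *)
Lemma psiP_rev (p : Paths X) : ev 0 p = x0 -> ev 1 p = x0 ->
  psiP (Defs.rev_path p) = - psiP p.
Proof.
move=> p0 p1; apply/eqP; rewrite -addr_eq0 -psiP_concat; try ends.
have [f sf [f0 f1 pf]] := concat_rev_reparam s (to_loop x0 p).
have [//|//||a [a0 a1 [h sh ah]]] :=
   joined_reparam (q := cst_loop x0) sf (dsmooth_cstR 1) _ _ pf.
  by move=> t; rewrite loop1.
rewrite -(psi_cst s w l) -a1 psi_path (Kint_thin w sh ah) pi_omega0 addr0 a0.
rewrite /psiP; apply/eqP; congr psi; apply: loop_eq.
by rewrite lconcat_val lrev_val !to_loop_val//; ends.
Qed.

Definition shrink (m : Paths X) (x : 'rV[R]_1) : Paths X :=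
  path_comp m (affine_dsmooth (x 0 0) 0).

Lemma ev_shrink m x t : ev t (shrink m x) = ev (x 0 0 * t) m.
Proof. by rewrite -[x 0 0 * t]addr0. Qed.

Lemma ev0_shrink m x : ev 0 (shrink m x) = ev 0 m.
Proof. by rewrite ev_shrink mulr0. Qed.

Lemma ev1_shrink m x : ev 1 (shrink m x) = ev (x 0 0) m.
Proof. by rewrite ev_shrink mulr1. Qed.

Lemma shrink0 m : shrink m (const_mx 0) = cst_path (ev 0 m).
Proof. by apply: path_eq => t; rewrite ev_shrink mxE mul0r. Qed.

Lemma shrink1 m : shrink m (const_mx 1) = m.
Proof. by apply: path_eq => t; rewrite ev_shrink mxE mul1r. Qed.

Lemma plot_shrink m : plot setT (shrink m).
Proof.
apply: plot_Paths; first exact: openT.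
apply: (plot_ext (P := fun z : 'rV[R]_(1 + 1) => ev (rsubmx z 0 0 * lsubmx z 0 0) m)).
  apply: (plot_ev (U := setT) (P := fun _ : 'rV[R]_1 => m) (b := rsubmx)) => //.
  - exact: plot_cst openT.
  - exact: open_cyl openT.
  - have oT : open (cyl (setT : set 'rV[R]_1)) by exact: open_cyl openT.
    apply: smoothM => //; last exact: smooth_time.
    rewrite (_ : (fun z : 'rV[R]_(1 + 1) => _) = fun z => z 0 (rshift 1 0)).
      exact: smooth_coord.
    by apply/funext => z; rewrite mxE.
  - exact: smooth_rsubmx.
by move=> z _; rewrite /Kplot ev_shrink.
Qed.

(** Companion of [shrink]: while [shrink m] moves its end along [m], the letters that start there
    are constant paths at the moving point, which keeps the word composable. *)
Lemma plot_cst_ev m : plot setT (fun x : 'rV[R]_1 => cst_path (ev (x 0 0) m) : Paths X).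
Proof.
apply: plot_Paths; first exact: openT.
apply: (plot_ext (P := fun z : 'rV[R]_(1 + 1) => line_plot m (rsubmx z))) => //.
apply: (plot_comp (plot_line m) (F := rsubmx)) => //; last exact: smooth_rsubmx.
exact: open_cyl openT.
Qed.

Lemma plot_fixed (m : Paths X) : plot setT (fun _ : 'rV[R]_1 => m).
Proof. exact: plot_cst openT. Qed.

Definition chain (d g e h f : Paths X) :=
  [/\ ev 1 d = ev 0 g, ev 1 g = ev 0 e, ev 1 g = ev 0 h & ev 1 h = ev 0 f].

(* If A and B denote (d g) e ((rev e) h) f and (d (g h)) f, this is A followed
   by rev B: psi sends it to the defect of additivity of the holonomy. *)
Definition word (d g e h f : Paths X) : Paths X :=
  concat s (concat s (concat s (concat s d g) e)
                     (concat s (concat s (Defs.rev_path e) h) f))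
           (Defs.rev_path (concat s (concat s d (concat s g h)) f)).

(** Each of d, g, e, h, f occurs in the word once with each orientation, so the [Kw] terms cancel in
    pairs. *)
Lemma word_const (d g e h f : 'rV[R]_1 -> Paths X) :
  plot setT d -> plot setT g -> plot setT e -> plot setT h -> plot setT f ->
  (forall x, chain (d x) (g x) (e x) (h x) (f x)) -> (forall x, ev 0 (d x) = x0) ->
  psiP (word (d (const_mx 1)) (g (const_mx 1)) (e (const_mx 1)) (h (const_mx 1)) (f (const_mx 1))) =
  psiP (word (d (const_mx 0)) (g (const_mx 0)) (e (const_mx 0)) (h (const_mx 0)) (f (const_mx 0))).
Proof.
move=> pd pg pe ph pf ch d0.
have dw := dformP w.
have p1 : plot setT (fun x => concat s (d x) (g x)).
  by apply: plot_concat => // x _; case: (ch x).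
have p2 : plot setT (fun x => concat s (concat s (d x) (g x)) (e x)).
  by apply: plot_concat => // x _; case: (ch x) => *; ends.
have pre := plot_rev pe.
have p3 : plot setT (fun x => concat s (Defs.rev_path (e x)) (h x)).
  by apply: plot_concat => // x _; case: (ch x) => *; ends.
have p4 : plot setT (fun x => concat s (concat s (Defs.rev_path (e x)) (h x)) (f x)).
  by apply: plot_concat => // x _; case: (ch x) => *; ends.
have p5 : plot setT (fun x => concat s (g x) (h x)).
  by apply: plot_concat => // x _; case: (ch x) => *; ends.
have p6 : plot setT (fun x => concat s (d x) (concat s (g x) (h x))).
  by apply: plot_concat => // x _; case: (ch x) => *; ends.
have p7 : plot setT (fun x => concat s (concat s (d x) (concat s (g x) (h x))) (f x)).
  by apply: plot_concat => // x _; case: (ch x) => *; ends.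
have p8 : plot setT (fun x => concat s (concat s (concat s (d x) (g x)) (e x))
                     (concat s (concat s (Defs.rev_path (e x)) (h x)) (f x))).
  by apply: plot_concat => // x _; case: (ch x) => *; ends.
have p7r := plot_rev p7.
apply: (psi_const (Q := fun x => word (d x) (g x) (e x) (h x) (f x))).
- by apply: plot_concat => // x _; case: (ch x) => *; ends.
- by move=> x; have dx := d0 x; case: (ch x) => *; split; rewrite /word; ends.
move=> x v; rewrite /Kw /word.
rewrite (Kop_concat s v dw p8 p7r)//; last by move=> y _; case: (ch y) => *; ends.
rewrite (Kop_concat s v dw p2 p4)//; last by move=> y _; case: (ch y) => *; ends.
rewrite (Kop_concat s v dw p1 pe)//; last by move=> y _; case: (ch y) => *; ends.
rewrite (Kop_concat s v dw pd pg)//; last by move=> y _; case: (ch y) => *; ends.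
rewrite (Kop_concat s v dw p3 pf)//; last by move=> y _; case: (ch y) => *; ends.
rewrite (Kop_concat s v dw pre ph)//; last by move=> y _; case: (ch y) => *; ends.
rewrite (Kop_rev v dw pe)// (Kop_rev v dw p7)//.
rewrite (Kop_concat s v dw p6 pf)//; last by move=> y _; case: (ch y) => *; ends.
rewrite (Kop_concat s v dw pd p5)//; last by move=> y _; case: (ch y) => *; ends.
rewrite (Kop_concat s v dw pg ph)//; last by move=> y _; case: (ch y) => *; ends.
lra.
Qed.

(** The letters are contracted in the order f, e, h, g, d. Shrinking a letter moves its end, so the
    letters of the chain that start there must already be constant; [e] can go early because only
    its own reverse starts at its end. *)
Lemma psi_word d g e h f : chain d g e h f -> ev 0 d = x0 -> psiP (word d g e h f) = 0.
Proof.
move=> [dg ge gh hf] d0.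
have fx := plot_fixed; have sh := plot_shrink; have ce := plot_cst_ev.
have ev_cst (x : X) t : ev t (cst_path x) = x by [].
have := word_const (fx d) (fx g) (fx e) (fx h) (sh f).
rewrite shrink1 shrink0 => ->//; last by move=> x; split; rewrite ?ev0_shrink.
have := word_const (fx d) (fx g) (sh e) (fx h) (fx (cst_path (ev 0 f))).
rewrite shrink1 shrink0 => ->//; last by move=> x; split; rewrite ?ev0_shrink.
have := word_const (fx d) (fx g) (fx (cst_path (ev 0 e))) (sh h) (ce h).
rewrite shrink1 shrink0 !mxE hf => ->//; last by move=> x; split; rewrite ?ev0_shrink ?ev1_shrink.
have := word_const (fx d) (sh g) (ce g) (ce g) (ce g).
rewrite shrink1 shrink0 !mxE ge -gh ge => ->//; last by move=> x; split; rewrite ?ev0_shrink ?ev1_shrink.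
have := word_const (sh d) (ce d) (ce d) (ce d) (ce d).
rewrite shrink1 shrink0 !mxE dg => ->//; last 2 first.
- by move=> x; split; rewrite ?ev0_shrink ?ev1_shrink.
- by move=> x; rewrite ev0_shrink.
by rewrite /word !rev_cst !concat_cst rev_cst concat_cst d0 psiP_cst.
Qed.

Lemma psi_backtrack d g : ev 1 d = ev 0 g -> ev 0 d = x0 ->
  psiP (concat s (concat s d (concat s g (Defs.rev_path g))) (Defs.rev_path d)) = 0.
Proof.
have dw := dformP w.
pose W (d g : Paths X) := concat s (concat s d (concat s g (Defs.rev_path g))) (Defs.rev_path d).
rewrite -/(W d g).
have WE (d' g' : 'rV[R]_1 -> Paths X) : plot setT d' -> plot setT g' ->
    (forall x, ev 1 (d' x) = ev 0 (g' x)) -> (forall x, ev 0 (d' x) = x0) ->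
    psiP (W (d' (const_mx 1)) (g' (const_mx 1))) = psiP (W (d' (const_mx 0)) (g' (const_mx 0))).
  move=> pd pg dg d0; have prg := plot_rev pg; have prd := plot_rev pd.
  have p1 : plot setT (fun x => concat s (g' x) (Defs.rev_path (g' x))).
    by apply: plot_concat => // x _; ends.
  have p2 : plot setT (fun x => concat s (d' x) (concat s (g' x) (Defs.rev_path (g' x)))).
    by apply: plot_concat => // x _; have := dg x; have := d0 x => *; ends.
  apply: (psi_const (Q := fun x => W (d' x) (g' x))).
  - by apply: plot_concat => // x _; have := dg x; have := d0 x => *; ends.
  - by move=> x; have := dg x; have := d0 x; rewrite /W => *; split; ends.
  move=> x v; rewrite /Kw /W.
  rewrite (Kop_concat s v dw p2 prd)//; last by move=> y _; have := dg y; have := d0 y => *; ends.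
  rewrite (Kop_concat s v dw pd p1)//; last by move=> y _; have := dg y; have := d0 y => *; ends.
  rewrite (Kop_concat s v dw pg prg)//; last by move=> y _; ends.
  rewrite (Kop_rev v dw pg)// (Kop_rev v dw pd)//; lra.
move=> dg d0.
have := WE (fun=> d) (shrink g) (plot_fixed d) (plot_shrink g).
rewrite shrink1 shrink0 => ->//; last by move=> x; rewrite ev0_shrink.
have := WE (shrink d) (fun x => cst_path (ev (x 0 0) d)) (plot_shrink d) (plot_cst_ev d).
rewrite shrink1 shrink0 !mxE -dg => ->; last 2 first.
- by move=> x; rewrite ev1_shrink.
- by move=> x; rewrite ev0_shrink.
by rewrite /W !rev_cst !concat_cst d0 psiP_cst.
Qed.

Lemma rev_revK (p : Paths X) : Defs.rev_path (Defs.rev_path p) = p.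
Proof. by apply: path_eq => t; rewrite /ev /= opprB addrC subrK. Qed.

Definition hol (d e g : Paths X) : T_omega s w l :=
  psiP (concat s (concat s d g) (Defs.rev_path e)).

(** This is [psi_word] with the reverses of [e] and [f] as letters: the word becomes the loop of g,
    then the loop of h, then the reversed loop of their concatenation. *)
Lemma hol_concat d e f g h : ev 0 d = x0 -> ev 0 e = x0 -> ev 0 f = x0 ->
  ev 1 d = ev 0 g -> ev 1 g = ev 1 e -> ev 1 e = ev 0 h -> ev 1 h = ev 1 f ->
  hol d f (concat s g h) = hol d e g + hol e f h.
Proof.
move=> d0 e0 f0 dg ge eh hf; rewrite /hol.
rewrite -psiP_concat; try ends.
have := @psi_word d g (Defs.rev_path e) h (Defs.rev_path f).
rewrite /word rev_revK psiP_concat; try ends.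
rewrite psiP_rev; try ends.
move=> H; apply/esym/eqP; rewrite -subr_eq0; apply/eqP; apply: H => //.
by split; ends.
Qed.

Lemma hol_cst d : ev 0 d = x0 -> hol d d (cst_path (ev 1 d)) = 0.
Proof.
move=> d0; have := @psi_backtrack d (cst_path (ev 1 d)) erefl d0.
by rewrite rev_cst concat_cst.
Qed.

(** A constant path put before [g] is split off in two ways, once through [d] and once through
    [d']. *)
Lemma hol_change d d' e g : ev 0 d = x0 -> ev 0 d' = x0 -> ev 0 e = x0 ->
  ev 1 d = ev 0 g -> ev 1 d' = ev 0 g -> ev 1 g = ev 1 e ->
  hol d e g = hol d d' (cst_path (ev 0 g)) + hol d' e g.
Proof.
move=> d0 d'0 e0 dg d'g ge.
have H1 : hol d e (concat s (cst_path (ev 0 g)) g) =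
    hol d d (cst_path (ev 0 g)) + hol d e g by apply: hol_concat => //; ends.
have H2 : hol d e (concat s (cst_path (ev 0 g)) g) =
    hol d d' (cst_path (ev 0 g)) + hol d' e g by apply: hol_concat => //; ends.
by move: H1; rewrite H2 -dg hol_cst// add0r.
Qed.

Lemma hol_rev d e g : ev 0 d = x0 -> ev 0 e = x0 -> ev 1 d = ev 0 g ->
  ev 1 g = ev 1 e -> hol e d (Defs.rev_path g) = - hol d e g.
Proof.
move=> d0 e0 dg ge; have := psi_backtrack dg d0.
rewrite -/(hol d d (concat s g (Defs.rev_path g))).
rewrite (@hol_concat d e d); try ends.
by move/eqP; rewrite addrC addr_eq0 => /eqP.
Qed.

Lemma PhiE d e p q : ev 0 d = x0 -> ev 0 e = x0 -> ev 1 d = ev 0 p ->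
  ev 1 p = ev 1 e -> ev 0 p = ev 0 q -> ev 1 p = ev 1 q ->
  Phi s w l d p q = hol d e p - hol d e q.
Proof.
move=> d0 e0 dp pe pq0 pq1; rewrite -[LHS]/(hol d d (concat s p (Defs.rev_path q))).
rewrite (@hol_concat d e d); try ends.
by rewrite (@hol_rev d e); try ends.
Qed.

Variable conn : dconnected X.

(** Chosen separately for each [x], with no smoothness in [x]; this is why later smooth families of
    holonomies keep their ends fixed. *)
Definition base_path (x : X) : Paths X := projT1 (cid (conn x0 x)).

Lemma base_path0 x : ev 0 (base_path x) = x0.
Proof. by rewrite /base_path; case: cid => p []. Qed.

Lemma base_path1 x : ev 1 (base_path x) = x.
Proof. by rewrite /base_path; case: cid => p []. Qed.

Definition holo (p : Paths X) : T_omega s w l :=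
  hol (base_path (ev 0 p)) (base_path (ev 1 p)) p.

Lemma holo_concat p q : ev 1 p = ev 0 q -> holo (concat s p q) = holo p + holo q.
Proof.
move=> pq; rewrite /holo ev0_concat// ev1_concat// (@hol_concat _ (base_path (ev 1 p))).
- by rewrite -pq.
- all: rewrite ?base_path0 ?base_path1//.
Qed.

Lemma holo_rev p : holo (Defs.rev_path p) = - holo p.
Proof.
by rewrite /holo ev0_rev ev1_rev hol_rev// ?base_path0 ?base_path1.
Qed.

Lemma holo_cst x : holo (cst_path x) = 0.
Proof.
have := @hol_cst (base_path x) (base_path0 x).
by rewrite base_path1.
Qed.

(** By [hol_change], replacing an arbitrary [d] by the base path alters the holonomies of [p] and
    [q] by the same term, so [Phi s w l d p q] is [holo p - holo q] for every [d]. *)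
Lemma omega_equivP p q : omega_equiv s w l p q <->
  [/\ ev 0 p = ev 0 q, ev 1 p = ev 1 q & holo p = holo q].
Proof.
have b0 := base_path0; have b1 := base_path1.
have PhiH d : ev 0 p = ev 0 q -> ev 1 p = ev 1 q -> ev 0 d = x0 -> ev 1 d = ev 0 p ->
    Phi s w l d p q = holo p - holo q.
  move=> pq0 pq1 d0 d1.
  rewrite (@PhiE d (base_path (ev 1 p)))// ?b0 ?b1//.
  rewrite (@hol_change d (base_path (ev 0 p)) _ p)// ?b0 ?b1//.
  rewrite (@hol_change d (base_path (ev 0 p)) _ q)// ?b0 ?b1//; last by rewrite d1.
  by rewrite /holo -pq0 -pq1 opprD addrACA subrr add0r.
split=> [[pq0 pq1 H]|[pq0 pq1 H]]; split => //.
  apply/eqP; rewrite -subr_eq0 -(PhiH (base_path (ev 0 p)))// ?b0 ?b1// H ?b0 ?b1//.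
by move=> d d0 d1; rewrite PhiH// H subrr.
Qed.

End Holonomy.

(** * Real-variable tools: inverses, bounded reparametrizations, proper subgroups *)

Section Analysis.
Context {R : realType}.

Lemma CkV k (V : normedModType R) (U : set V) (f : V -> R) : open U ->
  (forall x, U x -> f x != 0) -> Ck k U (f : V -> R^o) ->
  Ck k U ((fun x => (f x)^-1) : V -> R^o).
Proof.
move=> oU f0; elim: k => [|k IH] Cf.
  by move=> x Ux; apply: cvgV; [exact: f0|exact: Cf].
have /IH CV := Ck_pred Cf; have [df Df] := Cf; split=> [x Ux|v].
  by apply: differentiableV; [exact: df|exact: f0].
apply: (@Ck_ext _ _ _ _ _ _ (fun x => (-1 * ((f x)^-1 * (f x)^-1)) * 'D_v (f : V -> R^o) x)) => //.
  move=> x Ux; rewrite deriveV; [|exact: f0|exact/diff_derivable/df].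
  by rewrite mulN1r -invfM -expr2.
apply: (@CkZ _ _ _ R^o) => //; last exact: Df.
apply: (@CkZ _ _ _ R^o) => //; first exact: Ck_cst.
exact: (@CkZ _ _ _ R^o).
Qed.

(** The witness is r x / (1 + x^2), bounded because |x| < 1 + x^2. It bends a straight line through
    a point into a curve that is defined for all times, stays in a small ball, and keeps its
    direction at 0 up to the factor r. *)
Lemma bump (r : R) : 0 < r -> exists th : R -> R,
  [/\ dsmooth (X := real_line R) (Y := real_line R) th, th 0 = 0,
      is_derive (0 : R) 1 th r & forall x, `|th x| < r].
Proof.
move=> r0; have p x : 0 < 1 + x * x :> R by have := sqr_ge0 x; rewrite expr2; lra.
exists (fun x => r * (x * (1 + x * x)^-1)); split.
- move=> n U a [oU sa]; split => //=.
  apply: smoothM => //; first exact: smooth_cst.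
  apply: smoothM => // k; apply: CkV => // [x _|]; first by rewrite gt_eqF.
  by move: k; apply: smoothD; [exact: oU|exact: smooth_cst|exact: smoothM].
- by rewrite mul0r mulr0.
- apply/is_derive1_caratheodory; exists (fun x => r * (1 + x * x)^-1); split.
  + by move=> z; rewrite mul0r mulr0 !subr0 -mulrA [_^-1 * z]mulrC.
  + apply: (@cvgM _ _ _ _ (cst r)); first exact: cvg_cst.
    apply: cvgV; first by rewrite gt_eqF.
    by apply: cvgD; [exact: cvg_cst|apply: cvgM; exact: cvg_id].
  + by rewrite mul0r addr0 invr1 mulr1.
- move=> x; rewrite normrM gtr0_norm// -[ltRHS]mulr1 ltr_pM2l// normrM.
  rewrite [`|_^-1|]gtr0_norm ?invr_gt0// ltr_pdivrMr// mul1r.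
  have -> : x * x = `|x| * `|x| by rewrite -normrM ger0_norm// -expr2 sqr_ge0.
  set y := `|x|.
  have := sqr_ge0 (y - 2^-1); rewrite expr2; lra.
Qed.

(** By the intermediate value theorem, a nonzero [g 1] would place all numbers of absolute value at
    most [|g 1|] in [H], and multiples of these are all of [R]. *)
Lemma proper_continuous0 (H : {pred R}) (g : R -> R) : zmod_closed H ->
  (exists z, z \notin H) -> (forall t, 0 <= t <= 1 -> {for t, continuous g}) ->
  g 0 = 0 -> (forall t, 0 <= t <= 1 -> g t \in H) -> g 1 = 0.
Proof.
move=> [H0 HB] [z zH] cg g0 gH; apply/eqP/negPn/negP => g1.
have HN y : y \in H -> - y \in H by move=> Hy; rewrite -[- y]add0r; exact: HB.
have HD x y : x \in H -> y \in H -> x + y \in H.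
  by move=> Hx Hy; rewrite -[y]opprK; apply: HB => //; exact: HN.
have HM n y : y \in H -> y *+ n \in H.
  by move=> Hy; elim: n => [|n IH]; rewrite ?mulr0n// mulrS HD.
have Hlt y : `|y| <= `|g 1| -> y \in H.
  move=> yg.
  have cg' : {within `[0, 1], continuous g}.
    apply: continuous_in_subspaceT => t; rewrite inE/= in_itv/=; exact: cg.
  have img v : Num.min 0 (g 1) <= v <= Num.max 0 (g 1) -> v \in H.
    rewrite -{1 2}g0 => /(IVT ler01 cg')[c]; rewrite in_itv/= => c01 <-.
    exact: gH.
  have [y0|y0] := leP 0 y; have [G0|G0] := leP 0 (g 1).
  - by apply: img; rewrite min_l// max_r// y0 -(ger0_norm G0) -{1}(ger0_norm y0).
  - rewrite -[y]opprK; apply: HN; apply: img.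
    rewrite (min_r (ltW G0)) (max_l (ltW G0)) oppr_le0 y0 andbT lerNr.
    by move: yg; rewrite ger0_norm// ltr0_norm.
  - rewrite -[y]opprK; apply: HN; apply: img.
    rewrite min_l// max_r// oppr_ge0 (ltW y0).
    by move: yg; rewrite ltr0_norm// ger0_norm.
  - apply: img; rewrite (min_r (ltW G0)) (max_l (ltW G0)) (ltW y0) andbT.
    by move: yg; rewrite !ltr0_norm// lerN2.
have G0 : 0 < `|g 1| by rewrite normr_gt0.
(* With this n, z / n is at most [|g 1|] in absolute value, and z is n times it. *)
pose n := (Num.trunc (`|z| / `|g 1|)).+1.
have zn : `|z| / `|g 1| < n%:R by exact: truncnS_gt.
move/negP: zH; apply.
have -> : z = (z / n%:R) *+ n by rewrite -mulr_natr divfK// pnatr_eq0.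
apply: HM; apply: Hlt; rewrite normrM normfV (ger0_norm (ler0n _ _)).
rewrite ler_pdivrMr ?ltr0n// mulrC -ler_pdivrMr//; exact: ltW.
Qed.

End Analysis.

Section Rays.
Context {R : realType} (s : smashing R) (X : diffSpace R).

(** Radial contraction towards [r] inside a ball. The smashing function clamps the parameter to
    [0, 1], so the rays are defined for all real times and never leave [U]. *)
Lemma plot_ray n (U : set 'rV[R]_n) (P : 'rV[R]_n -> X) r : plot U P -> U r ->
  exists V (Q : 'rV[R]_n -> Paths X), [/\ V r, V `<=` U, plot V Q,
    forall t u, V t -> U (r + s u *: (t - r)) &
    forall t u, V t -> ev u (Q t) = P (r + s u *: (t - r))].
Proof.
move=> pP Ur; have oU := plot_open pP.
have /nbhs_normP[e /= e0 eU] : nbhs r U by exact: open_nbhs_nbhs.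
pose V := ball r e.
have VU u t : V t -> U (r + s u *: (t - r)).
  rewrite /V -ball_normE /= => Vt; apply: eU.
  rewrite /ball_/= opprD addNKr normrN normrZ; apply: le_lt_trans Vt.
  have /andP[s0 s1] := smash_range s u.
  by rewrite (distrC r) ger0_norm// -[leRHS]mul1r ler_wpM2r.
have oV : open V by exact: ball_open.
have sF m (W : set 'rV[R]_m) (a : 'rV[R]_m -> R) (b : 'rV[R]_m -> 'rV[R]_n) :
    open W -> smooth W (a : _ -> R^o) -> smooth W b ->
    smooth W (fun z => r + s (a z) *: (b z - r)).
  move=> oW sa sb; apply: smoothD => //; first exact: smooth_cst.
  apply: smoothZ => //; first by apply: dsmooth_smooth => //; exact: smash_smooth.
  by apply: smoothD => //; exact: smooth_cst.
have dP t : V t -> dsmooth (X := real_line R) (fun u => P (r + s u *: (t - r))).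
  move=> Vt m W a [oW sa]; apply: (plot_comp pP oW (F := fun z => r + s (a z) *: (t - r))).
    by apply: sF => //; exact: smooth_cst.
  by move=> z _; exact: VU.
pose Q t : Paths X := if pselect (V t) is left Vt then exist _ _ (dP t Vt) else cst_path (P r).
have QE t u : V t -> ev u (Q t) = P (r + s u *: (t - r)).
  by move=> Vt; rewrite /Q; case: pselect.
exists V, Q; split => [||| t u|//]; last exact: VU.
- exact: ballxx.
- by move=> t; rewrite /V -ball_normE; exact: eU.
apply: plot_Paths => //.
have oc := open_cyl oV.
apply: (plot_ext (P := P \o (fun z => r + s (lsubmx z 0 0) *: (rsubmx z - r)))).
  apply: (plot_comp pP) => //.
    by apply: sF => //; [exact: smooth_time|exact: smooth_rsubmx].
  by move=> z Vz; exact: VU.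
by move=> z Vz; rewrite /Kplot QE.
Qed.

End Rays.

(** * The homotopy formula for a closed 2-form *)

Section Exterior.
Context {R : realType} (X : diffSpace R).

(** Closedness on the vectors (1, 0), (0, v 0), (0, v 1) equates the time derivative of [m] with the
    combination of derivatives of the [h i] that stands under the integral in [ext_d (Kop w)]. The
    time derivative then integrates to the two boundary terms. *)
Lemma dKop (w : pre_dform 2 X) : is_dform w -> closed_dform w ->
  forall n (V : set 'rV[R]_n) (Q : 'rV[R]_n -> Paths X), plot V Q ->
  forall r, V r -> forall v,
  ext_d (Kop w) V Q r v =
  w n V (fun t => ev 1 (Q t)) r v - w n V (fun t => ev 0 (Q t)) r v.
Proof.
move=> dw cw n V Q pQ r Vr v; have oV := plot_open pQ.
have pK := plot_Kplot pQ.
have cr t : cyl V (tpoint t r) by rewrite /cyl /= rsub_tpoint.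
pose h i z := w (1 + n)%N (cyl V) (Kplot Q) z (Kvec (fun j => v (lift i j))).
have sh i : smooth (cyl V) (h i : _ -> R^o) by exact: dform_smooth pK _.
pose m z := w (1 + n)%N (cyl V) (Kplot Q) z (fun j => row_mx 0 (v j)).
have sm : smooth (cyl V) (m : _ -> R^o) by exact: dform_smooth pK _.
pose Dh i t := 'D_(row_mx 0 (v i)) (h i : _ -> R^o) (tpoint t r).
have cDh i : continuous (Dh i) by have [_ D] := sh i 1%N; exact: (cont_tslice (D _) Vr).
have DK (i : 'I_2) : 'D_(v i) ((fun t => Kop w V Q t (fun j : 'I_1 => v (lift i j))) : _ -> R^o) r =
    int01 (Dh i).
  by have [_ ->] := int01_diff oV (sh i 1%N) Vr.
have mc c : m (tpoint c r) = w n V (fun t => ev c (Q t)) r v.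
  have sc : smooth V (fun t => tpoint c t).
    by apply: smooth_tpoint => //; [exact: smooth_cst|exact: smooth_id].
  rewrite (dform_compat dw pK oV sc (Q := fun t => ev c (Q t)) _ _ Vr)//.
  - congr (w _ _ _ _ _); apply/funext => j; apply/esym; apply: derive_affine => u.
    exact: tpointD.
  - by move=> t Vt; rewrite /cyl /= rsub_tpoint.
  - by move=> t Vt; rewrite /Kplot rsub_tpoint tpoint_time.
pose Dm t := 'D_(tpoint 1 0) (m : _ -> R^o) (tpoint t r).
have cDm : continuous Dm by have [_ D] := sm 1%N; exact: (cont_tslice (D _) Vr).
have Dm01 : int01 Dm = m (tpoint 1 r) - m (tpoint 0 r).
  apply: (int01_ftc (F := fun t => m (tpoint t r))) => // t _.
  have tE u : tpoint u r = row_mx 0 r + u *: tpoint 1 0 by rewrite tpointE addrC.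
  rewrite /Dm tE (_ : (fun t => _) = fun u => m (row_mx 0 r + u *: tpoint 1 0)).
    by apply: is_derive_line; rewrite -tE; have [d _] := sm 1%N; exact: d.
  by apply/funext => u; rewrite -tE.
rewrite -!mc -Dm01 /ext_d big_ord_recl big_ord1 !DK expr0 mul1r.
rewrite (_ : (-1) ^+ _ = -1); last by rewrite /= expr1.
have cN : continuous (fun t => -1 * Dh (lift ord0 ord0) t).
  by move=> t; apply: cvgM; [exact: cvg_cst|exact: cDh].
rewrite -int01Z// -int01D//; apply: eq_int01 => t _.
have := cw _ _ _ pK _ (cr t) (Kvec v).
rewrite /ext_d /zero_dform !big_ord_recl big_ord0 /=.
have K0 : (fun j : 'I_2 => Kvec v (lift ord0 j)) = fun j => row_mx 0 (v j).
  by apply/funext => j; rewrite Kvec_lift.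
have K1 (i : 'I_2) : (fun j : 'I_2 => Kvec v (lift (lift ord0 i) j)) = Kvec (fun j => v (lift i j)).
  apply/funext => j; case: (unliftP ord0 j) => [j' ->|->].
    rewrite Kvec_lift (_ : lift (lift ord0 i) (lift ord0 j') = lift ord0 (lift i j')).
      by rewrite Kvec_lift.
    by apply: val_inj; case: i => -[|[|//]] ?; case: j' => -[|//] ?.
  rewrite Kvec0 (_ : lift (lift ord0 i) ord0 = ord0) ?Kvec0//.
  by apply: val_inj => /=; rewrite /bump.
rewrite K0 !K1 !Kvec_lift Kvec0 -/(Dm t) expr0 mul1r.
rewrite -/(h ord0) -/(h (lift ord0 ord0)) -/(Dh ord0 t) -/(Dh (lift ord0 ord0) t).
rewrite /bump /= !expr1; lra.
Qed.

End Exterior.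

(** * The groupoid and its invariant form *)

Section Morphisms.
Context {R : realType} (s : smashing R) (X : diffSpace R).
Variables (w : dform 2 X) (x0 : X) (l : loop_basis x0).
Hypothesis conn : dconnected X.

Let cls := class_omega s w l.
Let src := mor_src s w l.
Let trg := mor_trg s w l.
Let comp := mor_comp s w l.
Let hl := holo s w l conn.

(** Equality of the sets that serve as classes amounts to equivalence only for an equivalence
    relation. That property is visible through [omega_equivP], which makes it equality of three
    invariants; hence the appeal to connectedness. *)
Lemma class_eq p q : cls p = cls q <-> omega_equiv s w l p q.
Proof.
split=> [H|/(omega_equivP _ _ _ conn) [pq0 pq1 pqh]].
  have : omega_equiv s w l q q by apply/(omega_equivP _ _ _ conn).
  by rewrite -[omega_equiv s w l q]/(sval (cls q)) -H.
apply: eq_exist; apply/funext => r; apply/propext.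
by rewrite !(omega_equivP _ _ _ conn) pq0 pq1 pqh.
Qed.

Lemma class_eqP p q : cls p = cls q <-> [/\ ev 0 p = ev 0 q, ev 1 p = ev 1 q & hl p = hl q].
Proof. by rewrite class_eq; exact: omega_equivP. Qed.

Lemma class_rep y : cls (quotient_rep y) = y.
Proof. exact: quotient_repK. Qed.

Lemma src_class p : src (cls p) = ev 0 p.
Proof. by have /class_eqP[] := class_rep (cls p). Qed.

Lemma trg_class p : trg (cls p) = ev 1 p.
Proof. by have /class_eqP[] := class_rep (cls p). Qed.

Lemma comp_class p q : ev 1 p = ev 0 q -> comp (cls p) (cls q) = cls (concat s p q).
Proof.
move=> pq; have /class_eqP[p0 p1 hp] := class_rep (cls p).
have /class_eqP[q0 q1 hq] := class_rep (cls q).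
have e : ev 1 (quotient_rep (cls p)) = ev 0 (quotient_rep (cls q)) by rewrite p1 q0.
by apply/class_eqP; rewrite !ev0_concat// !ev1_concat// /hl !holo_concat// -/hl hp hq.
Qed.

Definition mor_inv (y : Mor s w l) : Mor s w l := cls (Defs.rev_path (quotient_rep y)).

Lemma inv_class p : mor_inv (cls p) = cls (Defs.rev_path p).
Proof.
have /class_eqP[p0 p1 hp] := class_rep (cls p).
by apply/class_eqP; rewrite !ev0_rev !ev1_rev /hl !holo_rev -/hl hp.
Qed.

Definition mor_one (x : X) : Mor s w l := cls (cst_path x).

Lemma mor_groupoid : is_groupoid src trg comp mor_one mor_inv.
Proof.
have cp := comp_class; have sc := src_class; have tc := trg_class.
have S y : exists p, y = cls p by exists (quotient_rep y); rewrite class_rep.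
have ce (x : X) t : ev t (cst_path x) = x by [].
split.
- move=> y z; have [p ->] := S y; have [q ->] := S z; rewrite sc tc => pq.
  by rewrite cp// !sc ev0_concat.
- move=> y z; have [p ->] := S y; have [q ->] := S z; rewrite sc tc => pq.
  by rewrite cp// !tc ev1_concat.
- move=> y z t; have [p ->] := S y; have [q ->] := S z; have [r ->] := S t.
  rewrite !sc !tc => pq qr; rewrite !cp//; try ends.
  apply/class_eqP; split; try ends.
  by rewrite /hl !holo_concat ?addrA//; ends.
- by move=> x; rewrite sc.
- by move=> x; rewrite tc.
- move=> y; have [p ->] := S y; rewrite sc cp//; apply/class_eqP; split; try ends.
  by rewrite /hl holo_concat// holo_cst add0r.
- move=> y; have [p ->] := S y; rewrite tc cp//; apply/class_eqP; split; try ends.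
  by rewrite /hl holo_concat// holo_cst addr0.
- by move=> y; have [p ->] := S y; rewrite inv_class sc tc ev0_rev.
- by move=> y; have [p ->] := S y; rewrite inv_class sc tc ev1_rev.
- move=> y; have [p ->] := S y; rewrite inv_class tc cp ?ev1_rev//.
  apply/class_eqP; split; try ends.
  by rewrite /hl holo_concat ?ev1_rev// holo_rev holo_cst addNr.
- move=> y; have [p ->] := S y; rewrite inv_class sc cp ?ev0_rev//.
  apply/class_eqP; split; try ends.
  by rewrite /hl holo_concat ?ev0_rev// holo_rev holo_cst subrr.
Qed.

Lemma plot_class n (U : set 'rV[R]_n) (Q : 'rV[R]_n -> Paths X) :
  plot U Q -> plot U (fun r => cls (Q r)).
Proof. by move=> pQ; split; [exact: plot_open pQ|move=> r Ur; exists U, Q; split]. Qed.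

Lemma plot_cst_path n (U : set 'rV[R]_n) (P : 'rV[R]_n -> X) :
  plot U P -> plot U (fun r => cst_path (P r) : Paths X).
Proof.
move=> pP; have oU := plot_open pP; apply: plot_Paths => //.
apply: (plot_ext (P := fun z : 'rV[R]_(1 + n) => P (rsubmx z))) => //.
apply: (plot_comp pP (F := rsubmx)) => //; last exact: smooth_rsubmx.
exact: open_cyl.
Qed.

Lemma dsmooth_mor (Y : diffSpace R) (f : Mor s w l -> Y) :
  (forall n (U : set 'rV[R]_n) Q, plot U Q -> plot U (fun r => f (cls (Q r)))) ->
  dsmooth f.
Proof.
move=> fQ n U P [oU lP]; apply: plot_local => // r Ur.
have [V [Q [Vr VU pQ PQ]]] := lP r Ur.
exists V, (fun r => f (cls (Q r))); split => //; first exact: fQ.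
by move=> t Vt /=; rewrite PQ.
Qed.

Lemma dsmooth_src : dsmooth src.
Proof.
apply: dsmooth_mor => n U Q pQ; apply: (plot_ext (plot_ev_at 0 pQ)) => t _.
exact: src_class.
Qed.

Lemma dsmooth_trg : dsmooth trg.
Proof.
apply: dsmooth_mor => n U Q pQ; apply: (plot_ext (plot_ev_at 1 pQ)) => t _.
exact: trg_class.
Qed.

Lemma mor_fibrating : fibrating_groupoid src trg comp.
Proof.
split.
  exists mor_one, mor_inv; split; first exact: mor_groupoid.
  split; [exact: dsmooth_src|exact: dsmooth_trg| | |].
  - by move=> n U P pP; apply: plot_class; exact: plot_cst_path.
  - apply: dsmooth_mor => n U Q pQ; apply: (plot_ext (plot_class (plot_rev pQ))) => t _.
    exact: inv_class.
  - move=> n U P [[oU l1] [_ l2]]; split=> // r Ur.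
    (* Local lifts of the two factors are composable wherever both are defined, since source and
       target can be read on any representative. *)
    have [V1 [Q1 [V1r V1U pQ1 PQ1]]] := l1 r Ur.
    have [V2 [Q2 [V2r V2U pQ2 PQ2]]] := l2 r Ur.
    have oV : open (V1 `&` V2) by apply: openI; [exact: plot_open pQ1|exact: plot_open pQ2].
    have E t : V1 t -> V2 t -> ev 1 (Q1 t) = ev 0 (Q2 t).
      move=> V1t V2t; have := svalP (P t); rewrite /= PQ1// PQ2//.
      by rewrite -/(cls (Q1 t)) -/(cls (Q2 t)) trg_class src_class.
    exists (V1 `&` V2), (fun t => concat s (Q1 t) (Q2 t)); split => //.
    + by move=> t [/V1U].
    + apply: plot_concat => [||t [? ?]]; last exact: E.
      * by apply: (plot_sub pQ1) => // t [].
      * by apply: (plot_sub pQ2) => // t [].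
    + move=> t [V1t V2t] /=; rewrite /sub_incl PQ1// PQ2//; apply: comp_class.
      exact: E.
split.
- move=> n U P pP; split; [exact: dsmooth_src pP|exact: dsmooth_trg pP].
- move=> [x y]; have [p [p0 p1]] := conn x y.
  by exists (cls p); rewrite src_class trg_class p0 p1.
move=> n U P [pP1 pP2] r Ur.
(* The local section over [P] near [r]: back along a ray to the first component of [P r], along a
   fixed path [p] to the second component, then out along another ray. *)
have [V1 [Q1 [V1r V1U pQ1 _ PQ1]]] := plot_ray s pP1 Ur.
have [V2 [Q2 [V2r V2U pQ2 _ PQ2]]] := plot_ray s pP2 Ur.
have [p [p0 p1]] := conn (P r).1 (P r).2.
have e0 := smash_eps_gt0 s.
have s0 : s 0 = 0 by apply: smash_left; lra.
have s1 : s 1 = 1 by apply: smash_right; lra.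
have Q10 t : V1 t -> ev 0 (Q1 t) = (P r).1 by move=> ?; rewrite PQ1// s0 scale0r addr0.
have Q20 t : V2 t -> ev 0 (Q2 t) = (P r).2 by move=> ?; rewrite PQ2// s0 scale0r addr0.
have Q11 t : V1 t -> ev 1 (Q1 t) = (P t).1.
  by move=> ?; rewrite PQ1// s1 scale1r addrC subrK.
have Q21 t : V2 t -> ev 1 (Q2 t) = (P t).2.
  by move=> ?; rewrite PQ2// s1 scale1r addrC subrK.
have oV : open (V1 `&` V2) by apply: openI; [exact: plot_open pQ1|exact: plot_open pQ2].
have pQ1' : plot (V1 `&` V2) Q1 by apply: (plot_sub pQ1) => // t [].
have pQ2' : plot (V1 `&` V2) Q2 by apply: (plot_sub pQ2) => // t [].
have prQ := plot_rev pQ1'.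
have pp : plot (V1 `&` V2) (fun=> p) by exact: plot_cst.
have p12 : plot (V1 `&` V2) (fun t => concat s (Defs.rev_path (Q1 t)) p).
  by apply: plot_concat => // t [V1t V2t]; rewrite ev1_rev Q10.
exists (V1 `&` V2), (fun t => cls (concat s (concat s (Defs.rev_path (Q1 t)) p) (Q2 t))).
split => //.
- by move=> t [/V1U].
- apply: plot_class; apply: plot_concat => // t [V1t V2t].
  by rewrite ev1_concat ?Q20// ev1_rev Q10.
move=> t [V1t V2t]; rewrite src_class trg_class.
have h1 : ev 1 (Defs.rev_path (Q1 t)) = ev 0 p by rewrite ev1_rev Q10.
have h2 : ev 1 (concat s (Defs.rev_path (Q1 t)) p) = ev 0 (Q2 t) by rewrite ev1_concat// p1 Q20.
rewrite ev0_concat// ev0_concat// ev0_rev ev1_concat// Q11// Q21//.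
by case: (P t).
Qed.

Let Kw : pre_dform 1 (Paths X) := Kop w.

Lemma Kw_line_smooth (N : 'rV[R]_1 -> Paths X) : plot setT N ->
  smooth setT ((fun x => Kw setT N (const_mx (x 0 0)) (fun=> const_mx 1)) : 'rV[R]_1 -> R^o).
Proof.
move=> pN.
rewrite (_ : (fun x => _) = fun x => Kw setT N x (fun=> const_mx 1)).
  exact: (dform_smooth (Kw_dform w) pN).
apply/funext => x; congr (Kop w _ _ _ _); apply/rowP => i.
by rewrite mxE ord1.
Qed.

Lemma Kw_line_cont (N : 'rV[R]_1 -> Paths X) : plot setT N ->
  continuous (fun t : R => Kw setT N (const_mx t) (fun=> const_mx 1)).
Proof.
move=> pN t.
have c := Kw_line_smooth pN 0%N.
rewrite (_ : (fun u : R => _) = (fun x : 'rV[R]_1 => Kw setT N (const_mx (x 0 0)) (fun=> const_mx 1)) \o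
   (fun u : R => u *: const_mx 1)); last by apply/funext => u; rewrite /= !mxE mulr1.
apply: continuous_comp; last exact: c.
by apply: cvgZ; [exact: cvg_id|exact: cvg_cst].
Qed.

(** Rescaling the family by b turns the integral from 0 to b into one over [0, 1]. The bound 1/2
    keeps b t above -1 for t in ]-1, 2[, the range that [int01_ftc] demands. *)
Lemma Kw_line (N : 'rV[R]_1 -> Paths X) (I : R -> R) b : plot setT N ->
  (forall x : R, -1 < x -> is_derive x 1 I (Kw setT N (const_mx x) (fun=> const_mx 1))) ->
  -2^-1 < b < 2^-1 ->
  int01 (fun t => Kw setT (fun x => N (b *: x)) (const_mx t) (fun=> const_mx 1)) = I b - I 0.
Proof.
move=> pN dI b2; have ck := Kw_line_cont pN; set k := fun t : R => _ in ck.
have sb : smooth setT (fun x : 'rV[R]_1 => b *: x).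
  by apply: smoothZ; [exact: openT|exact: smooth_cst|exact: smooth_id].
have cm (t : R) : b *: (const_mx t : 'rV[R]_1) = const_mx (b * t).
  by apply/rowP => i; rewrite !mxE.
have Kb t : Kop w setT (fun x => N (b *: x)) (const_mx t) (fun=> const_mx 1) = b * k (b * t).
  rewrite (dform_compat (Kw_dform w) pN openT sb)//.
  rewrite cm (_ : (fun i => _) = [eta (fun=> const_mx 1) with ord0 |-> b *: const_mx 1]).
    rewrite (dform_scale (Kw_dform w) pN)//; congr (_ * Kop w _ _ _ _).
    by apply/funext => i /=; case: ifP.
  apply/funext => i /=; rewrite ord1 eqxx; apply: derive_affine => u.
  by rewrite scalerDr scalerA mulrC -scalerA.
rewrite (_ : (fun t => _) = fun t => b * k (b * t)); last exact/funext.
rewrite -[in X in _ = I X - _](mulr1 b) -[in X in _ = _ - I X](mulr0 b).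
apply: (int01_ftc (F := fun t => I (b * t))) => [t|t t2].
  apply: cvgM; first exact: cvg_cst.
  apply: (@continuous_comp _ _ _ (fun t => b * t) k); last exact: ck.
  by apply: cvgM; [exact: cvg_cst|exact: cvg_id].
rewrite mulrC; apply: (is_derive_comp (f := fun t => b * t)).
  have := is_derive_affine1 b 0 t; congr (is_derive _ _ _ _).
  by apply/funext => u; rewrite addr0.
apply: dI; nra.
Qed.

(** * The invariant 1-form on the morphisms *)

Section Lambda.
Hypothesis proper : [set c : R | c \in P_omega s w l] <> setT.

Lemma line_equiv (Q Q' : 'rV[R]_1 -> Paths X) : plot setT Q -> plot setT Q' ->
  (forall x, cls (Q x) = cls (Q' x)) ->
  Kw setT Q (const_mx 0) (fun=> const_mx 1) = Kw setT Q' (const_mx 0) (fun=> const_mx 1).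
Proof.
move=> pQ pQ' QQ'; have dw := dformP w.
have E x : [/\ ev 0 (Q x) = ev 0 (Q' x), ev 1 (Q x) = ev 1 (Q' x) &
   forall d : Paths X, ev 0 d = x0 -> ev 1 d = ev 0 (Q x) -> Phi s w l d (Q x) (Q' x) = 0].
  by apply/class_eq.
have [B BE] := mk_path (plot_ev_at 0 pQ).
pose d := base_path x0 conn (ev 0 B).
have d1 : ev 1 d = ev 0 B by exact: base_path1.
have d0 : ev 0 d = x0 by exact: base_path0.
have BQ (x : 'rV[R]_1) : ev (x 0 0) B = ev 0 (Q x).
  by rewrite BE; congr (ev 0 (Q _)); apply/rowP => i; rewrite mxE ord1.
pose D x := concat s d (shrink B x).
have dB x : ev 1 d = ev 0 (shrink B x) by rewrite ev0_shrink.
have D0 x : ev 0 (D x) = x0 by rewrite /D ev0_concat.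
have D1 x : ev 1 (D x) = ev 0 (Q x) by rewrite /D ev1_concat// ev1_shrink BQ.
pose L x := concat s (Q x) (Defs.rev_path (Q' x)).
have QQ1 x : ev 1 (Q x) = ev 0 (Defs.rev_path (Q' x)).
  by rewrite ev0_rev; case: (E x).
have QQ0 x : ev 1 (Defs.rev_path (Q' x)) = ev 0 (Q x).
  by rewrite ev1_rev; case: (E x).
pose N x := concat s (concat s (D x) (L x)) (Defs.rev_path (D x)).
have DL x : ev 1 (D x) = ev 0 (L x) by rewrite D1 /L ev0_concat.
have LD x : ev 1 (concat s (D x) (L x)) = ev 0 (Defs.rev_path (D x)).
  by rewrite ev1_concat// /L ev1_concat// QQ0 ev0_rev D1.
have pB := plot_shrink B; have pd := plot_fixed d.
have pD : plot setT D by apply: plot_concat.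
have pQr := plot_rev pQ'.
have pL : plot setT L by apply: plot_concat.
have pDL : plot setT (fun x => concat s (D x) (L x)) by apply: plot_concat.
have pDr := plot_rev pD.
have pN : plot setT N by apply: plot_concat.
have N0 x : ev 0 (N x) = x0 /\ ev 1 (N x) = x0.
  by rewrite /N ev0_concat// ev0_concat// ev1_concat// ev1_rev D0.
have psiN x : psi s w l (to_loop x0 (N x)) = 0.
  by have [_ _] := E x; apply; rewrite ?D0 ?D1.
have KN x v : Kw setT N x v = Kw setT Q x v - Kw setT Q' x v.
  rewrite /Kw (Kop_concat s v dw pDL pDr)// (Kop_concat s v dw pD pL)//.
  rewrite (Kop_concat s v dw pQ pQr)// (Kop_rev v dw pQ')// (Kop_rev v dw pD)//; lra.
pose k t := Kw setT N (const_mx t) (fun=> const_mx 1).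
suff : k 0 = 0 by rewrite /k KN => /eqP; rewrite subr_eq0 => /eqP.
have ck : continuous k by exact: Kw_line_cont.
have [I dI] := antiderivative ck.
have IP b : -2^-1 < b < 2^-1 -> I b - I 0 \in P_omega s w l.
  move=> b2.
  have sb : smooth setT (fun x : 'rV[R]_1 => b *: x).
    by apply: smoothZ; [exact: openT|exact: smooth_cst|exact: smooth_id].
  have pNb : plot setT (fun x => N (b *: x)).
    by apply: (plot_comp pN openT (F := fun x => b *: x)).
  have := psi_var s w l pNb (fun x => N0 _); rewrite !psiN add0r => /esym/eqP.
  by rewrite pi_omega_eq0 (Kw_line pN dI b2).
have proper' : exists z, z \notin P_omega s w l.
  apply: contrapT => H; apply: proper; apply/seteqP; split => // z _ /=.
  by apply/negPn/negP => zH; apply: H; exists z.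
have cIb (b t : R) : -2^-1 < b < 2^-1 -> 0 <= t <= 1 ->
    {for t, continuous (fun u : R => I (u * b) - I 0 : R^o)}.
  move=> b2 t01; apply: cvgB; last exact: cvg_cst.
  apply: (@continuous_comp _ _ _ (fun u : R => u * b) I).
    by apply: cvgM; [exact: cvg_id|exact: cvg_cst].
  apply: differentiable_continuous; apply/derivable1_diffP.
  by have [|+ _] := dI (t * b); first nra.
have I0 b : -2^-1 < b < 2^-1 -> I b = I 0.
  move=> b2; apply/eqP; rewrite -subr_eq0; apply/eqP.
  (* Along the segment from 0 to b, the increments of [I] form a continuous curve in [P_omega] that
     starts at 0. *)
  have := @proper_continuous0 R (P_omega s w l) (fun t => I (t * b) - I 0)
    (P_omega_zmod_closed s w l) proper'.
  rewrite mul1r mul0r subrr; apply => // t t01; first exact: cIb.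
  by apply: IP; nra.
have [|_ <-] := dI 0; first lra.
rewrite (@near_eq_derive _ _ _ _ (cst (I 0))) ?derive_cst//.
have : \forall b \near (0 : R), b \in `]-2^-1, 2^-1[%R.
  by apply: near_in_itvoo; rewrite in_itv/=; lra.
by apply: filterS => b; rewrite in_itv/= => /I0.
Qed.

(** Reduction to [line_equiv]: [bump] gives a curve through [r], defined on the whole line and
    confined to the overlap of [V] and [V'], with velocity [rho *: v0] at 0. The factor [rho] is
    then divided out. *)
Lemma lift_unique n (V V' : set 'rV[R]_n) (Q Q' : 'rV[R]_n -> Paths X) r v :
  plot V Q -> plot V' Q' -> V r -> V' r ->
  (forall t, V t -> V' t -> cls (Q t) = cls (Q' t)) ->
  Kw V Q r v = Kw V' Q' r v.
Proof.
move=> pQ pQ' Vr V'r QQ'; have dK := Kw_dform w.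
pose v0 := v ord0.
have oW : open (V `&` V') by apply: openI; [exact: plot_open pQ|exact: plot_open pQ'].
have /nbhs_normP[e /= e0 eW] : nbhs r (V `&` V') by exact: open_nbhs_nbhs.
(* The 1 in the denominator covers v0 = 0 and makes [rho] times the norm of v0 strictly less than
   e. *)
pose rho := e / (1 + `|v0|).
have nv : 0 < 1 + `|v0| by have := normr_ge0 v0; lra.
have rho0 : 0 < rho by rewrite divr_gt0.
have [th [sth th0 dth thr]] := bump rho0.
pose F (x : 'rV[R]_1) := r + th (x 0 0) *: v0.
have FW x : (V `&` V') (F x).
  apply: eW; rewrite /ball_/= opprD addNKr normrN normrZ.
  apply: (@le_lt_trans _ _ (rho * `|v0|)); first by rewrite ler_wpM2r// ltW.
  by rewrite /rho mulrAC ltr_pdivrMr// ltr_pM2l//; lra.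
have sF : smooth setT F.
  apply: smoothD; [exact: openT|exact: smooth_cst|].
  apply: smoothZ; [exact: openT| |exact: smooth_cst].
  by apply: dsmooth_smooth => //; [exact: openT|exact: smooth_coord].
have H (W : set 'rV[R]_n) P : plot W P -> W r -> (forall x, W (F x)) ->
    Kw setT (P \o F) (const_mx 0) (fun=> const_mx 1) = rho * Kw W P r v.
  move=> pP Wr FW'.
  rewrite /Kw (dform_compat dK pP openT sF)//.
  have F0 : F (const_mx 0) = r by rewrite /F mxE th0 scale0r addr0.
  rewrite F0 (_ : (fun i => _) = [eta v with ord0 |-> rho *: v0]).
    rewrite (dform_scale dK pP)//; congr (_ * Kop w _ _ _ _).
    by apply/funext => i /=; rewrite ord1 eqxx.
  apply/funext => i /=; rewrite ord1 eqxx; apply: derive_lineE.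
  rewrite (_ : (fun u => _) = fun u : R => r + th u *: v0); first exact: is_derive_affine.
  by apply/funext => u; rewrite /F !mxE add0r mulr1.
have V1 x : V (F x) by case: (FW x).
have V2 x : V' (F x) by case: (FW x).
have := line_equiv (plot_comp pQ openT sF (fun x _ => V1 x)) (plot_comp pQ' openT sF (fun x _ => V2 x)).
rewrite (H _ _ pQ Vr V1) (H _ _ pQ' V'r V2) => H1; apply: (mulfI (lt0r_neq0 rho0)); apply: H1 => x /=.
exact: QQ'.
Qed.

Definition is_lift n (U : set 'rV[R]_n) (P : 'rV[R]_n -> Mor s w l) r
    (VQ : set 'rV[R]_n * ('rV[R]_n -> Paths X)) :=
  [/\ VQ.1 r, VQ.1 `<=` U, plot VQ.1 VQ.2 & forall t, VQ.1 t -> P t = cls (VQ.2 t)].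

(** The choice of a lift is harmless by [lift_unique]. The value 0 is taken only when [P] has no
    lift near [r], hence never for a plot at a point of its domain. *)
Definition lam : pre_dform 1 (Mor s w l) := fun n U P r v =>
  if pselect (exists VQ, is_lift U P r VQ) is left h
  then Kw (projT1 (cid h)).1 (projT1 (cid h)).2 r v else 0.

Lemma lamE n (U V : set 'rV[R]_n) P Q r v : V r -> V `<=` U -> plot V Q ->
  (forall t, V t -> P t = cls (Q t)) -> lam U P r v = Kw V Q r v.
Proof.
move=> Vr VU pQ PQ; rewrite /lam; case: pselect => [h|]; last by case; exists (V, Q).
case: cid => -[V' Q'] /= [/= V'r V'U pQ' PQ']; apply: lift_unique => // t V't Vt.
by rewrite -PQ// -PQ'.
Qed.

Lemma lam_dform : is_dform lam.
Proof.
have dK := Kw_dform w; split.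
- move=> n U P [oU lP] r Ur v i c u z; have [V [Q [Vr VU pQ PQ]]] := lP r Ur.
  by rewrite !(lamE _ Vr VU pQ PQ); exact: (dform_linear dK pQ).
- move=> n U P [oU lP] r Ur v i j ij vij; have [V [Q [Vr VU pQ PQ]]] := lP r Ur.
  by rewrite (lamE _ Vr VU pQ PQ); exact: (dform_alternating dK pQ _ ij).
- move=> n U P [oU lP] v k; apply: Ck_local => r Ur.
  have [V [Q [Vr VU pQ PQ]]] := lP r Ur.
  exists V, (fun r => Kw V Q r v); split => //; first exact: plot_open pQ.
    exact: (dform_smooth dK pQ).
  by move=> t Vt; exact: lamE.
- move=> n m U P V F P' [oU lP] oV sF FU PP' r Vr v.
  have [V1 [Q [V1r V1U pQ PQ]]] := lP _ (FU _ Vr).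
  have oV1 := plot_open pQ.
  pose W := V `&` F @^-1` V1.
  have oW : open W by exact: open_preimage.
  have sFW : smooth W F by apply: smooth_sub sF => t [].
  rewrite (lamE _ V1r V1U pQ PQ) (lamE (V := W) (Q := Q \o F))//.
  + by apply: (dform_compat dK pQ oW sFW) => // t [].
  + by move=> t [].
  + by apply: (plot_comp pQ oW sFW) => t [].
  + by move=> t [Vt V1t]; rewrite PP'// PQ.
Qed.

Lemma lam_class : dform_eq (pullback cls lam) Kw.
Proof. by move=> n U P pP r Ur v; rewrite /pullback (lamE (V := U) (Q := P)). Qed.

(** Pullback by the class map is injective on forms, because forms are local and plots of the
    quotient lift locally. *)
Lemma lam_unique (lam' : dform 1 (Mor s w l)) :
  dform_eq (pullback cls lam') Kw -> dform_eq lam' lam.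
Proof.
move=> H n U P pP r Ur v; have [oU lP] := pP; have [V [Q [Vr VU pQ PQ]]] := lP r Ur.
rewrite (lamE _ Vr VU pQ PQ) -(H _ _ _ pQ)//.
apply: (dform_local (dformP lam')) => //; first exact: plot_class.
by move=> t _ Vt; rewrite PQ.
Qed.

Lemma Kw_cst n (U : set 'rV[R]_n) p r v : open U -> U r -> Kw U (fun=> p) r v = 0.
Proof.
move=> oU Ur; apply: (Kop_thin (p := p) (h := fun z => lsubmx z 0 0)) => //.
- exact: dformP.
- exact: plot_cst.
- exact: smooth_time.
- by move=> t r' _; rewrite tpoint_time.
Qed.

(** Multiplication by [y] lifts to concatenation with one fixed representative. [Kw] vanishes on a
    constant family by [Kw_cst], so [Kop_concat] leaves only the term of the moving factor. *)
Lemma lam_invariant : left_right_invariant src trg comp lam.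
Proof.
have dw := dformP w.
split=> y n U P [oU lP] r Ur v; rewrite /pullback.
  have [V [Q [Vr VU pQ PQ]]] := lP r Ur; have oV := plot_open pQ.
  have pp : plot V (fun=> quotient_rep y) by exact: plot_cst.
  have E t : V t -> ev 1 (quotient_rep y) = ev 0 (Q t).
    move=> Vt; have := svalP (P t); rewrite /= PQ// -/(cls _) src_class => ->.
    by rewrite -[in RHS](class_rep y) trg_class.
  rewrite (lamE (P := sub_incl \o P) _ Vr VU pQ)//.
  rewrite (lamE (V := V) (Q := fun t => concat s (quotient_rep y) (Q t)))//.
  - by rewrite /Kw (Kop_concat s v dw pp pQ)// -/Kw Kw_cst// add0r.
  - exact: plot_concat.
  - move=> t Vt /=; rewrite -comp_class ?class_rep//; last exact: E.
    by congr (comp y _); exact: PQ.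
have [V [Q [Vr VU pQ PQ]]] := lP r Ur; have oV := plot_open pQ.
have pp : plot V (fun=> quotient_rep y) by exact: plot_cst.
have E t : V t -> ev 1 (Q t) = ev 0 (quotient_rep y).
  move=> Vt; have := svalP (P t); rewrite /= PQ// -/(cls _) trg_class => ->.
  by rewrite -[in LHS](class_rep y) src_class.
rewrite (lamE (P := sub_incl \o P) _ Vr VU pQ)//.
rewrite (lamE (V := V) (Q := fun t => concat s (Q t) (quotient_rep y)))//.
- by rewrite /Kw (Kop_concat s v dw pQ pp)// -/Kw Kw_cst// addr0.
- exact: plot_concat.
- move=> t Vt /=; rewrite -comp_class ?class_rep//; last exact: E.
  by congr (comp _ y); exact: PQ.
Qed.

(** The exterior derivative sees the form only near [r], where it is [Kw] of one lift, so [dKop]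
    applies. *)
Lemma lam_curvature : closed_dform w ->
  dform_eq (ext_d lam) (sub_dform (pullback trg w) (pullback src w)).
Proof.
move=> cw n U P pP r Ur v; have [oU lP] := pP.
have [V [Q [Vr VU pQ PQ]]] := lP r Ur; have oV := plot_open pQ.
have dw := dformP w.
have -> : ext_d lam U P r v = ext_d Kw V Q r v.
  apply: eq_bigr => i _; congr (_ * _); apply: near_eq_derive.
  apply: filterS (open_nbhs_nbhs (conj oV Vr)) => t Vt.
  exact: lamE.
rewrite (dKop dw cw pQ)// /sub_dform /pullback; congr (_ - _).
- apply: (dform_local dw) => //; first exact: plot_ev_at.
    exact: dsmooth_trg.
  by move=> t Vt Ut /=; rewrite PQ// trg_class.
- apply: (dform_local dw) => //; first exact: plot_ev_at.
    exact: dsmooth_src.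
  by move=> t Vt Ut /=; rewrite PQ// src_class.
Qed.

End Lambda.
End Morphisms.

(** * Isotropy groups *)

Section Inverse.
Context {R : realType}.

(** Where [k] is positive, [I] is strictly increasing and the intermediate value theorem supplies
    [J]; the identity J' = 1 / k(J) then raises the order of smoothness by one at each step. The
    bound 1/2 on [J] is the one that [Kw_line] demands. *)
Lemma smooth_inverse (I k : R -> R) :
  (forall x : R, -1 < x -> is_derive x 1 I (k x)) ->
  smooth setT ((fun x => k (x 0 0)) : 'rV[R]_1 -> R^o) -> 0 < k 0 ->
  exists (e : R) (J : R -> R), [/\ 0 < e,
    forall c, `|c| < e -> `|J c| < 2^-1 /\ I (J c) = I 0 + c &
    smooth [set x : 'rV[R]_1 | `|x 0 0| < e] ((fun x => J (x 0 0)) : _ -> R^o)].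
Proof.
move=> dI sk k0.
have ck : continuous k.
  move=> t; rewrite (_ : k = (fun x : 'rV[R]_1 => k (x 0 0)) \o (fun u : R => u *: const_mx 1)).
    apply: continuous_comp; last exact: (sk 0%N).
    by apply: cvgZ; [exact: cvg_id|exact: cvg_cst].
  by apply/funext => u; rewrite /= !mxE mulr1.
have [d d0 dk] : exists2 d : R, 0 < d & forall x, `|x| < d -> 0 < k x.
  have : \forall x \near (0 : R), 0 < k x.
    by apply: (@cvgr_gt _ _ (nbhs (0 : R)) _ k (k 0) (ck 0)).
  move=> /nbhs_normP[d /= d0 H]; exists d => // x xd; apply: H.
  by rewrite /ball_/= sub0r normrN.
(* The bound d / 2 stays where [k] is positive; 1/4 stays below the announced 1/2 and well inside
   the domain beyond -1. *)
pose h := Num.min (d / 2) (4^-1 : R).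
have h0 : 0 < h by rewrite lt_min divr_gt0//= invr_gt0.
have hd : h < d by rewrite gt_min; apply/orP; left; lra.
have h4 : h <= 4^-1 by rewrite ge_min lexx orbT.
have cI (x : R) : -1 < x -> {for x, continuous I}.
  by move=> /dI[D _]; apply: differentiable_continuous; apply/derivable1_diffP.
have incr (x y : R) : `|x| < d -> `|y| < d -> -1 < x -> x < y -> I x < I y.
  move=> xd yd x1 xy.
  have [||z] := @MVT _ I k x y xy.
  - move=> z; rewrite in_itv/= => /andP[xz zy]; apply: dI; lra.
  - apply: continuous_in_subspaceT => z; rewrite inE/= in_itv/= => /andP[xz zy].
    apply: cI; lra.
  rewrite in_itv/= => /andP[xz zy] E; rewrite -subr_gt0 E mulr_gt0 ?subr_gt0//.
  apply: dk; rewrite ltr_norml; move: xd yd; rewrite !ltr_norml; lra.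
have inj (x y : R) : `|x| < d -> `|y| < d -> -1 < x -> -1 < y -> I x = I y -> x = y.
  move=> xd yd x1 y1 E; have [xy|xy|//] := ltgtP x y.
  - by have := incr _ _ xd yd x1 xy; rewrite E ltxx.
  - by have := incr _ _ yd xd y1 xy; rewrite E ltxx.
have nh : `|h| < d by rewrite gtr0_norm.
have nNh : `|- h| < d by rewrite normrN.
have n0 : `|0 : R| < d by rewrite normr0.
pose e := Num.min (I h - I 0) (I 0 - I (- h)).
have e0 : 0 < e by rewrite lt_min !subr_gt0 !incr//; lra.
have ex c : `|c| < e -> exists2 x, `|x| <= h & I x = I 0 + c.
  rewrite ltr_norml /e => ce.
  have : - Num.min (I h - I 0) (I 0 - I (- h)) >= - (I 0 - I (- h)).
    by rewrite lerN2 ge_min lexx orbT.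
  have : Num.min (I h - I 0) (I 0 - I (- h)) <= I h - I 0 by rewrite ge_min lexx.
  move=> H1 H2.
  have [|||x] := @IVT R I (- h) h (I 0 + c).
  - lra.
  - apply: continuous_in_subspaceT => z; rewrite inE/= in_itv/= => /andP[xz zy].
    apply: cI; lra.
  - have Ih : I (- h) <= I h by apply/ltW/incr => //; lra.
    by rewrite min_l// max_r//; lra.
  by rewrite in_itv/= => xh Ix; exists x => //; rewrite ler_norml.
pose J : R -> R := fun c => xget (0 : R) [set x | `|x| <= h /\ I x = I 0 + c].
have JP c : `|c| < e -> `|J c| <= h /\ I (J c) = I 0 + c.
  by move=> /ex[x xh Ix]; rewrite /J; case: xgetP => [y _ //|/(_ x)[]].
have J1 c : `|c| < e -> -1 < J c < 2^-1 /\ `|J c| < d.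
  by move=> /JP[+ _]; rewrite ler_norml ltr_norml => H; split; lra.
have dJ (c : R) : `|c| < e -> is_derive c 1 J (k (J c))^-1.
  move=> ce; have [Jh IJ] := JP c ce; have [J11 Jd] := J1 c ce.
  have -> : c = I (J c) - I 0 by rewrite IJ addrAC subrr add0r.
  rewrite (_ : J (I (J c) - I 0) = J c); last by congr J; rewrite IJ addrAC subrr add0r.
  apply: (@is_derive_inverse R (fun x => I x - I 0)).
  - have cN : {for J c, continuous (fun x => `|I x - I 0| : R^o)}.
      apply: cvg_norm; apply: cvgB; last exact: cvg_cst.
      by apply: cI; case/andP: J11.
    have N1 : \forall x \near J c, `|I x - I 0| < e.
      by apply: (@cvgr_lt _ _ (nbhs (J c)) _ _ _ cN); rewrite IJ addrAC subrr add0r.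
    have N2 : \forall x \near J c, `|x| < d.
      have cid : {for J c, continuous (fun x : R => `|x| : R^o)} by apply: cvg_norm; exact: cvg_id.
      exact: (@cvgr_lt _ _ (nbhs (J c)) _ _ _ cid).
    have N3 : \forall x \near J c, -1 < x.
      by apply: open_nbhs_nbhs; split; [exact: open_gt|case/andP: J11].
    near=> x.
    have xe : `|I x - I 0| < e by near: x.
    have [Jxh IJx] := JP _ xe; have [J1x Jdx] := J1 _ xe.
    apply: inj => //; first by near: x.
    + by case/andP: J1x.
    + by near: x.
    + by rewrite IJx addrCA subrr addr0.
  - have N3 : \forall x \near J c, -1 < x.
      by apply: open_nbhs_nbhs; split; [exact: open_gt|case/andP: J11].
    near=> x; apply: cvgB; last exact: cvg_cst.
    by apply: cI; near: x.
  - have dIJ : is_derive (J c) 1 I (k (J c)) by apply: dI; case/andP: J11.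
    have := is_deriveB dIJ (is_derive_cst (I 0) (J c) 1); rewrite subr0; exact.
  - by rewrite gt_eqF// dk.
exists e, J; split => // [c ce|].
  by have [Jh ->] := JP c ce; split => //; apply: (le_lt_trans Jh); lra.
set O := [set x | _].
have oO : open O.
  rewrite (_ : O = setT `&` (fun x : 'rV[R]_1 => x 0 0) @^-1` (ball (0 : R) e)).
    apply: (@open_preimage R _ R^o) => //; [exact: openT|exact: ball_open|exact: smooth_coord].
  by apply/seteqP; split => x; rewrite /O -ball_normE /= sub0r normrN; [split|case].
have DJ x v : O x -> is_derive (0 : R) 1 (fun u : R => J ((x + u *: v) 0 0)) ((k (J (x 0 0)))^-1 * v 0 0).
  move=> Ox; rewrite (_ : (fun u => _) = fun u => J (v 0 0 * u + x 0 0)).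
    apply: (is_derive_comp (f := fun u => v 0 0 * u + x 0 0)); first exact: is_derive_affine1.
    by rewrite mulr0 add0r; exact: dJ.
  by apply/funext => u; rewrite !mxE addrC mulrC.
elim=> [|m IH].
  move=> x Ox; apply: (@continuous_comp _ _ _ (fun x : 'rV[R]_1 => x 0 0) J).
    exact: coord_continuous.
  apply: differentiable_continuous; apply/derivable1_diffP.
  by have [] := dJ _ Ox.
split=> [x Ox|v].
  apply: (@differentiable_comp _ _ _ _ (fun x : 'rV[R]_1 => x 0 0 : R^o) J).
    by have [+ _] := @smooth_coord R 1 setT 0 1%N; exact.
  by apply/derivable1_diffP; have [] := dJ _ Ox.
apply: (@Ck_ext _ _ _ _ _ _ (fun x : 'rV[R]_1 => v 0 0 * (k (J (x 0 0)))^-1 : R^o)) => //.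
  by move=> x Ox; rewrite mulrC; apply: derive_lineE; exact: DJ.
apply: (@CkZ _ _ _ R^o) => //; first exact: Ck_cst.
apply: CkV => // [x Ox|].
  by rewrite gt_eqF// dk//; have [] := J1 _ Ox.
apply: (@Ck_ext _ _ _ _ _ _ (((fun x : 'rV[R]_1 => k (x 0 0)) : _ -> R^o) \o
   (fun x : 'rV[R]_1 => J (x 0 0) *: (const_mx 1 : 'rV[R]_1)))) => //.
  by move=> x _; rewrite /= !mxE mulr1.
apply: (Ck_comp oO openT) => //.
by apply: CkZ => //; exact: Ck_cst.
Unshelve. all: by end_near. Qed.

End Inverse.

Section Isotropy.
Context {R : realType} (s : smashing R) (X : diffSpace R).
Variables (w : dform 2 X) (x0 : X) (l : loop_basis x0).
Hypothesis conn : dconnected X.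

Let hl := holo s w l conn.
Let Kw : pre_dform 1 (Paths X) := Kop w.
Let pio := pi_omega s w l.

(** With both ends fixed, one base path [d] conjugates the whole family into based loops. As [d] is
    constant in the family it adds nothing to [Kw], and [psi_var] applies. *)
Lemma holo_var (x : X) (Q : 'rV[R]_1 -> Paths X) : plot setT Q ->
  (forall r, ev 0 (Q r) = x /\ ev 1 (Q r) = x) ->
  hl (Q (const_mx 1)) = hl (Q (const_mx 0)) +
    pio (int01 (fun t => Kw setT Q (const_mx t) (fun=> const_mx 1))).
Proof.
move=> pQ Q01; have dw := dformP w.
have Q0 r : ev 0 (Q r) = x by case: (Q01 r).
have Q1 r : ev 1 (Q r) = x by case: (Q01 r).
pose d := base_path x0 conn x.
have d0 : ev 0 d = x0 by exact: base_path0.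
have d1 : ev 1 d = x by exact: base_path1.
have pd := plot_fixed d; have prd := plot_fixed (Defs.rev_path d).
have pdQ : plot setT (fun r => concat s d (Q r)) by apply: plot_concat => // r _; rewrite d1.
have dQ r : ev 1 (concat s d (Q r)) = ev 0 (Defs.rev_path d).
  by rewrite ev1_concat ?d1// ev0_rev Q1.
have pN : plot setT (fun r => concat s (concat s d (Q r)) (Defs.rev_path d)).
  exact: plot_concat.
have N0 r : ev 0 (concat s (concat s d (Q r)) (Defs.rev_path d)) = x0 /\
            ev 1 (concat s (concat s d (Q r)) (Defs.rev_path d)) = x0.
  by rewrite ev0_concat// ev0_concat ?d1// ev1_concat// ev1_rev d0.
rewrite /hl /holo !Q0 !Q1 -/d.
have := psi_var s w l pN N0; rewrite /hol => ->; congr (_ + pi_omega _ _ _ _).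
apply: eq_int01 => t _; rewrite (Kop_concat s _ dw pdQ prd)// (Kop_concat s _ dw pd pQ)//.
  by rewrite !(Kw_cst w _ _ openT)// add0r addr0.
by move=> r _; rewrite d1.
Qed.

Lemma path_integral_Kop (Y : diffSpace R) (a : pre_dform 1 Y) n (V : set 'rV[R]_n)
    (S : 'rV[R]_n -> Paths Y) t : is_dform a -> plot V S -> V t ->
  path_integral a (S t) = Kop a V S t (fun=> 0).
Proof.
move=> da pS Vt; rewrite (path_integralE da).
have sc : smooth setT (fun _ : 'rV[R]_1 => t) by exact: smooth_cst.
rewrite (dform_compat (Kop_is_dform da) pS openT sc)//.
by congr (Kop a _ _ _ _); apply/funext => -[].
Qed.

(** The plot is contracted to [Q r] by rays in [Paths X]. By [holo_var] the holonomy changes along a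
    ray by the integral of [Kw], which is the 0-form [Kop Kw] on the plot of rays and therefore
    smooth in t. *)
Lemma holo_lift (x : X) n (V : set 'rV[R]_n) (Q : 'rV[R]_n -> Paths X) r :
  plot V Q -> V r -> (forall t, V t -> ev 0 (Q t) = x /\ ev 1 (Q t) = x) ->
  exists V' (c : 'rV[R]_n -> R), [/\ V' r, V' `<=` V, open V',
    smooth V' (c : _ -> R^o) & forall t, V' t -> hl (Q t) = pio (c t)].
Proof.
move=> pQ Vr Q01; have dK := Kw_dform w.
have [V' [S [V'r V'V pS VS QS]]] := plot_ray (X := Paths X) s pQ Vr.
have [c0 c0E] := pi_omega_surj (hl (Q r)).
have e0 := smash_eps_gt0 s.
have s0 : s 0 = 0 by apply: smash_left; lra.
have s1 : s 1 = 1 by apply: smash_right; lra.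
have oV' := plot_open pS.
exists V', (fun t => c0 + Kop Kw V' S t (fun=> 0)); split => //.
  apply: smoothD => //; first exact: smooth_cst.
  exact: (dform_smooth (Kop_is_dform dK) pS).
move=> t V't; rewrite /pio pi_omegaD c0E -path_integral_Kop//.
have pN : plot setT (fun x : 'rV[R]_1 => ev (x 0 0) (S t)) by exact: (plot_line (S t)).
have S01 (y : 'rV[R]_1) : ev 0 (ev (y 0 0) (S t)) = x /\ ev 1 (ev (y 0 0) (S t)) = x.
  by rewrite QS//; apply: Q01; exact: VS.
have := holo_var pN S01; rewrite !mxE !QS// s0 s1 scale0r addr0 scale1r addrC subrK => ->.
by rewrite addrC.
Qed.

End Isotropy.

(** * Small loops with prescribed holonomy, and the isotropy isomorphism *)

Section SmallLoops.
Context {R : realType} (s : smashing R) (X : diffSpace R).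
Variables (w : dform 2 X) (x0 : X) (l : loop_basis x0).
Hypothesis conn : dconnected X.
Hypothesis w_neq0 : ~ dform_eq w (@zero_dform R 2 X).

Let cls := class_omega s w l.
Let hl := holo s w l conn.
Let Kw : pre_dform 1 (Paths X) := Kop w.
Let pio := pi_omega s w l.

Lemma plot_curry (Y : diffSpace R) n (N : 'rV[R]_(1 + n) -> Y) : plot setT N ->
  exists2 Q : 'rV[R]_n -> Paths Y, plot setT Q & forall t r, ev t (Q r) = N (tpoint t r).
Proof.
move=> pN.
have sN r : dsmooth (X := real_line R) (fun t => N (tpoint t r)).
  move=> m W a [oW sa]; apply: (plot_comp pN oW (F := fun z => tpoint (a z) r)) => //.
  by apply: smooth_tpoint => //; exact: smooth_cst.
exists (fun r => exist _ _ (sN r)) => //; apply: plot_Paths; first exact: openT.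
by apply: (plot_ext pN) => z _; rewrite /Kplot /ev /= tpoint_eta.
Qed.

Lemma positive_value : exists n (U : set 'rV[R]_n) P r v,
  [/\ plot U P, U r & 0 < dform_val w U P r v].
Proof.
apply: contrapT => H; apply: w_neq0 => n U P pP r Ur v; rewrite /zero_dform.
apply/eqP; rewrite eq_le; apply/andP; split; rewrite leNgt; apply/negP => wv; apply: H.
  by exists n, U, P, r, v.
(* A negative value becomes positive when one vector changes sign. *)
exists n, U, P, r, [eta v with ord0 |-> -1 *: v ord0]; split => //.
rewrite (dform_scale (dformP w) pP)//.
rewrite (_ : [eta v with ord0 |-> v ord0] = v :> (_ -> _)); first by rewrite mulN1r oppr_gt0.
by apply/funext => i /=; case: eqP => [->|].
Qed.

Let E : 'I_2 -> 'rV[R]_(1 + 1) := Kvec (fun _ : 'I_1 => const_mx 1).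

(** The plane is sent into [U] by r + th(a) v0 + th(b) v1 with [th] from [bump]. At the origin the
    coordinate frame [E] goes to (rho v0, rho v1), which multiplies the positive value by rho^2. *)
Lemma plane_plot : exists2 M : 'rV[R]_(1 + 1) -> X, plot setT M &
  0 < dform_val w setT M (tpoint 0 0) E.
Proof.
have dw := dformP w.
have [n [U [P [r [v [pP Ur wv]]]]]] := positive_value.
have oU := plot_open pP.
have /nbhs_normP[e /= e0 eU] := open_nbhs_nbhs (conj oU Ur).
pose v0 := v ord0; pose v1 := v (lift ord0 ord0).
have nv : 0 < 1 + `|v0| + `|v1| by have := normr_ge0 v0; have := normr_ge0 v1; lra.
pose rho := e / (1 + `|v0| + `|v1|).
have rho0 : 0 < rho by rewrite divr_gt0.
have [th [sth th0 dth thr]] := bump rho0.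
pose F (z : 'rV[R]_(1 + 1)) := r + (th (lsubmx z 0 0) *: v0 + th (rsubmx z 0 0) *: v1).
have FU z : U (F z).
  apply: eU; rewrite /ball_/= opprD addNKr normrN; apply: (le_lt_trans (ler_normD _ _)).
  rewrite !normrZ; apply: (@le_lt_trans _ _ (rho * (`|v0| + `|v1|))).
    by rewrite mulrDr lerD// ler_wpM2r// ltW.
  by rewrite /rho mulrAC ltr_pdivrMr// ltr_pM2l//; lra.
have sr : smooth setT ((fun z : 'rV[R]_(1 + 1) => rsubmx z 0 0) : _ -> R^o).
  rewrite (_ : (fun z : 'rV[R]_(1 + 1) => _) = fun z => z 0 (rshift 1 0)).
    exact: smooth_coord.
  by apply/funext => z; rewrite mxE.
have oT : open (setT : set 'rV[R]_(1 + 1)) by exact: openT.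
have sF : smooth setT F.
  apply: smoothD => //; first exact: smooth_cst.
  apply: smoothD => //; apply: smoothZ => //; try exact: smooth_cst.
    by apply: dsmooth_smooth => //; exact: smooth_time.
  exact: dsmooth_smooth.
exists (P \o F); first exact: (plot_comp pP oT sF).
rewrite (dform_compat dw pP oT sF)//.
have Frs t (c : 'rV[R]_1) : F (tpoint t c) = r + (th t *: v0 + th (c 0 0) *: v1).
  by rewrite /F tpoint_time rsub_tpoint.
have F0 : F (tpoint 0 0) = r by rewrite Frs mxE th0 !scale0r !addr0.
rewrite F0 (_ : (fun i => _) = [eta [eta v with lift ord0 ord0 |-> rho *: v1] with ord0 |-> rho *: v0]).
  rewrite (dform_scale dw pP)//.
  rewrite (_ : [eta _ with ord0 |-> v0] = [eta v with lift ord0 ord0 |-> rho *: v1] :> (_ -> _)).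
    rewrite (dform_scale dw pP)//.
    rewrite (_ : [eta v with _ |-> v1] = v :> (_ -> _)); first by rewrite !mulr_gt0.
    by apply/funext => i /=; case: eqP => [->|].
  by apply/funext => i /=; case: eqP => [->|].
apply/funext => i /=; rewrite /E; case: (unliftP ord0 i) => [j ->|->].
  rewrite ord1 /= Kvec_lift; apply: derive_lineE.
  rewrite (_ : (fun u => _) = fun u : R => r + th u *: v1); first exact: is_derive_affine.
  by apply/funext => u; rewrite -tpointD Frs add0r !mxE mulr1 th0 scale0r add0r.
rewrite /= Kvec0; apply: derive_lineE.
rewrite (_ : (fun u => _) = fun u : R => r + th u *: v0); first exact: is_derive_affine.
by apply/funext => u; rewrite -tpointDl Frs add0r mxE th0 scale0r addr0.
Qed.

(** The arcs t -> (A t, c t (1 - t)) of the plane have the same ends for all c. At c = 0 the value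
    of [Kw] is A times the integral of t (1 - t) f(A t), where f(a) is the value of [w] on the frame
    at (a, 0). *)
Lemma small_family : exists2 La : 'rV[R]_1 -> Paths X, plot setT La &
  [/\ forall c, ev 0 (La c) = ev 0 (La 0), forall c, ev 1 (La c) = ev 1 (La 0) &
      0 < Kw setT La (const_mx 0) (fun=> const_mx 1)].
Proof.
have dw := dformP w.
have [M pM sig0] := plane_plot.
pose f (a : R) := dform_val w setT M (tpoint a 0) E.
have cf : continuous f.
  apply: (cont_tslice (U := setT) (h := fun z => dform_val w setT M z E)) => //.
  apply: Ck_sub (dform_smooth dw pM E 0%N); exact: subsetT.
(* A is small enough for f to vary by at most f(0) / 2 along the arc. As t (1 - t) has integral 1/6
   and maximum 1/4, the integral is at least f(0) (1/6 - 1/8), which is positive. *)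
have [A A0 Af] : exists2 A : R, 0 < A & forall t, 0 <= t <= 1 -> `|f (A * t) - f 0| <= f 0 / 2.
  have f2 : 0 < f 0 / 2 by rewrite divr_gt0.
  have /cvgr_dist_lt/(_ _ f2)/nbhs_normP[d /= d0 H] := cf 0.
  exists (d / 2); first by rewrite divr_gt0.
  move=> t t01; rewrite distrC; apply/ltW/H.
  rewrite /ball_/= sub0r normrN ger0_norm; nra.
have oT : open (setT : set 'rV[R]_(1 + 1)) by exact: openT.
pose G (z : 'rV[R]_(1 + 1)) : 'rV[R]_(1 + 1) := tpoint (A * lsubmx z 0 0)
  ((rsubmx z 0 0 * (lsubmx z 0 0 * (1 + -1 * lsubmx z 0 0))) *: const_mx 1).
have sG : smooth setT G.
  have sr : smooth setT ((fun z : 'rV[R]_(1 + 1) => rsubmx z 0 0) : _ -> R^o).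
    rewrite (_ : (fun z : 'rV[R]_(1 + 1) => _) = fun z => z 0 (rshift 1 0)).
      exact: smooth_coord.
    by apply/funext => z; rewrite mxE.
  have st := @smooth_time R 1 setT.
  have sc c : smooth setT ((fun _ : 'rV[R]_(1 + 1) => c) : _ -> R^o) by exact: smooth_cst.
  apply: smooth_tpoint => //; first exact: smoothM.
  apply: smoothZ => //; last exact: smooth_cst.
  by apply: smoothM => //; apply: smoothM => //; apply: smoothD => //; exact: smoothM.
have pN := plot_comp pM oT sG (fun z _ => I).
have [La pLa LaE] := plot_curry pN.
exists La => //; split.
- by move=> c; rewrite !LaE /= /G !rsub_tpoint !tpoint_time !mul0r !mulr0.
- by move=> c; rewrite !LaE /= /G !rsub_tpoint !tpoint_time mulN1r subrr !mulr0.
have GE t (c : 'rV[R]_1) : G (tpoint t c) =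
    tpoint (A * t) ((c 0 0 * (t * (1 + -1 * t))) *: const_mx 1).
  by rewrite /G rsub_tpoint tpoint_time.
pose q t : R := t * (1 + -1 * t).
have dE t : dform_val w (cyl setT) (Kplot La) (tpoint t (const_mx 0)) (Kvec (fun=> const_mx 1)) =
    A * (q t * f (A * t)).
  have oc : open (cyl (setT : set 'rV[R]_1)) by exact: open_cyl openT.
  have sGc : smooth (cyl setT) G by exact: smooth_sub sG.
  rewrite (dform_compat dw pM oc sGc)//; last first.
    by move=> z _; rewrite /Kplot LaE tpoint_eta.
  have e00 : (const_mx 0 : 'rV[R]_1) 0 0 = 0 by rewrite mxE.
  rewrite GE e00 mul0r scale0r.
  rewrite (_ : (fun i => _) = [eta [eta E with lift ord0 ord0 |-> q t *: E (lift ord0 ord0)]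
     with ord0 |-> A *: E ord0]).
    rewrite (dform_scale dw pM)//; congr (_ * _).
    rewrite (_ : [eta _ with ord0 |-> E ord0] = [eta E with lift ord0 ord0 |-> q t *: E (lift ord0 ord0)] :> (_ -> _)).
      rewrite (dform_scale dw pM)//; congr (_ * dform_val w _ _ _ _).
      by apply/funext => i /=; case: eqP => [->|].
    by apply/funext => i /=; case: eqP => [->|].
  apply/funext => i /=; case: (unliftP ord0 i) => [j ->|->].
    rewrite ord1 /= /E !Kvec_lift; apply: derive_affine => u.
    rewrite -tpointD !GE !mxE add0r mulr1 mul0r scale0r -scalerA -/(q t).
    by rewrite scale_row_mx scaler0 -tpointD add0r.
  rewrite /= /E !Kvec0; apply: derive_affine => u.
  by rewrite -tpointDl !GE e00 !mul0r !scale0r mulrDr tpointDl scalerA [u * A]mulrC.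
rewrite /Kw KopE; under eq_int01 do rewrite dE.
have cA : continuous (fun t : R => A * t).
  by move=> t; apply: cvgM; [exact: cvg_cst|exact: cvg_id].
have cfA : continuous (fun t : R => f (A * t)).
  by move=> t; apply: (@continuous_comp _ _ _ (fun t : R => A * t) f); [exact: cA|exact: cf].
have cq : continuous q.
  move=> t; apply: cvgM; first exact: cvg_id.
  by apply: cvgD; [exact: cvg_cst|apply: cvgM; [exact: cvg_cst|exact: cvg_id]].
have cqf : continuous (fun t => q t * f (A * t)).
  by move=> t; apply: cvgM; [exact: cq|exact: cfA].
have cqd : continuous (fun t => q t * (f (A * t) - f 0)).
  move=> t; apply: cvgM; first exact: cq.
  by apply: cvgB; [exact: cfA|exact: cvg_cst].
rewrite int01Z// mulr_gt0//.
have -> : int01 (fun t => q t * f (A * t)) = f 0 * int01 q + int01 (fun t => q t * (f (A * t) - f 0)).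
  rewrite -int01Z// -int01D//; last by move=> t; apply: cvgM; [exact: cvg_cst|exact: cq].
  by apply: eq_int01 => t _; ring.
have -> : int01 q = 6^-1.
  pose Fq (t : R) : R := t * (t * (2^-1 - t * 3^-1)).
  suff -> : int01 q = Fq 1 - Fq 0 by rewrite /Fq; lra.
  apply: int01_ftc => // t _; apply/is_derive1_caratheodory.
  exists (fun z => (z + t) * 2^-1 - (z * z + z * t + t * t) * 3^-1); split.
  - by move=> z; rewrite /Fq; field.
  - apply: cvgB; apply: cvgM; try exact: cvg_cst.
      by apply: cvgD; [exact: cvg_id|exact: cvg_cst].
    by apply: cvgD; [apply: cvgD; apply: cvgM; try exact: cvg_id; exact: cvg_cst|exact: cvg_cst].
  - by rewrite /q; field.
have : `|int01 (fun t => q t * (f (A * t) - f 0))| <= 4^-1 * (f 0 / 2).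
  apply: int01_le => // t t01; rewrite normrM ler_pM//; last exact: Af.
  have sq : 0 <= (t - 2^-1) * (t - 2^-1) by rewrite -expr2 sqr_ge0.
  have q0 : 0 <= q t by rewrite /q mulr_ge0//; lra.
  by rewrite ger0_norm// /q; lra.
have f0 : 0 < f 0 by [].
rewrite ler_norml => H; lra.
Qed.

(** Closing the arcs by the reverse of the arc at 0 gives loops whose holonomy at parameter c is the
    class of I(c) - I(0), with [I] a primitive of [Kw]. Reparametrizing by the inverse [J] makes it
    exactly the class of c. *)
Lemma small_loops : exists (y : X) (e : R) (L : R -> Paths X), [/\ 0 < e,
  forall c, `|c| < e -> [/\ ev 0 (L c) = y, ev 1 (L c) = y & hl (L c) = pio c] &
  forall n (U : set 'rV[R]_n) (a : 'rV[R]_n -> R), open U -> smooth U (a : _ -> R^o) ->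
    (forall t, U t -> `|a t| < e) -> plot U (fun t => L (a t))].
Proof.
have dw := dformP w.
have [La pLa [La0 La1 k0]] := small_family.
pose N x := concat s (La x) (Defs.rev_path (La 0)).
have pr : plot setT (fun _ : 'rV[R]_1 => Defs.rev_path (La 0)) by exact: plot_fixed.
have LL x : ev 1 (La x) = ev 0 (Defs.rev_path (La 0)) by rewrite ev0_rev.
have pN : plot setT N by exact: plot_concat.
have N01 x : ev 0 (N x) = ev 0 (La 0) /\ ev 1 (N x) = ev 0 (La 0).
  by rewrite /N ev0_concat// ev1_concat// ev1_rev La0.
have KN x v : Kw setT N x v = Kw setT La x v.
  by rewrite /Kw (Kop_concat s v dw pLa pr)// (Kw_cst w _ _ openT)// addr0.
have [I dI] := antiderivative (@Kw_line_cont _ _ w _ pN).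
have [|e [J [e0 JP sJ]]] := smooth_inverse dI (Kw_line_smooth w pN).
  by rewrite -/Kw KN.
exists (ev 0 (La 0)), e, (fun c => N (const_mx (J c))); split => //.
  move=> c ce; have [N0 N1] := N01 (const_mx (J c)); split => //.
  have [Jc IJ] := JP c ce.
  have sb : smooth setT (fun x : 'rV[R]_1 => J c *: x).
    by apply: smoothZ; [exact: openT|exact: smooth_cst|exact: smooth_id].
  have pNb : plot setT (fun x => N (J c *: x)).
    by apply: (plot_comp pN openT (F := fun x => J c *: x)).
  have := holo_var s w l conn pNb (fun x => N01 _).
  rewrite (Kw_line pN dI); last by rewrite -ltr_norml.
  rewrite IJ addrAC subrr add0r.
  have -> : J c *: const_mx 1 = const_mx (J c) :> 'rV[R]_1.
    by apply/rowP => i; rewrite !mxE mulr1.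
  have -> : J c *: const_mx 0 = 0 :> 'rV[R]_1 by apply/rowP => i; rewrite !mxE mulr0.
  rewrite {2}/N holo_concat// holo_rev subrr add0r; exact.
move=> n U a oU sa ae; apply: (plot_comp pN oU (F := fun t => const_mx (J (a t)))) => //.
have oO : open [set x : 'rV[R]_1 | `|x 0 0| < e].
  rewrite (_ : [set x | _] = setT `&` (fun x : 'rV[R]_1 => x 0 0) @^-1` (ball (0 : R) e)).
    apply: (@open_preimage R _ R^o) => //; [exact: openT|exact: ball_open|exact: smooth_coord].
  by apply/seteqP; split => x; rewrite -ball_normE /= sub0r normrN; [split|case].
apply: (@smooth_ext _ _ _ _ _ (fun t => J (a t) *: const_mx 1)) => //.
  by move=> t _; apply/rowP => i; rewrite !mxE mulr1.
apply: smoothZ => //; last exact: smooth_cst.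
apply: (@smooth_ext _ _ _ _ _ (((fun x : 'rV[R]_1 => J (x 0 0)) : _ -> R^o) \o
   (fun t => a t *: (const_mx 1 : 'rV[R]_1)))) => //.
  by move=> t _; rewrite /= !mxE mulr1.
apply: (smooth_comp oU oO) => // [t Ut|]; first by rewrite /= !mxE mulr1; exact: ae.
by apply: smoothZ => //; exact: smooth_cst.
Qed.

(** The holonomy [g] separates morphisms with the same ends, and [holo_lift] makes it smooth. Both
    its surjectivity and the smoothness of its inverse [f] rest on [small_loops]. *)
Lemma isotropy_torus (x : X) : exists f : T_omega s w l -> isotropy s w l x,
  diffeomorphism (X := T_omega_space s w l) f /\
  (forall u v : T_omega s w l,
     sub_incl (f (u + v)) = mor_comp s w l (sub_incl (f u)) (sub_incl (f v))).
Proof.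
have srcE := src_class s w l conn; have trgE := trg_class s w l conn.
pose g (y : isotropy s w l x) : T_omega s w l := hl (quotient_rep (sub_incl y)).
have lift (y : isotropy s w l x) : exists p, [/\ sub_incl y = cls p, ev 0 p = x & ev 1 p = x].
  exists (quotient_rep (sub_incl y)).
  have [ys yt] := svalP y; have E1 := class_rep (sub_incl y).
  by split; [rewrite /cls E1|rewrite -srcE E1|rewrite -trgE E1].
have gE y p : sub_incl y = cls p -> g y = hl p.
  move=> yp; have /(class_eqP s w l conn)[_ _ H] : cls (quotient_rep (sub_incl y)) = cls p.
    by rewrite /cls class_rep.
  exact: H.
have mkP p : ev 0 p = x -> ev 1 p = x -> mor_src s w l (cls p) = x /\ mor_trg s w l (cls p) = x.
  by move=> p0 p1; rewrite srcE trgE.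
have injg y y' : g y = g y' -> sub_incl y = sub_incl y'.
  have [p [yp p0 p1]] := lift y; have [p' [yp' p'0 p'1]] := lift y'.
  rewrite (gE _ _ yp) (gE _ _ yp') yp yp' => H; apply/(class_eqP s w l conn).
  by rewrite p0 p1 p'0 p'1.
have [y [e [L [e0 LP pL]]]] := small_loops.
have [d [d0 d1]] := conn x y.
(* The small loops sit at [y]. Conjugation by [d] moves them to [x] and preserves the holonomy, as
   the values lie in a commutative group. *)
pose Lx c := concat s (concat s d (L c)) (Defs.rev_path d).
have dL c : `|c| < e -> ev 1 d = ev 0 (L c) by move=> /LP[-> _ _].
have Ld c : `|c| < e -> ev 1 (concat s d (L c)) = ev 0 (Defs.rev_path d).
  by move=> ce; rewrite (ev1_concat s (dL c ce)) ev0_rev d1; case: (LP c ce).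
have Lx0 c : `|c| < e -> ev 0 (Lx c) = x.
  by move=> ce; rewrite /Lx (ev0_concat s (Ld c ce)) (ev0_concat s (dL c ce)).
have Lx1 c : `|c| < e -> ev 1 (Lx c) = x.
  by move=> ce; rewrite /Lx (ev1_concat s (Ld c ce)) ev1_rev.
have hLx c : `|c| < e -> hl (Lx c) = pio c.
  move=> ce; rewrite /hl /Lx (holo_concat s w l conn (Ld c ce)) (holo_concat s w l conn (dL c ce)).
  rewrite holo_rev addrAC subrr add0r.
  by case: (LP c ce).
have surjg u : exists p, [/\ ev 0 p = x, ev 1 p = x & hl p = u].
  have [c <-] := pi_omega_surj u.
  (* The representative c is cut into n pieces smaller than e, and n small loops are multiplied. *)
  pose n := (Num.trunc (`|c| / e)).+1.
  have cn : `|c| / e < n%:R by exact: truncnS_gt.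
  have -> : c = (c / n%:R) *+ n by rewrite -mulr_natr divfK// pnatr_eq0.
  have ce : `|c / n%:R| < e.
    rewrite normrM normfV (ger0_norm (ler0n _ _)) ltr_pdivrMr ?ltr0n//.
    by rewrite mulrC -ltr_pdivrMr.
  elim: n {cn} (c / n%:R) ce => [|n IH] c' ce.
    by exists (cst_path x); rewrite /hl holo_cst mulr0n pi_omega0.
  have [p [p0 p1 hp]] := IH c' ce.
  exists (concat s (Lx c') p).
  have E1 : ev 1 (Lx c') = ev 0 p by rewrite Lx1// p0.
  by rewrite ev0_concat// ev1_concat// Lx0// /hl holo_concat// -/hl hLx// hp mulrS pi_omegaD.
have exf u : exists y : isotropy s w l x, g y = u.
  have [p [p0 p1 hp]] := surjg u.
  by exists (exist _ (cls p) (mkP p p0 p1)); rewrite -hp; exact: gE.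
pose f u := projT1 (cid (exf u)).
have fK u : g (f u) = u by rewrite /f; case: cid.
have eqI (z z' : isotropy s w l x) : sub_incl z = sub_incl z' -> z = z'.
  by case: z z' => [z hz] [z' hz'] /= zz'; apply: eq_exist.
have gK z : f (g z) = z by apply: eqI; apply: injg; rewrite fK.
have fE u p : ev 0 p = x -> ev 1 p = x -> hl p = u -> sub_incl (f u) = cls p.
  move=> p0 p1 hp; apply: (injg (f u) (exist _ (cls p) (mkP p p0 p1))).
  by rewrite fK -hp; apply/esym; exact: gE.
exists f; split.
  split.
    move=> n U P [oU lP]; split=> // r Ur.
    have [V [h [Vr VU [oV sh] Ph]]] := lP r Ur.
    have [p [p0 p1 hp]] := surjg (P r).
    pose V' := V `&` h @^-1` (ball (h r) e).
    have oV' : open V' by apply: (@open_preimage R _ R^o) => //; exact: ball_open.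
    have hV' t : V' t -> `|h t + - h r| < e.
      by case=> _ /=; rewrite -ball_normE /= distrC.
    have pLh : plot V' (fun t => L (h t + - h r)).
      apply: pL => //; apply: smoothD => //; last exact: smooth_cst.
      by apply: smooth_sub sh => t [].
    have pd : plot V' (fun=> d) by exact: plot_cst.
    have prd : plot V' (fun=> Defs.rev_path d) by exact: plot_cst.
    have pp : plot V' (fun=> p) by exact: plot_cst.
    have pdL : plot V' (fun t => concat s d (L (h t + - h r))).
      by apply: plot_concat => // t /hV'; exact: dL.
    have pLx : plot V' (fun t => Lx (h t + - h r)).
      by apply: plot_concat => // t /hV'; exact: Ld.
    (* A fixed loop [p] carries the value at [r]; the small loop carries only the increment h t - h
       r, which stays below e on [V']. *)
    exists V', (fun t => concat s p (Lx (h t + - h r))); split => //.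
    - by split => //=; exact: ballxx.
    - by move=> t [/VU].
    - by apply: plot_concat => // t /hV' he; rewrite Lx0.
    move=> t V't; have he := hV' _ V't.
    have E1 : ev 1 p = ev 0 (Lx (h t + - h r)) by rewrite Lx0.
    apply: fE; [by rewrite ev0_concat|by rewrite ev1_concat// Lx1|].
    rewrite /hl holo_concat// -/hl hLx// hp (Ph _ Vr) -/pio.
    rewrite Ph; last by case: V't.
    by rewrite -/(pi_omega s w l) /pio -pi_omegaD addrCA subrr addr0.
  exists g; split => //.
  move=> n U P [oU lP]; split=> // r Ur.
  have [V [Q [Vr VU pQ PQ]]] := lP r Ur.
  have Q01 t : V t -> ev 0 (Q t) = x /\ ev 1 (Q t) = x.
    move=> Vt; have := svalP (P t); rewrite /= PQ// -/(cls (Q t)) srcE trgE; exact.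
  have [V' [c [V'r V'V oV' sc cE]]] := holo_lift s w l conn pQ Vr Q01.
  exists V', c; split => //; first by move=> t /V'V/VU.
  move=> t V't; transitivity (hl (Q t)); last exact: cE.
  by apply: gE; exact: (PQ _ (V'V _ V't)).
move=> u v; have [p [p0 p1 hp]] := surjg u; have [q [q0 q1 hq]] := surjg v.
have pq : ev 1 p = ev 0 q by rewrite p1.
rewrite (fE u p)// (fE v q)// (comp_class s w l conn)//; apply: fE.
- by rewrite ev0_concat.
- by rewrite ev1_concat.
- by rewrite /hl holo_concat// -/hl hp hq.
Qed.

End SmallLoops.

(** The opening clauses tie the operations, which are computed on chosen representatives, to the
    formulas on classes. The isotropy clause assumes [w] nonzero because for w = 0 all the integrals
    vanish: then [P_omega] is trivial and [T_omega] is [R], whereas any two paths with the same ends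
    are equivalent and each isotropy group is a point. *)
Theorem theorem1 (R : realType) (s : smashing R) (X : diffSpace R)
    (w : dform 2 X) (x0 : X) (l : loop_basis x0) :
  closed_dform w ->
  dconnected X ->
  discrete_space (sub_space [set c : real_line R | c \in P_tor w]) ->
  [set c : R | c \in P_omega s w l] <> setT ->
  [/\ (forall p q : Paths X, class_omega s w l p = class_omega s w l q <->
         omega_equiv s w l p q),
      (forall p : Paths X, mor_src s w l (class_omega s w l p) = ev 0 p),
      (forall p : Paths X, mor_trg s w l (class_omega s w l p) = ev 1 p) &
      (forall p q : Paths X, ev 1 p = ev 0 q ->
         mor_comp s w l (class_omega s w l p) (class_omega s w l q) =
         class_omega s w l (concat s p q))] /\
  fibrating_groupoid (mor_src s w l) (mor_trg s w l)
                     (mor_comp s w l) /\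
  (~ dform_eq w (@zero_dform R 2 X) ->
   forall x : X, exists f : T_omega s w l -> isotropy s w l x,
     diffeomorphism (X := T_omega_space s w l) f /\
     (forall u v : T_omega s w l,
        sub_incl (f (u + v)) =
        mor_comp s w l (sub_incl (f u)) (sub_incl (f v)))) /\
  exists lambda : dform 1 (Mor s w l),
    [/\ left_right_invariant (mor_src s w l) (mor_trg s w l)
                             (mor_comp s w l) lambda,
        dform_eq (pullback (class_omega s w l) lambda) (Kop w),
        (forall lambda' : dform 1 (Mor s w l),
           left_right_invariant (mor_src s w l) (mor_trg s w l)
                                (mor_comp s w l) lambda' ->
           dform_eq (pullback (class_omega s w l) lambda') (Kop w) ->
           dform_eq lambda' lambda) &
        dform_eq (ext_d lambda)
          (sub_dform (pullback (mor_trg s w l) w)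
                     (pullback (mor_src s w l) w))].
Proof.
move=> cw conn _ proper; split; [split|split; [|split]].
- by move=> p q; exact: class_eq.
- by move=> p; exact: src_class.
- by move=> p; exact: trg_class.
- by move=> p q; exact: comp_class.
- exact: mor_fibrating.
- by move=> w0 x; exact: isotropy_torus.
have lamP := lam_dform conn proper.
exists (DForm lamP); split.
- exact: lam_invariant.
- exact: lam_class.
- by move=> lambda' _; exact: lam_unique.
- exact: lam_curvature.
Qed.
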